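(* Let $p>1$, $\frac1p+\frac1{p'}=1$, let $s_*\in(0,1)$, and let $g,d,h:[0,1]\to\mathbb{R}$ satisfy the standing assumptions on $g$, $d$, $h$ listed in the context. Put $h_M:=\sup_{s_*\le t\le 1}h(t)$, $h_m:=\inf_{0\le t\le s_*}h(t)$ and $$\mu_1:=\sup_{t\in(0,s_* )}\frac{-(d(t))^{\frac1{p-1}}g(t)}{(s_*-t)^{p'-1}}>0,\qquad \mu_2:=\sup_{t\in(s_*,1)}\frac{(d(t))^{\frac1{p-1}}g(t)}{(t-s_* )^{p'-1}}>0$$ (possibly $+\infty$). Suppose that either $$\liminf_{t\to s_*^-}\frac{(s_*-t)^{p'-1}(h(s_* )-h(t))}{-(d(t))^{\frac1{p-1}}g(t)}>-\infty$$ or $$\limsup_{t\to s_*^+}\frac{(t-s_* )^{p'-1}(h(s_* )-h(t))}{(d(t))^{\frac1{p-1}}g(t)}<\infty .$$ Then there is a number $c^*\in\mathbb{R}$ with $$h_m-(p')^{\frac1{p'}}p^{\frac1p}\mu_1^{\frac1{p'}}<c^*<h_M+(p')^{\frac1{p'}}p^{\frac1p}\mu_2^{\frac1{p'}}$$ such that the problem $$(d(U)|U'|^{p-2}U')'+(c-h(U))U'+g(U)=0 \ \text{ on } \mathbb{R},\qquad \lim_{z\to-\infty}U(z)=1,\quad \lim_{z\to+\infty}U(z)=0 \tag{P}$$ admits a unique profile $U=U(z)$, $z\in\mathbb{R}$, satisfying (i)–(iv) below if and only if $c=c^*$: (i) $U$ is strictly decreasing on the open interval $(z_0,z_1)=\{z\in\mathbb{R}:0<U(z)<1\}$,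 where $-\infty\le z_0<0<z_1\le+\infty$, $U(0)=\frac12$, $U(z)=1$ for $z\in(-\infty,z_0]$, and $U(z)=0$ for $z\in[z_1,+\infty)$. In particular, for every $z\in(z_0,z_1)$ both one-sided derivatives $U'(z-)$ and $U'(z+)$ exist and are nonzero. (ii) $M_U=\{\zeta_1,\zeta_2,\dots,\zeta_r\}$, and $U\in C(\mathbb{R})$ is piecewise $C^1$ in the sense that $U|_{(\zeta_i,\zeta_{i+1})}\in C^1(\zeta_i,\zeta_{i+1})$ for $i=0,1,\dots,r$, with $\zeta_0=z_0$, $\zeta_{r+1}=z_1$, and the one-sided derivatives $U'(\zeta_i\pm)=\lim_{z\to\zeta_i\pm}U'(z)$, $i=1,\dots,r$, exist and are finite. (iii) $\lim_{z\to z_0+}d(U(z))|U'(z)|^{p-2}U'(z)=\lim_{z\to z_1-}d(U(z))|U'(z)|^{p-2}U'(z)=0$, and $$|U'(\zeta_i-)|^{p-2}U'(\zeta_i-)\lim_{z\to\zeta_i-}d(U(z))=|U'(\zeta_i+)|^{p-2}U'(\zeta_i+)\lim_{z\to\zeta_i+}d(U(z)),\quad i=1,\dots,r.$$ (iv) $U$ satisfies (P) in the classical sense on $\mathbb{R}\setminus(\partial M_U\cup K_U\cup\partial N_U)$.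
   Context: Standing assumptions on $g,d,h$: - $g:[0,1]\to\mathbb{R}$ is continuous, $g(0)=g(s_* )=g(1)=0$, $g<0$ in $(0,s_* )$, $g>0$ in $(s_*,1)$. - $d:[0,1]\to\mathbb{R}$ is nonnegative, lower semicontinuous on $[0,1]$ and strictly positive in $(0,1)$. There are points $0=m_0<m_1<\dots<m_r<m_{r+1}=1$ such that $d$ has jump discontinuities at $m_i$ ($i=1,\dots,r$) and $d|_{(m_i,m_{i+1})}\in C(m_i,m_{i+1})$, $i=0,\dots,r$. In addition $d^{\frac1{p-1}}g\in L^1(0,1)$ and $\int_0^1(d(t))^{\frac1{p-1}}g(t)\,dt\ge0$. - $h:[0,1]\to\mathbb{R}$ is bounded and continuous at $s_*$. There are points $0=k_0<k_1<\dots<k_q<k_{q+1}=1$ such that $h$ has jump discontinuities at $k_j$ ($j=1,\dots,q$) and $h|_{(k_j,k_{j+1})}\in C(k_j,k_{j+1})$, $j=0,\dots,q$. Notation. For a monotone continuous $U:\mathbb{R}\to[0,1]$ set $M_U=\{z:U(z)=m_i \text{ for some } i=1,\dots,r\}$, $K_U=\{z:U(z)=k_j\text{ for some }j=1,\dots,q\}$, $N_U=\{z:U(z)=0\text{ or }U(z)=1\}$, $D_U=\partial M_U\cup\partial N_U$, and $H(u)=\int_0^u h(s)\,ds$. Monotone solution (profile). A monotone continuous function $U:\mathbb{R}\to[0,1]$ is a monotone solution of $(d(U)|U'|^{p-2}U')'+(c-h(U))U'+g(U)=0$ if: (a) $U\in C^1(\mathbb{R}\setminus D_U)$ and $U'(z)\ne0$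 for all $z\in\mathbb{R}\setminus D_U$ with $U(z)\in(0,1)$; (b) for any $z\in\partial M_U$ there exist finite nonzero one-sided derivatives $U'(z-),U'(z+)$ and $L(z):=|U'(z-)|^{p-2}U'(z-)\lim_{\xi\to z-}d(U(\xi))=|U'(z+)|^{p-2}U'(z+)\lim_{\xi\to z+}d(U(\xi))$; (c) the function $v:\mathbb{R}\to\mathbb{R}$ given by $v(z)=d(U(z))|U'(z)|^{p-2}U'(z)$ for $z\notin\partial M_U\cup\partial N_U$, $v(z)=0$ for $z\in\partial N_U$, $v(z)=L(z)$ for $z\in\partial M_U$, is continuous, satisfies, for all $z,\hat z\in\mathbb{R}$, $v(\hat z)-v(z)+c(U(\hat z)-U(z))-(H(U(\hat z))-H(U(z)))+\int_z^{\hat z}g(U(\tau))\,d\tau=0$, and $\lim_{z\to\pm\infty}v(z)=0$. A profile of (P) is a monotone solution, in this sense, that satisfies the boundary conditions in (P). *)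

(* Defs.v *)
From HB Require Import structures.
From mathcomp Require Import all_boot all_order all_algebra.
From mathcomp Require Import all_classical all_reals all_analysis.

Set Implicit Arguments.
Unset Strict Implicit.
Unset Printing Implicit Defensive.

Import Order.TTheory GRing.Theory Num.Theory.
Import numFieldNormedType.Exports.

Local Open Scope classical_set_scope.
Local Open Scope ring_scope.

Section Coefficients.
Context {R : realType}.
Implicit Types (f g d h : R -> R) (m : nat -> R).

Definition jump_discontinuity f (a : R) : Prop :=
  exists l1 l2 : R,
    [/\ f t @[t --> a^'-] --> l1, f t @[t --> a^'+] --> l2 & l1 != l2].

(* 0 = m 0 < m 1 < .. < m r < m r.+1 = 1; the other values of m are irrelevant *)
Definition subdivision (r : nat) m : Prop :=
  [/\ m 0%N = 0, m r.+1 = 1 & forall i, (i <= r)%N -> m i < m i.+1].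

Definition jumps_at (r : nat) m f : Prop :=
  [/\ subdivision r m,
      forall i, (0 < i <= r)%N -> jump_discontinuity f (m i) &
      forall i, (i <= r)%N -> {in `]m i, m i.+1[, continuous f}].

(* The coefficients are functions on [0, 1]: they are represented by functions
   R -> R of which only the restriction to [0, 1] is constrained and used. *)

Definition standing_g (sstar : R) g : Prop :=
  [/\ {within `[0, 1], continuous g},
      [/\ g 0 = 0, g sstar = 0 & g 1 = 0],
      (forall t, 0 < t < sstar -> g t < 0) &
      (forall t, sstar < t < 1 -> 0 < g t)].

Definition standing_d (p : R) g (r : nat) m d : Prop :=
  [/\ [/\ forall t, 0 <= t <= 1 -> 0 <= d t,
          lower_semicontinuous
            ((fun t => (d t)%:E) : subspace `[0, 1] -> \bar R) &
          forall t, 0 < t < 1 -> 0 < d t],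
      jumps_at r m d,
      (@lebesgue_measure R).-integrable `]0, 1[
        (fun t => (d t `^ (p - 1)^-1 * g t)%:E) &
      0 <= \int[@lebesgue_measure R]_(t in `]0, 1[)
             (d t `^ (p - 1)^-1 * g t)].

Definition standing_h (sstar : R) (q : nat) (k : nat -> R) h : Prop :=
  [/\ exists M : R, forall t, 0 <= t <= 1 -> `|h t| <= M,
      {for sstar, continuous h} &
      jumps_at q k h].

End Coefficients.

Section Calculus.
Context {R : realType}.
Implicit Types (f U : R -> R) (A : set R) (z : R).

Definition boundary A : set R := closure A `\` interior A.

(* f is C^1 on the open set A *)
Definition C1_on A f : Prop :=
  forall z, A z -> derivable f z 1 /\ {for z, continuous (derive1 f)}.

Definition left_derivable f z : Prop :=
  cvg (t^-1 *: (f (t + z) - f z) @[t --> 0^'-]).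

Definition right_derivable f z : Prop :=
  cvg (t^-1 *: (f (t + z) - f z) @[t --> 0^'+]).

Definition left_derive f z : R :=
  lim (t^-1 *: (f (t + z) - f z) @[t --> 0^'-]).

Definition right_derive f z : R :=
  lim (t^-1 *: (f (t + z) - f z) @[t --> 0^'+]).

(* \int_a^b f, with the usual orientation when b < a *)
Definition oriented_integral f (a b : R) : R :=
  if a <= b then \int[@lebesgue_measure R]_(t in `[a, b]) f t
  else - \int[@lebesgue_measure R]_(t in `[b, a]) f t.

(* one-sided limits at a possibly infinite end of an interval: z --> a+ for
   a < +oo, and z --> b- for -oo < b *)
Definition ereal_at_right (a : \bar R) : set_system R :=
  if a is x%:E then x^'+ else ninfty_nbhs R.

Definition ereal_at_left (b : \bar R) : set_system R :=
  if b is x%:E then x^'- else pinfty_nbhs R.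

(* |x|^(p-2) x; its value at x = 0 is 0 for every p *)
Definition plap (p x : R) : R := `|x| `^ (p - 2) * x.

End Calculus.

Section Profiles.
Context {R : realType}.
Variables (p c : R) (g d h : R -> R).
(* jump points m 1, .., m r of d and k 1, .., k q of h *)
Variables (r q : nat) (m k : nat -> R).
Implicit Types (U : R -> R) (z : R).

Definition M_ U : set R := [set z | exists2 i, (0 < i <= r)%N & U z = m i].
Definition K_ U : set R := [set z | exists2 j, (0 < j <= q)%N & U z = k j].
Definition N_ U : set R := [set z | U z = 0 \/ U z = 1].
Definition D_ U : set R := boundary (M_ U) `|` boundary (N_ U).

Definition H_ (u : R) : R := oriented_integral h 0 u.

Definition left_flux U z : R :=
  plap p (left_derive U z) * lim (d (U xi) @[xi --> z^'-]).

Definition right_flux U z : R :=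
  plap p (right_derive U z) * lim (d (U xi) @[xi --> z^'+]).

Definition flux_matching U z : Prop :=
  [/\ cvg (d (U xi) @[xi --> z^'-]), cvg (d (U xi) @[xi --> z^'+]) &
      left_flux U z = right_flux U z].

(* For U continuous the two boundaries are disjoint, so the order of the tests
   does not matter; on the boundary of M_ U the value is the common value L(z)
   of the two one-sided fluxes. *)
Definition flux U z : R :=
  if `[< boundary (N_ U) z >] then 0
  else if `[< boundary (M_ U) z >] then left_flux U z
  else d (U z) * plap p (derive1 U z).

Record monotone_solution U : Prop := MonotoneSolution {
  sol_continuous : continuous U ;
  sol_range : forall z, 0 <= U z <= 1 ;
  sol_monotone : {homo U : x y / x <= y} \/ {homo U : x y /~ x <= y} ;
  sol_C1 : C1_on (~` D_ U) U ;
  sol_derive_neq0 : forall z, ~ D_ U z -> 0 < U z < 1 -> derive1 U z != 0 ;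
  sol_sides : forall z, boundary (M_ U) z ->
    [/\ left_derivable U z, right_derivable U z,
        left_derive U z != 0, right_derive U z != 0 & flux_matching U z] ;
  sol_flux_continuous : continuous (flux U) ;
  sol_balance : forall z z' : R,
    flux U z' - flux U z + c * (U z' - U z) - (H_ (U z') - H_ (U z))
      + oriented_integral (g \o U) z z' = 0 ;
  sol_flux_pinfty : flux U z @[z --> +oo] --> (0 : R) ;
  sol_flux_ninfty : flux U z @[z --> -oo] --> (0 : R)
}.

Definition profile U : Prop :=
  [/\ monotone_solution U, U z @[z --> -oo] --> (1 : R) &
      U z @[z --> +oo] --> (0 : R)].

Definition property_i U (z0 z1 : \bar R) : Prop :=
  [/\ (z0 < 0)%E /\ (0 < z1)%E,
      [set z | 0 < U z < 1] = [set z | (z0 < z%:E < z1)%E],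
      (forall x y, (z0 < x%:E)%E -> x < y -> (y%:E < z1)%E -> U y < U x),
      [/\ U 0 = 2^-1, (forall z, (z%:E <= z0)%E -> U z = 1) &
          (forall z, (z1 <= z%:E)%E -> U z = 0)] &
      (forall z, (z0 < z%:E < z1)%E ->
         [/\ left_derivable U z, right_derivable U z,
             left_derive U z != 0 & right_derive U z != 0])].

Definition property_ii U (z0 z1 : \bar R) (zeta : nat -> \bar R) : Prop :=
  [/\ [/\ zeta 0%N = z0, zeta r.+1 = z1 &
          forall i, (i <= r)%N -> (zeta i < zeta i.+1)%E],
      M_ U = [set z | exists2 i, (0 < i <= r)%N & zeta i = z%:E],
      (forall i, (i <= r)%N ->
         C1_on [set z | (zeta i < z%:E < zeta i.+1)%E] U) &
      (forall i, (0 < i <= r)%N ->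
         let x := fine (zeta i) in
         [/\ left_derivable U x, right_derivable U x,
             derive1 U z @[z --> x^'-] --> left_derive U x &
             derive1 U z @[z --> x^'+] --> right_derive U x])].

Definition property_iii U (z0 z1 : \bar R) (zeta : nat -> \bar R) : Prop :=
  [/\ d (U z) * plap p (derive1 U z) @[z --> ereal_at_right z0] --> (0 : R),
      d (U z) * plap p (derive1 U z) @[z --> ereal_at_left z1] --> (0 : R) &
      forall i, (0 < i <= r)%N -> flux_matching U (fine (zeta i))].

Definition property_iv U : Prop :=
  forall z, ~ (boundary (M_ U) `|` K_ U `|` boundary (N_ U)) z ->
    let w := fun x => d (U x) * plap p (derive1 U x) in
    [/\ derivable U z 1, derivable w z 1 &
        derive1 w z + (c - h (U z)) * derive1 U z + g (U z) = 0].

Definition regular_profile U : Prop :=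
  profile U /\
  exists (z0 z1 : \bar R) (zeta : nat -> \bar R),
    [/\ property_i U z0 z1, property_ii U z0 z1 zeta,
        property_iii U z0 z1 zeta & property_iv U].

End Profiles.

Section Bounds.
Context {R : realType}.
Variables (p p' sstar : R) (g d h : R -> R).

Definition h_M : R := sup [set h t | t in `[sstar, 1]].
Definition h_m : R := inf [set h t | t in `[0, sstar]].

Definition mu_1 : \bar R := ereal_sup
  [set (- (d t `^ (p - 1)^-1 * g t) / (sstar - t) `^ (p' - 1))%:E
    | t in `]0, sstar[].

Definition mu_2 : \bar R := ereal_sup
  [set (d t `^ (p - 1)^-1 * g t / (t - sstar) `^ (p' - 1))%:E
    | t in `]sstar, 1[].

Definition liminf_left : \bar R := limf_einf
  (fun t => ((sstar - t) `^ (p' - 1) * (h sstar - h t)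
               / - (d t `^ (p - 1)^-1 * g t))%:E) sstar^'-.

Definition limsup_right : \bar R := limf_esup
  (fun t => ((t - sstar) `^ (p' - 1) * (h sstar - h t)
               / (d t `^ (p - 1)^-1 * g t))%:E) sstar^'+.

End Bounds.

(* Main.v *)
Require Import Defs.
From HB Require Import structures.
From mathcomp Require Import all_boot all_order all_algebra.
From mathcomp Require Import all_classical all_reals all_analysis.
From mathcomp Require Import ring lra.

Set Implicit Arguments.
Unset Strict Implicit.
Unset Printing Implicit Defensive.

Import Order.TTheory GRing.Theory Num.Theory.
Import numFieldNormedType.Exports.

Local Open Scope classical_set_scope.
Local Open Scope ring_scope.

(** A decreasing profile is determined by its flux as a function of its own value.
    Put r = 1/(p-1), f = d^r g and, for a profile U of speed c, let W(u) be the
    opposite of the flux at the point where U = u. Multiplying the equation of the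
    profile by dz/du gives, on ]0, 1[ and away from the jumps of d and h,

      W' = c - h - f / W^r,   W(0) = W(1) = 0,   W > 0,

    and U is recovered from W by a quadrature, because its slope is - (W/d)^r. So
    the theorem amounts to the existence and uniqueness of the speed c for which
    this singular boundary value problem is solvable.

    On [0, s], where f <= 0, the right-hand side is nonincreasing in W. Hence the
    solution issuing from W(0) = 0 is unique, and its value at s is a nondecreasing
    Lipschitz function of c. Existence is obtained by freezing W^(-r) below a small
    level and letting that level tend to 0 ([singular_solution_exists]); for the
    frozen equation the integral operator is antitone and Lipschitz, and a fixed
    point is found by order alone ([antitone_ode]). The reflection t |-> 1 - t
    turns [s, 1] into the same problem with the drift reversed, so the value at s
    of the solution that vanishes at 1 is nonincreasing in c. The two values
    therefore agree for some c ([matching_speed_exists]).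

    If they agreed at 0, then c = h(s); each of the two one-sided hypotheses at s
    excludes this, because it keeps one half-wave above a line of nonzero slope
    through (s, 0) while the negative part of its drift tends to 0 at s
    ([singular_solution_pos_of_drift_small]). Once the common value
    is positive it varies strictly with c, which gives the uniqueness of the speed
    ([matching_speed_unique]). The estimates of the speed compare a half-wave with
    the line of the best slope through (s, 0) ([singular_solution_vanishes],
    [optimal_slope]).

    The quadrature of W is inverted to give a function U on the whole line, whose
    properties are then checked ([profile_of_regular]). Conversely, for an
    arbitrary regular profile of speed c the difference between minus its flux and
    a half-wave evaluated at U is repelled from 0 and tends to 0 at infinity, so
    it vanishes ([flux_right], [flux_left]). The two half-waves of speed c thus
    match at s, which makes c the speed found above, and the profile is the
    constructed one ([regular_profile_eq]). *)

(** * Comparison on the real line with finitely many exceptional points *)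

Section RealLine.
Context {R : realType}.
Implicit Types (del mu e eta : R).
Implicit Types (f g D : R -> R) (a b t x y z : R) (S : seq R).

Lemma continuous_epsP f x : {for x, continuous f} <->
  forall e, 0 < e -> exists2 del, 0 < del & forall y, `|y - x| < del -> `|f y - f x| < e.
Proof.
split=> [cf e e0|H].
  have /cvgrPdist_lt/(_ _ e0) := cf => /nbhs_ballP[del /= del0 H].
  by exists del => // y yx; rewrite distrC; apply: H; rewrite /ball/= distrC.
apply/cvgrPdist_lt => e e0; have [del del0 Hd] := H _ e0.
apply/nbhs_ballP; exists del => //= y; rewrite /ball/= distrC => yx.
by rewrite distrC; apply: Hd.
Qed.

Lemma is_derive_continuous f x l : is_derive x 1 f l -> {for x, continuous f}.
Proof. by case=> df _; exact/differentiable_continuous/derivable1_diffP. Qed.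

(** Between consecutive exceptional points this is the mean value theorem;
    continuity joins the pieces. *)
Lemma le0_derive_le f a b S : a <= b -> continuous f ->
  (forall t, a < t < b -> t \notin S -> exists2 l, is_derive t 1 f l & l <= 0) ->
  f b <= f a.
Proof.
move=> + cf; elim: S a b => [|x S IH] a b ab H.
  pose l t := xget 0 [set l | is_derive t 1 f l /\ l <= 0].
  have lP t : t \in `]a, b[ -> is_derive t 1 f (l t) /\ l t <= 0.
    rewrite in_itv /= => /H/(_ isT)[l0 d0 l00]; rewrite /l.
    by case: xgetP => [y _ []//|/(_ l0)[]].
  move: ab; rewrite le_eqVlt => /predU1P[->//|ab].
  have [c cab E] := MVT ab (fun t h => proj1 (lP t h)) (continuous_subspaceT cf).
  have [_ lc] := lP c cab.
  by rewrite -subr_le0 E mulr_le0_ge0 ?subr_ge0 ?(ltW ab).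
have [/andP[ax xb]|xab] := boolP (a < x < b).
  apply: (@le_trans _ _ (f x)).
    apply: IH => [|t /andP[t1 t2] tS]; first exact: ltW.
    by apply: H; rewrite ?t2 ?(lt_trans ax)// inE negb_or tS gt_eqF.
  apply: IH => [|t /andP[t1 t2] tS]; first exact: ltW.
  by apply: H; rewrite ?t1 ?(lt_trans t2)// inE negb_or tS lt_eqF.
apply: IH => // t tab tS; apply: H => //.
rewrite inE negb_or tS andbT; apply: contraNneq xab => <-//.
Qed.

(** A continuous function that is nonpositive at a can only become positive by
    crossing values between 0 and eta, so the sign of its derivative matters
    only there. Every comparison of solutions below is an instance, and the
    bound eta allows hypotheses that hold only close to the crossing. *)
Lemma le0_comparison D a b eta S : continuous D -> D a <= 0 -> 0 < eta ->
  (forall t, a < t < b -> t \notin S -> 0 < D t < eta ->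
     exists2 l, is_derive t 1 D l & l <= 0) ->
  forall t, a <= t <= b -> D t <= 0.
Proof.
move=> cD Da eta0 H t1 /andP[at1 t1b]; rewrite leNgt; apply/negP => Dt1.
pose A := [set t | a <= t <= t1 /\ D t <= 0].
have supA : has_sup A.
  by split; [exists a; rewrite /A/= lexx at1|exists t1 => t [/andP[]]].
set s := sup A.
have as_ : a <= s by apply: sup_upper_bound => //; rewrite /A/= lexx at1.
have st1 : s <= t1 by apply: ge_sup; [case: supA|move=> t [/andP[]]].
have Ds : D s <= 0.
  rewrite leNgt; apply/negP => Ds.
  have /continuous_epsP/(_ _ Ds)[del del0 Hdel] := cD s.
  have [t [/andP[at_ tt1] Dt] st] := sup_adherent del0 supA.
  have ts : t <= s by apply: sup_upper_bound => //; split; rewrite ?at_.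
  have : `|t - s| < del by rewrite ler0_norm ?subr_le0// opprB ltrBlDl -ltrBlDr.
  by move=> /Hdel; rewrite ltr_norml => /andP[]; lra.
have {st1} st1 : s < t1 by rewrite lt_neqAle st1 andbT; apply: contraTneq Dt1 => <-; rewrite -leNgt.
have /continuous_epsP/(_ _ eta0)[del del0 Hdel] := cD s.
pose u := Num.min t1 (s + del / 2).
have su : s < u by rewrite lt_min st1 ltrDl divr_gt0.
have ut1 : u <= t1 by rewrite ge_min lexx.
have Hu t : s < t -> t <= u -> 0 < D t < eta.
  move=> st tu; apply/andP; split.
    rewrite ltNge; apply/negP => Dt.
    have : t <= s by apply: sup_upper_bound => //; split=> //; rewrite (le_trans as_ (ltW st)) (le_trans tu).
    by rewrite leNgt st.
  have : `|t - s| < del.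
    rewrite gtr0_norm ?subr_gt0//.
    have : t <= s + del / 2 by rewrite (le_trans tu)// ge_min lexx orbT.
    by lra.
  by move=> /Hdel; rewrite ltr_norml => /andP[]; lra.
have : D u <= D s.
  apply: (@le0_derive_le _ _ _ S) => //; first exact: ltW.
  move=> t /andP[st tu] tS; apply: H => //.
    by rewrite (le_lt_trans as_ st) (lt_le_trans tu)// (le_trans ut1).
  by apply: Hu => //; rewrite ltW.
by have /andP[] := Hu _ su (lexx _); lra.
Qed.


(** Compactness of [a, b] for functions that need not be continuous; it stands
    in for the extreme value theorem where the coefficients jump. *)
Lemma locally_bounded_below (k : R -> R) a b : a <= b ->
  (forall x, a <= x <= b -> exists2 del, 0 < del & exists2 mu, 0 < mu &
     forall y, `|y - x| < del -> mu <= k y) ->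
  exists2 mu, 0 < mu & forall y, a <= y <= b -> mu <= k y.
Proof.
move=> ab H.
pose A := [set t | a <= t <= b /\ exists2 mu, 0 < mu & forall y, a <= y <= t -> mu <= k y].
have Aa : A a.
  split; first by rewrite lexx.
  have [|del del0 [mu mu0 Hd]] := H a; first by rewrite lexx.
  exists mu => // y; rewrite -eq_le => /eqP<-.
  by apply: Hd; rewrite subrr normr0.
have supA : has_sup A by split; [exists a|exists b => t [/andP[]]].
set s := sup A.
have as_ : a <= s by apply: sup_upper_bound.
have sb : s <= b by apply: ge_sup; [case: supA|move=> t [/andP[]]].
have [|del del0 [mu mu0 Hd]] := H s; first by rewrite as_.
have [t [/andP[at_ tb] [nu nu0 Ht]] st] := sup_adherent del0 supA.
have ts : t <= s.
  by apply: sup_upper_bound => //; split; [rewrite at_|exists nu].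
have Hs y : a <= y -> y < s + del -> Num.min mu nu <= k y.
  move=> ay ys; rewrite ge_min; have [yt|ty] := leP y t.
    by rewrite Ht ?orbT// ay.
  rewrite Hd//= ltr_norml; move: st; rewrite -/s; lra.
have minmn : 0 < Num.min mu nu by rewrite lt_min mu0.
have [bs|sb'] := ltP b (s + del).
  exists (Num.min mu nu) => // y /andP[ay yb].
  by apply: Hs => //; exact: le_lt_trans bs.
have : s + del / 2 <= s.
  apply: sup_upper_bound => //; split; first by apply/andP; split; lra.
  by exists (Num.min mu nu) => // y /andP[ay ys]; apply: Hs => //; lra.
lra.
Qed.

(** Composition with [clamp] turns continuity within [a, b] into continuity on
    the line, which spares subspace topologies afterwards. *)
Definition clamp a b t : R := Num.max a (Num.min t b).

Lemma clampP a b t : a <= b -> a <= clamp a b t <= b.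
Proof. by move=> ab; rewrite /clamp le_max lexx/= ge_max ab/= ge_min lexx orbT. Qed.

Lemma clamp_id a b t : a <= t <= b -> clamp a b t = t.
Proof. by move=> /andP[? ?]; rewrite /clamp min_l// max_r. Qed.

Lemma clamp_lip a b x y : `|clamp a b x - clamp a b y| <= `|x - y|.
Proof.
wlog xy : x y / y <= x.
  by move=> H; have [/H//|/ltW/H] := leP y x; rewrite distrC (distrC x).
rewrite (ger0_norm (_ : 0 <= x - y)) ?subr_ge0// ler_norml /clamp.
case: (leP x b) => ?; case: (leP y b) => ?; rewrite !maxEle;
  do 2?[case: (leP a) => ?]; lra.
Qed.

Lemma clamp_homo a b x y : x <= y -> clamp a b x <= clamp a b y.
Proof.
move=> xy; rewrite /clamp ge_max le_max lexx/= le_max; apply/orP; right.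
by rewrite le_min !ge_min xy lexx orbT.
Qed.

Lemma clamp_continuous a b (f : R -> R) : a <= b ->
  {within `[a, b], continuous f} -> continuous (f \o clamp a b).
Proof.
move=> ab /subspace_continuousP cf x; apply/continuous_epsP => e e0.
have /cf/cvgrPdist_lt/(_ _ e0) : `[a, b]%classic (clamp a b x).
  by rewrite /= in_itv /= clampP.
rewrite near_withinE => /nbhs_ballP[del /= del0 Hd].
exists del => // y yx /=; rewrite distrC; apply: Hd; last by rewrite /= in_itv/= clampP.
by rewrite /ball/=; apply: le_lt_trans yx; rewrite (distrC y) clamp_lip.
Qed.

(** A monotone function can be discontinuous only by jumping over values. *)
Lemma monotone_onto_continuous (f : R -> R) a b : {homo f : x y / x <= y} ->
  (forall x, a <= f x <= b) -> (forall u, a < u < b -> exists x, f x = u) ->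
  continuous f.
Proof.
move=> mf fab onto x; apply/continuous_epsP => e e0.
have above : exists2 del, 0 < del & forall y, y < x + del -> f y < f x + e.
  have [xb|bx] := ltP (f x + e / 2) b; last first.
    by exists 1 => // y _; have /andP[_] := fab y; lra.
  have [|y fy] := onto (f x + e / 2).
    by rewrite xb andbT; have /andP[] := fab x; lra.
  exists (y - x); first rewrite subr_gt0.
    by rewrite ltNge; apply/negP => /mf; lra.
  by move=> z; rewrite subrKC => /ltW/mf; lra.
have below : exists2 del, 0 < del & forall y, x - del < y -> f x - e < f y.
  have [xb|bx] := ltP a (f x - e / 2); last first.
    by exists 1 => // y _; have /andP[] := fab y; lra.
  have [|y fy] := onto (f x - e / 2).
    by rewrite xb /=; have /andP[] := fab x; lra.
  exists (x - y); first rewrite subr_gt0.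
    by rewrite ltNge; apply/negP => /mf; lra.
  by move=> z; rewrite subKr => /ltW/mf; lra.
have [d1 d10 H1] := above; have [d2 d20 H2] := below.
exists (Num.min d1 d2); first by rewrite lt_min d10.
move=> y; rewrite lt_min !ltr_norml => /andP[/andP[? ?] /andP[? ?]].
have := H1 y; have := H2 y; lra.
Qed.

Lemma constant_of_derive0 (E : R -> R) S a b : a <= b -> continuous E ->
  (forall t, a < t < b -> t \notin S -> is_derive t 1 E 0) -> E a = E b.
Proof.
move=> ab cE dE; apply/eqP; rewrite eq_le; apply/andP; split; last first.
  apply: (@le0_derive_le E _ _ S) => // t tab tS.
  by exists 0 => //; exact: dE.
rewrite -lerN2; apply: (@le0_derive_le (fun z => - E z) _ _ S) => // [z|z zab zS].
  by apply: cvgN; exact: cE.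
exists (- 0); last by rewrite oppr0.
exact: (is_deriveN (dE _ zab zS)).
Qed.

Lemma notin_seq_near S x : exists2 del, 0 < del &
  forall y, `|y - x| < del -> y != x -> y \notin S.
Proof.
elim: S => [|a S [del del0 H]]; first by exists 1.
have [->|ax] := eqVneq a x.
  by exists del => // y yx ynx; rewrite inE negb_or ynx H.
exists (Num.min del `|a - x|); first by rewrite lt_min del0 normr_gt0 subr_eq0.
move=> y; rewrite lt_min => /andP[yx ya] ynx; rewrite inE negb_or H// andbT.
by apply: contraTneq ya => ->; rewrite ltxx.
Qed.

End RealLine.

(** * Derivatives as limits, and primitives of piecewise continuous functions *)

Section Derivatives.
Context {R : realType}.
Implicit Types (c : R).
Implicit Types (f g df : R -> R) (a b t x y z l : R).

(** In this form the rules apply to an expression in a bound variable, without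
    rewriting it as an operation on functions. *)
Lemma deriv_add f g t a b : is_derive t 1 f a -> is_derive t 1 g b ->
  is_derive t 1 (fun x => f x + g x) (a + b).
Proof. by move=> df dg; exact: (is_deriveD df dg). Qed.

Lemma deriv_sub f g t a b : is_derive t 1 f a -> is_derive t 1 g b ->
  is_derive t 1 (fun x => f x - g x) (a - b).
Proof. by move=> df dg; exact: (is_deriveB df dg). Qed.

Lemma deriv_opp f t a : is_derive t 1 f a -> is_derive t 1 (fun x => - f x) (- a).
Proof. by move=> df; exact: (is_deriveN df). Qed.

Lemma deriv_mul f g t a b : is_derive t 1 f a -> is_derive t 1 g b ->
  is_derive t 1 (fun x => f x * g x) (a * g t + f t * b).
Proof.
move=> df dg; have := is_deriveM df dg; rewrite /GRing.scale/=.
by rewrite addrC (mulrC (g t)).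
Qed.

Lemma deriv_scale c f t a : is_derive t 1 f a -> is_derive t 1 (fun x => c * f x) (c * a).
Proof. by move=> df; exact: (is_deriveZ c df). Qed.

Lemma deriv_const (c t : R) : is_derive t 1 (fun _ : R => c) 0.
Proof. exact: (is_derive_cst c t 1). Qed.

Lemma deriv_var t : is_derive t 1 (fun x : R => x) 1.
Proof. exact: is_derive_id. Qed.

Lemma deriv_comp f g t a b : is_derive (g t) 1 f a -> is_derive t 1 g b ->
  is_derive t 1 (fun x => f (g x)) (a * b).
Proof. by move=> df dg; exact: (is_derive1_comp df dg). Qed.

Lemma cvg_left_epsP f z l : f t @[t --> z^'-] --> l <->
  forall e, 0 < e -> exists2 del, 0 < del & forall t, z - del < t < z -> `|f t - l| < e.
Proof.
split=> [/cvgrPdist_lt H e /H|H].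
  rewrite near_withinE => /nbhs_ballP[del /= del0 Hd]; exists del => // t /andP[t1 t2].
  by rewrite distrC; apply: Hd => //=; rewrite /ball/= gtr0_norm ?subr_gt0//; lra.
apply/cvgrPdist_lt => e /H[del del0 Hd].
rewrite near_withinE; apply/nbhs_ballP; exists del => //= t.
rewrite /ball/= => zt tz; rewrite distrC; apply: Hd; rewrite tz andbT.
by move: zt; rewrite gtr0_norm ?subr_gt0//; lra.
Qed.

Lemma cvg_right_epsP f z l : f t @[t --> z^'+] --> l <->
  forall e, 0 < e -> exists2 del, 0 < del & forall t, z < t < z + del -> `|f t - l| < e.
Proof.
split=> [/cvgrPdist_lt H e /H|H].
  rewrite near_withinE => /nbhs_ballP[del /= del0 Hd]; exists del => // t /andP[t1 t2].
  by rewrite distrC; apply: Hd => //=; rewrite /ball/= ltr0_norm ?subr_lt0//; lra.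
apply/cvgrPdist_lt => e /H[del del0 Hd].
rewrite near_withinE; apply/nbhs_ballP; exists del => //= t.
rewrite /ball/= => zt tz; rewrite distrC; apply: Hd; rewrite tz/=.
by move: zt; rewrite ltr0_norm ?subr_lt0//; lra.
Qed.

(** By the mean value theorem the difference quotient is a value of the derivative
    at an intermediate point. *)
Lemma left_quotient_cvg f df z l : continuous f ->
  (exists2 del, 0 < del & forall t, z - del < t < z -> is_derive t 1 f (df t)) ->
  df t @[t --> z^'-] --> l ->
  t^-1 *: (f (t + z) - f z) @[t --> 0^'-] --> l.
Proof.
move=> cf [d0 d00 Hd0] /cvg_left_epsP dfl; apply/cvg_left_epsP => e e0.
have [d1 d10 Hd1] := dfl _ e0.
exists (Num.min d0 d1); first by rewrite lt_min d00.
move=> t; rewrite sub0r ltrNl lt_min => /andP[/andP[td0 td1] t0].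
have tz : t + z < z by rewrite gtrDr.
have [|c cab E] := MVT tz (df := df) _ (continuous_subspaceT cf).
  by move=> x; rewrite in_itv/= => /andP[? ?]; apply: Hd0; lra.
have {}E : f (t + z) - f z = df c * t by rewrite -(opprB (f z)) E; ring.
rewrite E.
rewrite /GRing.scale/= mulrCA mulVf ?lt_eqF// mulr1.
by apply: Hd1; move: cab; rewrite in_itv/= => /andP[? ?]; lra.
Qed.

Lemma right_quotient_cvg f df z l : continuous f ->
  (exists2 del, 0 < del & forall t, z < t < z + del -> is_derive t 1 f (df t)) ->
  df t @[t --> z^'+] --> l ->
  t^-1 *: (f (t + z) - f z) @[t --> 0^'+] --> l.
Proof.
move=> cf [d0 d00 Hd0] /cvg_right_epsP dfl; apply/cvg_right_epsP => e e0.
have [d1 d10 Hd1] := dfl _ e0.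
exists (Num.min d0 d1); first by rewrite lt_min d00.
move=> t; rewrite add0r lt_min => /andP[t0 /andP[td0 td1]].
have tz : z < t + z by rewrite ltrDr.
have [|c cab E] := MVT tz (df := df) _ (continuous_subspaceT cf).
  by move=> x; rewrite in_itv/= => /andP[? ?]; apply: Hd0; lra.
rewrite E addrK /GRing.scale/= mulrCA mulVf ?gt_eqF// mulr1.
by apply: Hd1; move: cab; rewrite in_itv/= => /andP[? ?]; lra.
Qed.

Lemma is_derive_sides f z l :
  t^-1 *: (f (t + z) - f z) @[t --> 0^'-] --> l ->
  t^-1 *: (f (t + z) - f z) @[t --> 0^'+] --> l -> is_derive z 1 f l.
Proof.
move=> /cvg_left_epsP fl /cvg_right_epsP fr.
have H : h^-1 *: ((f \o shift z) (h *: 1) - f z) @[h --> 0^'] --> l.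
  apply/cvgrPdist_lt => e e0; have [d1 d10 H1] := fl _ e0; have [d2 d20 H2] := fr _ e0.
  rewrite near_withinE; apply/nbhs_ballP.
  exists (Num.min d1 d2) => /=; first by rewrite lt_min d10.
  move=> t; rewrite /ball/= sub0r normrN lt_min /shift/= /GRing.scale/= mulr1 => /andP[t1 t2] t0.
  rewrite distrC; have [tn|tp|/eqP] := ltgtP t 0; last by rewrite (negbTE t0).
    by apply: H1; move: t1; rewrite ltr0_norm//; lra.
  by apply: H2; move: t2; rewrite gtr0_norm//; lra.
split; first by apply/cvg_ex; exists l.
by apply/cvg_lim => //; exact: Rhausdorff.
Qed.

(** Used where a differential equation is known only next to z but its right-hand
    side is continuous at z. *)
Lemma is_derive_of_limit f df z : continuous f ->
  (exists2 del, 0 < del & forall t, `|t - z| < del -> t != z -> is_derive t 1 f (df t)) ->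
  {for z, continuous df} -> is_derive z 1 f (df z).
Proof.
move=> cf [del del0 H] /[dup] /cvg_at_left_filter dl /cvg_at_right_filter dr.
apply: is_derive_sides.
  apply: left_quotient_cvg dl => //; exists del => // t /andP[? ?].
  by apply: H; rewrite ?lt_eqF// ltr0_norm; lra.
apply: right_quotient_cvg dr => //; exists del => // t /andP[? ?].
by apply: H; rewrite ?gt_eqF// gtr0_norm; lra.
Qed.

End Derivatives.

Section Primitives.
Context {R : realType}.
Notation mu := (@lebesgue_measure R).
Implicit Types (f k : R -> R) (a b t x y z : R) (S : seq R).

(** The clamped bound makes the primitive continuous on the whole line. *)
Definition primitive k a b t : R := \int[mu]_(s in `[a, clamp a b t]) k s.

Lemma primitive_continuous k a b : a <= b -> mu.-integrable `[a, b] (EFin \o k) ->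
  continuous (primitive k a b).
Proof.
move=> ab ik; apply: (@clamp_continuous _ a b (fun t => \int[mu]_(s in `[a, t]) k s)) => //.
exact: parameterized_integral_continuous.
Qed.

Lemma primitive_derive k a b t : mu.-integrable `[a, b] (EFin \o k) -> a < t < b ->
  {for t, continuous k} -> is_derive t 1 (primitive k a b) (k t).
Proof.
move=> ik /andP[at_ tb] ck.
have [d1 d2] := continuous_FTC1_closed tb ik at_ ck.
apply: (@near_eq_is_derive _ _ _ (fun t => \int[mu]_(s in `[a, t]) k s)).
  have : t \in `]a, b[ by rewrite in_itv/= at_.
  move=> /near_in_itvoo; apply: filterS => s; rewrite in_itv/= => /andP[? ?].
  by rewrite /primitive clamp_id// !ltW.
by split=> //; rewrite -derive1E.
Qed.

Lemma oriented_integralE k a b x y : mu.-integrable `[a, b] (EFin \o k) ->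
  a <= x <= b -> a <= y <= b ->
  oriented_integral k x y = primitive k a b y - primitive k a b x.
Proof.
move=> ik; have H u v : a <= u <= b -> a <= v <= b -> u <= v ->
    \int[mu]_(t in `[u, v]) k t = primitive k a b v - primitive k a b u.
  move=> uab vab uv; rewrite /primitive !clamp_id//.
  have [/andP[au ub] /andP[av vb]] := (uab, vab).
  have iS (i : interval R) : [set` i] `<=` `[a, b] -> mu.-integrable [set` i] (EFin \o k).
    by move=> iab; apply: integrableS ik.
  rewrite Rintegral_itvB ?bnd_simp//; last first.
    by apply: iS => s; rewrite /= !in_itv/= => /andP[-> sv] /=; exact: le_trans vb.
  rewrite Rintegral_itv_obnd_cbnd//; apply: iS => s.
  by rewrite /= !in_itv/= => /andP[? ?]; apply/andP; split; lra.
move=> xab yab; rewrite /oriented_integral; case: leP => [|/ltW] xy; first exact: H.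
by rewrite H// opprB.
Qed.

Lemma primitive0 k a b t : t <= a -> a <= b -> primitive k a b t = 0.
Proof.
move=> ta ab; have -> : primitive k a b t = \int[mu]_(s in [set a]) k s.
  by rewrite /primitive /clamp min_l ?(le_trans ta)// max_l// set_itv1.
by rewrite Rintegral_set1.
Qed.

(** Induction on the exceptional points, each of which splits the interval. *)
Lemma measurable_piecewise k a b S :
  (forall t, a < t < b -> t \notin S -> {for t, continuous k}) ->
  measurable_fun `]a, b[ k.
Proof.
elim: S a b => [|x S IH] a b H.
  apply: measurable_realfun.open_continuous_measurable_fun; first exact: interval_open.
  by move=> t; rewrite inE/= in_itv/= => tab; exact: H.
have [/andP[ax xb]|xab] := boolP (a < x < b).
  have -> : (`]a, b[%classic : set R) = `]a, x] `|` `]x, b[.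
    by rewrite -itv_bndbnd_setU ?bnd_simp// ltW.
  apply/measurable_funU => //; split.
    apply/measurable_realfun.measurable_fun_itv_bndo_bndcP.
    apply: IH => t /andP[t1 t2] tS.
    by apply: H; rewrite ?t1 ?(lt_trans t2)// inE negb_or tS lt_eqF.
  apply: IH => t /andP[t1 t2] tS.
  by apply: H; rewrite ?t2 ?(lt_trans ax)// inE negb_or tS gt_eqF.
apply: IH => // t tab tS; apply: H => //.
rewrite inE negb_or tS andbT; apply: contraNneq xab => <-//.
Qed.

Lemma integrable_cc k a b : mu.-integrable `]a, b[ (EFin \o k) ->
  mu.-integrable `[a, b] (EFin \o k).
Proof.
move=> ik.
have mk : measurable_fun `[a, b] k.
  apply: (@measurable_realfun.measurable_fun_itv_cc _ a b false true).
  by apply/measurable_realfun.measurable_EFinP; exact: measurable_int ik.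
have [ab|ba] := leP a b; last first.
  by rewrite set_itv_ge// ?bnd_simp -?ltNge//; exact: integrable_set0.
have mu0 : mu [set a; b] = 0%E.
  by apply: countable_lebesgue_measure0; exact: finite_set_countable.
move/measurable_realfun.measurable_EFinP: mk => mk.
have mab : measurable ([set a; b] : set R) by apply: measurableU; exact: measurable_set1.
apply: (proj2 (negligible_integrable (mu := mu) mab _ mk mu0)) => //.
apply: integrableS ik => //.
  exact: measurableD.
move=> t [] /=; rewrite !in_itv/= => /andP[at_ tb] /not_orP[/eqP ta /eqP tb'].
by rewrite !lt_neqAle at_ tb tb' eq_sym ta.
Qed.

Lemma integrable_piecewise k a b S M :
  (forall t, a < t < b -> t \notin S -> {for t, continuous k}) ->
  (forall t, a < t < b -> `|k t| <= M) ->
  mu.-integrable `[a, b] (EFin \o k).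
Proof.
move=> ck bk; apply: integrable_cc; apply: measurable_bounded_integrable => //.
- by rewrite /= lebesgue_measure_itv/=; case: ifP => _; rewrite ?ltry.
- exact: measurable_piecewise ck.
- exists M; split; first exact: num_real.
  by move=> N MN t /=; rewrite in_itv/= => /bk /le_trans -> //; exact: ltW.
Qed.

End Primitives.

(** * The equation x' = G(x + kappa) with G nonincreasing *)

Section AntitoneODE.
Context {R : realType}.
Implicit Types (e c : R).
Variables (kappa G : R -> R) (L M T : R).
Hypotheses (ck : continuous kappa) (T0 : 0 < T).
Hypothesis antiG : forall x y, x <= y -> G y <= G x.
Hypothesis lipG : forall x y, x <= y -> G x - G y <= L * (y - x).
Hypothesis bndG : forall x, 0 <= G x <= M.

Let cG : continuous G.
Proof.
move=> x; apply/continuous_epsP => e e0.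
have L1 : 0 < `|L| + 1 by rewrite ltr_wpDl.
exists (e / (`|L| + 1)); first by rewrite divr_gt0.
have H y z : y <= z -> `|G y - G z| <= `|L| * `|y - z|.
  move=> yz; rewrite ger0_norm ?subr_ge0 ?antiG// (distrC y) (ger0_norm (_ : 0 <= z - y)) ?subr_ge0//.
  by apply: (le_trans (lipG yz)); rewrite ler_wpM2r ?subr_ge0 ?ler_norm.
move=> y; rewrite ltr_pdivlMr// => yx.
apply: (@le_lt_trans _ _ (`|L| * `|y - x|)).
  by have [/H//|/ltW/H] := leP y x; rewrite distrC (distrC y).
by apply: le_lt_trans yx; rewrite mulrC ler_wpM2l// lerDl.
Qed.

Let rhs (x : R -> R) s := G (x s + kappa s).
Let op (x : R -> R) := primitive (rhs x) 0 T.
(* one Lipschitz constant for the whole class makes pointwise infima continuous *)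
Let X (x : R -> R) := (forall t, t <= 0 -> x t = 0) /\
  forall s t, s <= t -> 0 <= x t - x s <= M * (t - s).
Let le (x y : R -> R) := forall t, x t <= y t.

Let M0 : 0 <= M. Proof. by have /andP[h1 h2] := bndG 0; exact: le_trans h2. Qed.

Let X_continuous x : X x -> continuous x.
Proof.
move=> [_ Hx] t; apply/continuous_epsP => e e0.
exists (e / (M + 1)); first by rewrite divr_gt0// ltr_wpDl.
move=> s; rewrite ltr_pdivlMr ?ltr_wpDl// => st.
apply: (@le_lt_trans _ _ (M * `|s - t|)); last first.
  by apply: le_lt_trans st; rewrite mulrC ler_wpM2l// lerDl.
have [st'|/ltW st'] := leP s t; have /andP[h1 h2] := Hx _ _ st'.
  by rewrite distrC (distrC s) !ger0_norm// subr_ge0.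
by rewrite !ger0_norm// subr_ge0.
Qed.

Let rhs_continuous x : X x -> continuous (rhs x).
Proof.
move=> Xx t; apply: (@continuous_comp _ _ _ (fun s => x s + kappa s) G); last exact: cG.
by apply: cvgD; [exact: X_continuous|exact: ck].
Qed.

Let op_int x : X x -> (@lebesgue_measure R).-integrable `[0, T] (EFin \o rhs x).
Proof.
move=> Xx; apply: (@integrable_piecewise _ _ _ _ [::] M) => [t _ _|t _].
  exact: rhs_continuous.
by have /andP[h1 h2] := bndG (x t + kappa t); rewrite ger0_norm.
Qed.

Let op_continuous x : X x -> continuous (op x).
Proof. by move=> Xx; apply: primitive_continuous (ltW T0) (op_int Xx). Qed.

Let op_derive x t : X x -> 0 < t < T -> is_derive t 1 (op x) (rhs x t).
Proof. by move=> Xx tT; exact: (primitive_derive (op_int Xx) tT (@rhs_continuous x Xx t)). Qed.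

Let op_clamp x t : op x (clamp 0 T t) = op x t.
Proof. by rewrite /op /primitive [clamp 0 T (clamp _ _ _)]clamp_id// clampP// ltW. Qed.

Let op_X x : X x -> X (op x).
Proof.
move=> Xx; split=> [t t0|s t st]; first by apply: primitive0 => //; exact: ltW.
have [/andP[s0 sT] /andP[t0 tT]] := (clampP s (ltW T0), clampP t (ltW T0)).
have cst := clamp_homo 0 T st.
have clt : clamp 0 T t - clamp 0 T s <= t - s.
  by have := clamp_lip 0 T t s; rewrite !ger0_norm ?subr_ge0.
rewrite -(op_clamp x t) -(op_clamp x s); apply/andP; split.
  suff : (fun u => - op x u) (clamp 0 T t) <= (fun u => - op x u) (clamp 0 T s) by rewrite /=; lra.
  apply: (@le0_derive_le _ (fun u => - op x u) _ _ [::]) => // [u|u /andP[su ut] _].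
    by apply: cvgN; exact: op_continuous.
  have duT : 0 < u < T by rewrite (le_lt_trans s0)//= (lt_le_trans ut).
  exists (- rhs x u); first by apply: deriv_opp; exact: op_derive.
  by rewrite oppr_le0; have /andP[] := bndG (x u + kappa u).
apply: (@le_trans _ _ (M * (clamp 0 T t - clamp 0 T s))); last by rewrite ler_wpM2l.
suff : (fun u => op x u - M * u) (clamp 0 T t) <= (fun u => op x u - M * u) (clamp 0 T s).
  by rewrite /= mulrBr; lra.
apply: (@le0_derive_le _ (fun u => op x u - M * u) _ _ [::]) => // [u|u /andP[su ut] _].
  apply: cvgB; first exact: op_continuous.
  by apply: cvgM; [exact: cvg_cst|exact: cvg_id].
have duT : 0 < u < T by rewrite (le_lt_trans s0)//= (lt_le_trans ut).
exists (rhs x u - M * 1).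
  exact: deriv_sub (op_derive Xx duT) (deriv_scale _ (deriv_var _)).
by rewrite mulr1 subr_le0; have /andP[] := bndG (x u + kappa u).
Qed.

Let op_anti x y : X x -> X y -> le x y -> le (op y) (op x).
Proof.
move=> Xx Xy xy t; rewrite -(op_clamp y t) -(op_clamp x t).
have /andP[t0 tT] := clampP t (ltW T0).
suff : (fun u => op y u - op x u) (clamp 0 T t) <= (fun u => op y u - op x u) 0.
  by rewrite /= (proj1 (op_X Xx) 0)// (proj1 (op_X Xy) 0)//; lra.
apply: (@le0_derive_le _ (fun u => op y u - op x u) _ _ [::]) => // [u|u /andP[su ut] _].
  by apply: cvgB; exact: op_continuous.
have duT : 0 < u < T by rewrite su (lt_le_trans ut).
exists (rhs y u - rhs x u); first by apply: deriv_sub; exact: op_derive.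
by rewrite subr_le0 antiG// lerD2r.
Qed.

(* the least fixed point of the monotone operator [op \o op], after Knaster and Tarski *)
Let pre := [set x | X x /\ le (op (op x)) x].
Let bot t := inf [set x t | x in pre].

Let X_ge0 x t : X x -> 0 <= x t.
Proof.
move=> [x0 Hx]; have [t0|/ltW t0] := leP t 0; first by rewrite x0.
by have /andP[] := Hx _ _ t0; rewrite (x0 0)// subr0.
Qed.

Let has_inf_bot t : has_inf [set x t | x in pre].
Proof.
split; last by exists 0 => _ [x [Xx _] <-]; exact: X_ge0.
exists (M * Num.max t 0), (fun t => M * Num.max t 0) => //.
have Xtop : X (fun t => M * Num.max t 0).
  split=> [s s0|s u su]; first by rewrite max_r// mulr0.
  rewrite -mulrBr; have : 0 <= Num.max u 0 - Num.max s 0 <= u - s.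
    by case: (leP u 0) => ?; case: (leP s 0) => ?; lra.
  by move=> /andP[h1 h2]; rewrite mulr_ge0//= ler_wpM2l.
split=> // s; have [s0|/ltW s0] := leP s 0.
  by rewrite (proj1 (op_X (op_X Xtop)))// mulr_ge0// le_max lexx orbT.
have /andP[_] := (proj2 (op_X (op_X Xtop))) _ _ s0.
rewrite (proj1 (op_X (op_X Xtop)) 0)// !subr0 => h; apply: (le_trans h).
by rewrite ler_wpM2l// le_max lexx.
Qed.

Let bot_le x : pre x -> le bot x.
Proof.
by move=> px t; apply: ge_inf; [have [] := has_inf_bot t|exists x].
Qed.

Let le_bot c t : (forall x, pre x -> c <= x t) -> c <= bot t.
Proof.
by move=> H; apply: lb_le_inf; [have [] := has_inf_bot t|move=> _ [x px <-]; exact: H].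
Qed.

Let X_bot : X bot.
Proof.
split=> [t t0|s t st].
  apply/eqP; rewrite eq_le; apply/andP; split.
    by have [[_ [x [Xx px] _]] _] := has_inf_bot t; rewrite -(proj1 Xx t t0) bot_le.
  by apply: le_bot => x [Xx _]; exact: X_ge0.
apply/andP; split.
  rewrite subr_ge0; apply: le_bot => x [Xx px].
  by apply: (le_trans (bot_le (conj Xx px) s)); have /andP[] := (proj2 Xx) _ _ st; lra.
rewrite lerBlDr -lerBlDl; apply: le_bot => x [Xx px]; rewrite lerBlDl.
apply: (le_trans (bot_le (conj Xx px) t)).
by have /andP[] := (proj2 Xx) _ _ st; lra.
Qed.

Let op2_mono x y : X x -> X y -> le x y -> le (op (op x)) (op (op y)).
Proof. by move=> Xx Xy xy; apply: op_anti (op_anti _ _ _) => //; exact: op_X. Qed.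

Let bot_fix : op (op bot) = bot.
Proof.
have H : le (op (op bot)) bot.
  move=> t; apply: le_bot => x [Xx px].
  by apply: le_trans (px t); apply: op2_mono => //; exact: bot_le.
apply/funext => t; apply/eqP; rewrite eq_le H/=; apply: bot_le; split.
  by do 2 apply: op_X; exact: X_bot.
by apply: op2_mono H; [do 2 apply: op_X; exact: X_bot|exact: X_bot].
Qed.

(** The integral operator x |-> \int_0^t G(x + kappa) reverses the order, so its
    square has a least fixed point, [bot], and the operator exchanges [bot] with
    a larger function, [op bot]. As G is Lipschitz, Gronwall's inequality forces
    the two to coincide, and their common value solves the equation. *)
Lemma antitone_ode : exists x : R -> R, [/\ continuous x, x 0 = 0 &
  forall t, 0 < t < T -> is_derive t 1 x (G (x t + kappa t))].
Proof.
have Xb := X_bot; have Xo := op_X Xb.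
have bo : le bot (op bot) by apply: bot_le; split=> //; rewrite bot_fix.
have dbot t : 0 < t < T -> is_derive t 1 bot (rhs (op bot) t).
  by move=> tT; rewrite -{1}bot_fix; exact: op_derive.
exists bot; split; [exact: X_continuous|exact: (proj1 Xb)|] => t tT.
have -> : G (bot t + kappa t) = rhs (op bot) t; last exact: dbot.
rewrite /rhs; congr (G (_ + _)); apply/eqP; rewrite eq_le bo/=.
(* the difference D of the two functions has D' <= L D and vanishes at 0 *)
pose E u := (op bot u - bot u) * expR (- L * u).
suff : E t <= E 0.
  rewrite /E (proj1 Xo 0)// (proj1 Xb 0)// subr0 mul0r pmulr_lle0 ?expR_gt0//.
  by rewrite subr_le0.
have [t0 tT'] := andP tT.
apply: (@le0_derive_le _ E _ _ [::]); first exact: ltW.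
  move=> u; apply: cvgM.
    by apply: cvgB; exact: X_continuous.
  apply: (@continuous_comp _ _ _ (fun u => - L * u) expR); last exact: continuous_expR.
  by apply: cvgM; [exact: cvg_cst|exact: cvg_id].
move=> u /andP[u0 ut] _.
have uT : 0 < u < T by rewrite u0 (lt_trans ut).
have dE := deriv_mul (deriv_sub (op_derive Xb uT) (dbot u uT))
  (deriv_comp (is_derive_expR (- L * u)) (deriv_scale (- L) (deriv_var u))).
eexists; first exact: dE.
rewrite mulr1 (mulrC (expR _)) mulrA -mulrDl pmulr_lle0 ?expR_gt0//.
have := lipG (_ : bot u + kappa u <= op bot u + kappa u).
by rewrite lerD2r => /(_ (bo u)); rewrite /rhs; lra.
Qed.

End AntitoneODE.

(** * The nonlinearity x^(-r) *)

Section InversePower.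
Context {R : realType}.
Variable r : R.
Hypothesis r0 : 0 < r.
Implicit Types x y th : R.

Lemma powR_le x y : 0 <= x -> x <= y -> x `^ r <= y `^ r.
Proof.
move=> x0 xy; apply: ge0_ler_powR => //; rewrite ?nnegrE ?(ltW r0)//.
exact: le_trans xy.
Qed.

Lemma ipow_anti x y : 0 < x -> x <= y -> (y `^ r)^-1 <= (x `^ r)^-1.
Proof.
move=> x0 xy; rewrite lef_pV2 ?posrE ?powR_gt0//; last exact: lt_le_trans xy.
by rewrite powR_le// ltW.
Qed.

Lemma ipow_continuous x : 0 < x -> {for x, continuous (fun y => (y `^ r)^-1)}.
Proof.
move=> x0; apply: (@is_derive_continuous _ _ _ (- r * x `^ (- r - 1))).
have H := is_derive1_powR (- r) x0.
by move: H; congr (is_derive _ _ _ _); apply/funext => y; rewrite powRN.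
Qed.

(** Frozen below the level th, the nonlinearity stays nonincreasing and becomes
    bounded and Lipschitz. *)
Definition truncated_ipow th x := ((Num.max x th) `^ r)^-1.

Lemma truncated_ipow_anti th x y : 0 < th -> x <= y ->
  truncated_ipow th y <= truncated_ipow th x.
Proof.
move=> th0 xy; apply: ipow_anti; first by rewrite lt_max th0 orbT.
by rewrite ge_max !le_max xy lexx orbT.
Qed.

Lemma truncated_ipow_bound th x : 0 < th ->
  0 <= truncated_ipow th x <= (th `^ r)^-1.
Proof.
by move=> th0; rewrite invr_ge0 powR_ge0/= ipow_anti// le_max lexx orbT.
Qed.

Lemma truncated_ipow_ge th x : 0 < th -> th <= x -> truncated_ipow th x = (x `^ r)^-1.
Proof. by move=> th0 thx; rewrite /truncated_ipow max_l. Qed.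

Lemma truncated_ipow_le th x : x <= th -> truncated_ipow th x = (th `^ r)^-1.
Proof. by move=> thx; rewrite /truncated_ipow max_r. Qed.

Lemma truncated_ipow_lip th x y : 0 < th -> x <= y ->
  truncated_ipow th x - truncated_ipow th y <= r * th `^ (- r - 1) * (y - x).
Proof.
move=> th0 xy; pose x' := Num.max x th; pose y' := Num.max y th.
have x0 : 0 < x' by rewrite lt_max th0 orbT.
have thx : th <= x' by rewrite le_max lexx orbT.
have xy' : x' <= y' by rewrite ge_max !le_max xy lexx orbT.
have dxy : y' - x' <= y - x.
  by rewrite /x' /y'; case: (leP x th) => ?; case: (leP y th) => ?; lra.
have c0 : 0 <= r * th `^ (- r - 1) by rewrite mulr_ge0// ?ltW// powR_gt0.
apply: (@le_trans _ _ (r * th `^ (- r - 1) * (y' - x'))); last by rewrite ler_wpM2l.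
have Hd z : z \in `]x', y'[ -> is_derive z 1 (fun z : R => z `^ (- r)) (- r * z `^ (- r - 1)).
  by rewrite in_itv/= => /andP[xz _]; apply: is_derive1_powR; exact: lt_trans xz.
have [|c /andP[xc _]] := MVT_segment xy' Hd.
  apply: continuous_in_subspaceT => z; rewrite inE/= in_itv/= => /andP[xz _].
  have z0 : 0 < z by exact: lt_le_trans xz.
  exact: (is_derive_continuous (is_derive1_powR (- r) z0)).
rewrite !powRN => E.
rewrite /truncated_ipow -/x' -/y'.
have -> : (x' `^ r)^-1 - (y' `^ r)^-1 = r * c `^ (- r - 1) * (y' - x').
  by rewrite -[LHS]opprB E; ring.
rewrite bnd_simp in xc.
have c1 : 0 < c by exact: lt_le_trans xc.
rewrite ler_wpM2r ?subr_ge0// ler_wpM2l// ?(ltW r0)//.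
rewrite -!opprD !powRN lef_pV2 ?posrE ?powR_gt0//.
have thc : th <= c by exact: le_trans xc.
by apply: ge0_ler_powR; rewrite // ?nnegrE ?(ltW th0) ?(ltW c1)// addr_ge0// ltW.
Qed.

End InversePower.

(** * Existence for the singular first-order equation *)

Section LeftProblem.
Context {R : realType}.
Implicit Types (del e eta : R).
Implicit Types (w : R -> R) (t x y : R).

(** For a travelling wave with speed c, and up to the reflection t |-> 1 - t, w is
    the opposite of the flux as a function of the value of the profile, k = c - h,
    and phi is the modulus of d^r g. The equation is singular at 0, where w
    vanishes, and possibly at T. *)
Definition singular_solution (r T : R) (S : seq R) (k phi w : R -> R) : Prop :=
  [/\ continuous w, w 0 = 0, (forall t, 0 < t < T -> 0 < w t) &
      forall t, 0 < t < T -> t \notin S ->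
        is_derive t 1 w (k t + phi t / w t `^ r)].

Variables (r T C : R) (S : seq R) (k phi K Phi : R -> R).
Hypotheses (r0 : 0 < r) (T0 : 0 < T).
Hypotheses (cK : continuous K) (cPhi : continuous Phi).
Hypothesis dK : forall t, 0 < t < T -> t \notin S -> is_derive t 1 K (k t).
Hypothesis dPhi : forall t, 0 < t < T -> t \notin S -> is_derive t 1 Phi (phi t).
Hypothesis kC : forall t, 0 < t < T -> `|k t| <= C.
Hypothesis phi0 : forall t, 0 < t < T -> 0 < phi t.
Hypothesis phi_low : forall x, 0 < x < T -> exists2 del, 0 < del &
  exists2 mu, 0 < mu & forall y, `|y - x| < del -> mu <= phi y.

Let phi_lowab a b : 0 < a -> a <= b -> b < T ->
  exists2 mu, 0 < mu & forall y, a <= y <= b -> mu <= phi y.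
Proof.
move=> a0 ab bT; apply: locally_bounded_below => // x /andP[ax xb].
by apply: phi_low; rewrite (lt_le_trans a0)//= (le_lt_trans xb).
Qed.

Let C0 : 0 <= C.
Proof.
have T2 : 0 < T / 2 < T by move: T0 => ?; lra.
by apply: le_trans (kC T2).
Qed.

Let Phi_le s t : 0 <= s -> s <= t -> t <= T -> Phi s <= Phi t.
Proof.
move=> s0 st tT; rewrite -lerN2.
apply: (@le0_derive_le _ (fun x => - Phi x) _ _ S) => // [x|x /andP[sx xt] xS].
  by apply: cvgN; exact: cPhi.
have x01 : 0 < x < T by lra.
exists (- phi x); first by apply: deriv_opp; exact: dPhi.
by have := phi0 x01; lra.
Qed.

Let Phi_lt s t : 0 <= s -> s < t -> t <= T -> Phi s < Phi t.
Proof.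
move=> s0 st tT; pose a := (2 * s + t) / 3; pose b := (s + 2 * t) / 3.
have [|||mu mu0 Hmu] := @phi_lowab a b; rewrite /a /b; [lra..|].
have : (fun x => mu * x - Phi x) b <= (fun x => mu * x - Phi x) a.
  apply: (@le0_derive_le _ (fun x => mu * x - Phi x) _ _ S); rewrite /a /b; first lra.
    by move=> x; apply: cvgB; [apply: cvgM; [exact: cvg_cst|exact: cvg_id]|exact: cPhi].
  move=> x /andP[ax xb] xS; have x01 : 0 < x < T by lra.
  exists (mu * 1 - phi x); first exact: deriv_sub (deriv_scale _ (deriv_var _)) (dPhi x01 xS).
  by have := Hmu x; rewrite /a /b; lra.
have h1 : Phi s <= Phi a by apply: Phi_le; rewrite /a; lra.
have h2 : Phi b <= Phi t by apply: Phi_le; rewrite /b; lra.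
have h3 : 0 < mu * (b - a) by rewrite mulr_gt0// /a /b; lra.
by rewrite /=; lra.
Qed.

(** The inverse of Phi, extended to the line so as to be monotone with all its
    values in [0, T], hence continuous. *)
Let theta tau := sup [set t | 0 <= t <= T /\ Phi t <= Num.max tau (Phi 0)].

Let theta_has tau : has_sup [set t | 0 <= t <= T /\ Phi t <= Num.max tau (Phi 0)].
Proof.
split; last by exists T => t [/andP[]].
by exists 0; rewrite /= lexx ltW// le_max lexx orbT.
Qed.

Let theta_range tau : 0 <= theta tau <= T.
Proof.
apply/andP; split.
  by apply: sup_upper_bound => //; rewrite /= lexx ltW// le_max lexx orbT.
by apply: ge_sup; [have [] := theta_has tau|move=> t [/andP[]]].
Qed.

Let thetaK t : 0 <= t <= T -> theta (Phi t) = t.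
Proof.
move=> /andP[t0 tT]; apply/eqP; rewrite eq_le; apply/andP; split; last first.
  by apply: sup_upper_bound; rewrite //= t0 tT le_max lexx.
apply: ge_sup; first by have [] := theta_has (Phi t).
move=> s [/andP[s1 s2]]; rewrite max_l => [H|]; last exact: Phi_le.
by rewrite leNgt; apply/negP => ts; have := Phi_lt t0 ts s2; rewrite ltNge H.
Qed.

Let theta_continuous : continuous theta.
Proof.
apply: (@monotone_onto_continuous _ _ 0 T) => [x y xy|x|u /andP[u0 uT]]; last first.
- by exists (Phi u); apply: thetaK; rewrite !ltW.
- exact: theta_range.
- apply: sup_le; [|by have [] := theta_has x|exact: theta_has].
  move=> t [t01 Ht]; exists t => //; split=> //; split=> //.
  by apply: (le_trans Ht); rewrite ge_max !le_max xy lexx orbT.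
Qed.

(** In the variable tau = Phi t, and after subtracting the primitive K, the
    equation becomes x' = G(x + kappa) with kappa continuous: the weight phi,
    which need not be bounded, disappears. *)
Lemma regular_ode (G : R -> R) (L M a w0 : R) : 0 <= a < T ->
  (forall x y, x <= y -> G y <= G x) ->
  (forall x y, x <= y -> G x - G y <= L * (y - x)) ->
  (forall x, 0 <= G x <= M) ->
  exists w, [/\ continuous w, w a = w0 &
    forall t, a < t < T -> t \notin S -> is_derive t 1 w (k t + phi t * G (w t))].
Proof.
move=> /andP[a0 aT] Ganti Glip Gbnd.
pose kappa tau := K (theta (tau + Phi a)) - K a + w0.
have ckappa : continuous kappa.
  move=> tau; apply: cvgD; last exact: cvg_cst.
  apply: cvgB; last exact: cvg_cst.
  apply: (@continuous_comp _ _ _ (fun tau => theta (tau + Phi a)) K); last exact: cK.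
  apply: (@continuous_comp _ _ _ (fun tau => tau + Phi a) theta).
    by apply: cvgD; [exact: cvg_id|exact: cvg_cst].
  exact: theta_continuous.
have Ta : 0 < Phi T - Phi a by rewrite subr_gt0 Phi_lt.
have [x [cx x0 dx]] := antitone_ode ckappa Ta Ganti Glip Gbnd.
exists (fun t => x (Phi t - Phi a) + (K t - K a + w0)); split.
- move=> t; apply: cvgD.
    apply: (@continuous_comp _ _ _ (fun t => Phi t - Phi a) x); last exact: cx.
    by apply: cvgB; [exact: cPhi|exact: cvg_cst].
  by apply: cvgD; [apply: cvgB; [exact: cK|exact: cvg_cst]|exact: cvg_cst].
- by rewrite !subrr x0 !add0r.
- move=> t /andP[at_ tT] tS; have t01 : 0 < t < T by lra.
  have tau01 : 0 < Phi t - Phi a < Phi T - Phi a.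
    by rewrite subr_gt0 ltrD2r !Phi_lt// ltW//; lra.
  have := deriv_add (deriv_comp (g := fun t => Phi t - Phi a) (dx _ tau01) (deriv_sub (dPhi t01 tS) (deriv_const (Phi a) t)))
    (deriv_add (deriv_sub (dK t01 tS) (deriv_const (K a) t)) (deriv_const w0 t)).
  rewrite /kappa subrK thetaK; last by lra.
  congr (is_derive _ _ _ _); ring.
Qed.

Let lev n : R := n.+1%:R^-1.
Let G n := truncated_ipow r (lev n).

Let lev0 n : 0 < lev n. Proof. by rewrite invr_gt0. Qed.

Let lev_anti m n : (m <= n)%N -> lev n <= lev m.
Proof. by move=> mn; rewrite lef_pV2 ?posrE// ler_nat. Qed.

Let G_bound n x : 0 <= G n x <= (lev n `^ r)^-1.
Proof. exact: truncated_ipow_bound. Qed.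

Let G_mono m n x : (m <= n)%N -> G m x <= G n x.
Proof.
move=> mn; apply: ipow_anti => //; first by rewrite lt_max lev0 orbT.
by rewrite ge_max !le_max lexx/= (lev_anti mn) orbT.
Qed.

Let regular n (a w0 : R) : 0 <= a < T -> exists w, [/\ continuous w, w a = w0 &
    forall t, a < t < T -> t \notin S -> is_derive t 1 w (k t + phi t * G n (w t))].
Proof.
move=> aT; apply: (regular_ode w0 aT (fun x y => truncated_ipow_anti r0 (lev0 n))
  (fun x y => truncated_ipow_lip r0 (lev0 n)) (G_bound n)).
Qed.

(** The right-hand side is nonincreasing in the unknown and increases with the
    index of the regularisation, so a gap between u and v cannot grow where u is
    the larger. *)
Let comparison m n a b u v : (m <= n)%N -> 0 <= a -> b <= T -> continuous u -> continuous v ->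
  (forall t, a < t < b -> t \notin S -> is_derive t 1 u (k t + phi t * G m (u t))) ->
  (forall t, a < t < b -> t \notin S -> is_derive t 1 v (k t + phi t * G n (v t))) ->
  forall e, 0 <= e -> u a <= v a + e -> forall t, a <= t <= b -> u t <= v t + e.
Proof.
move=> mn a0 bT cu cv du dv e e0 uva t tab.
suff : (fun t => u t - v t - e) t <= 0 by rewrite /=; lra.
apply: (@le0_comparison _ (fun t => u t - v t - e) a b 1 S) => //; last first.
- move=> x xab xS /andP[Dx _].
  exists (k x + phi x * G m (u x) - (k x + phi x * G n (v x)) - 0).
    exact: deriv_sub (deriv_sub (du _ xab xS) (dv _ xab xS)) (deriv_const _ _).
  have x01 : 0 < x < T by lra.
  have h1 : G m (u x) <= G n (v x).
    apply: (le_trans (G_mono _ mn)); apply: truncated_ipow_anti => //; lra.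
  by have := ler_wpM2l (ltW (phi0 x01)) h1; lra.
- lra.
- by move=> x; apply: cvgB; [apply: cvgB; [exact: cu|exact: cv]|exact: cvg_cst].
Qed.

Let ex_w : exists w : nat -> R -> R, forall n, [/\ continuous (w n), w n 0 = 0 &
    forall t, 0 < t < T -> t \notin S -> is_derive t 1 (w n) (k t + phi t * G n (w n t))].
Proof.
have H n := regular n 0 (ltac:(by rewrite lexx) : 0 <= 0 < T).
by have [w Hw] := choice H; exists w.
Qed.

Section Limit.
Variable w : nat -> R -> R.
Hypothesis cw : forall n, continuous (w n).
Hypothesis w0 : forall n, w n 0 = 0.
Hypothesis dw : forall n t, 0 < t < T -> t \notin S ->
  is_derive t 1 (w n) (k t + phi t * G n (w n t)).

Let w_mono m n t : (m <= n)%N -> 0 <= t <= T -> w m t <= w n t.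
Proof.
move=> mn tT; rewrite -[leRHS]addr0.
by apply: (comparison mn (lexx 0) (lexx T) (@cw m) (@cw n) (@dw m) (@dw n)); rewrite // !w0 addr0.
Qed.

(** Above the level eta the nonlinearity is at most eta^(-r). The bound is uniform
    in n; letting t and then eta tend to 0, it gives the limit its initial value. *)
Let w_upper eta n t : 0 < eta -> 0 <= t <= T ->
  w n t <= eta + C * t + (eta `^ r)^-1 * (Phi t - Phi 0).
Proof.
move=> eta0 tT; rewrite -subr_le0; pose E t := C * t + (eta `^ r)^-1 * Phi t.
pose D t := w n t - E t - (eta - (eta `^ r)^-1 * Phi 0).
suff : D t <= 0 by rewrite /D /E; lra.
apply: (@le0_comparison _ D 0 T 1 S) => //.
- move=> x; apply: cvgB; last exact: cvg_cst.
  apply: cvgB; first exact: cw.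
  apply: cvgD; apply: cvgM; try exact: cvg_cst; [exact: cvg_id|exact: cPhi].
- by rewrite /D /E w0; lra.
- move=> x x01 xS /andP[Dx _].
  exists (k x + phi x * G n (w n x) - (C * 1 + (eta `^ r)^-1 * phi x) - 0).
    exact: deriv_sub (deriv_sub (dw n x01 xS) (deriv_add (deriv_scale _ (deriv_var _))
      (deriv_scale _ (dPhi x01 xS)))) (deriv_const _ _).
  have Phix : 0 <= (eta `^ r)^-1 * (Phi x - Phi 0).
    rewrite mulr_ge0// ?invr_ge0 ?powR_ge0// subr_ge0; apply: Phi_le => //; lra.
  have Cx : 0 <= C * x by rewrite mulr_ge0//; lra.
  have etaw : eta <= w n x by move: Dx; rewrite /D /E; lra.
  have h1 : G n (w n x) <= (eta `^ r)^-1.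
    by apply: ipow_anti => //; rewrite le_max etaw.
  have := ler_wpM2l (ltW (phi0 x01)) h1.
  by have := kC x01; rewrite ler_norml; lra.
Qed.

Let w_lower n t : 0 <= t <= T -> - (C * t) <= w n t.
Proof.
move=> tT; pose D t := - (C * t) - w n t; suff : D t <= 0 by rewrite /D; lra.
apply: (@le0_comparison _ D 0 T 1 S) => //.
- move=> x; apply: cvgB; last exact: cw.
  by apply: cvgN; apply: cvgM; [exact: cvg_cst|exact: cvg_id].
- by rewrite /D w0; lra.
- move=> x x01 xS _; exists (- (C * 1) - (k x + phi x * G n (w n x))).
    exact: deriv_sub (deriv_opp (deriv_scale _ (deriv_var _))) (dw n x01 xS).
  have := kC x01; rewrite ler_norml => /andP[? _].
  have : 0 <= phi x * G n (w n x).
    by rewrite mulr_ge0 ?(ltW (phi0 _))//; have /andP[] := G_bound n (w n x).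
  lra.
Qed.

Let level_ge X : exists n, X <= (lev n `^ r)^-1.
Proof.
pose Y := Num.max X 1; have Y0 : 0 < Y by rewrite lt_max ltr01 orbT.
have [n _ /(_ n (leqnn n)) Hn] : \forall n \near \oo, Y `^ r^-1 <= n%:R :> R.
  exact: nbhs_infty_ger.
exists n; rewrite -powRN /lev -powR_inv1// -powRrM mulN1r opprK.
apply: (@le_trans _ _ Y); first by rewrite le_max lexx.
rewrite -[leLHS]powRr1 ?(ltW Y0)// -[X in Y `^ X](@mulVf _ r) ?gt_eqF// powRrM.
apply: powR_le => //; first exact: powR_ge0.
by apply: (le_trans Hn); rewrite ler_nat.
Qed.

(** Below the level 1/(N+1) the frozen nonlinearity is so large that the slope is at
    least C + 2/a: starting from -C a/2 at a/2 at the lowest, the solution is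
    above the level before a, and it cannot go below it afterwards. *)
Let w_positive a b : 0 < a -> a <= b -> b < T -> exists N, forall n t,
  (N <= n)%N -> a <= t <= b -> lev N <= w n t.
Proof.
move=> a0 ab bT.
have [|||mu mu0 Hmu] := @phi_lowab (a / 2) b; [lra..|].
have [N HN] := level_ge ((C + (C + 2 / a)) / mu).
exists N => n t Nn tab; apply: (@le_trans _ _ (w N t)); last by apply: w_mono => //; lra.
have slope x : a / 2 < x < b -> w N x <= lev N -> C + 2 / a <= k x + phi x * G N (w N x).
  move=> xab wx; rewrite /G truncated_ipow_le//.
  have h1 : (C + (C + 2 / a)) <= phi x * (lev N `^ r)^-1.
    rewrite ler_pdivrMr// in HN; apply: (le_trans HN); rewrite [leLHS]mulrC.
    by rewrite ler_wpM2r ?invr_ge0 ?powR_ge0// Hmu//; lra.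
  have x01 : 0 < x < T by lra.
  have := kC x01; rewrite ler_norml; lra.
have slope0 : 0 <= C + 2 / a by rewrite addr_ge0// divr_ge0// ltW.
have at_a : lev N <= w N a.
  pose D t := lev N - (C + 2 / a) * (a - t) - w N t.
  suff : D a <= 0 by rewrite /D subrr mulr0; lra.
  apply: (@le0_comparison _ D (a / 2) a 1 S) => //; last by apply/andP; split; lra.
  - move=> x; apply: cvgB; last exact: cw.
    apply: cvgB; first exact: cvg_cst.
    by apply: cvgM; [exact: cvg_cst|apply: cvgB; [exact: cvg_cst|exact: cvg_id]].
  - rewrite /D; have := w_lower N (t := a / 2) ltac:(lra).
    have -> : (C + 2 / a) * (a - a / 2) = C * (a / 2) + 1 by field; rewrite gt_eqF.
    have : lev N <= 1 by rewrite invf_le1// ler1n.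
    lra.
  - move=> x /andP[x1 x2] xS /andP[Dx _].
    exists (0 - (C + 2 / a) * (0 - 1) - (k x + phi x * G N (w N x))).
      have x01 : 0 < x < T by lra.
      exact: deriv_sub (deriv_sub (deriv_const _ _)
        (deriv_scale _ (deriv_sub (deriv_const _ _) (deriv_var _)))) (dw N x01 xS).
    have : C + 2 / a <= k x + phi x * G N (w N x).
      apply: slope; first lra.
      have : 0 <= (C + 2 / a) * (a - x) by rewrite mulr_ge0//; lra.
      by move: Dx; rewrite /D; lra.
    lra.
pose D t := lev N - w N t; suff : D t <= 0 by rewrite /D; lra.
apply: (@le0_comparison _ D a b 1 S) => //.
- by move=> x; apply: cvgB; [exact: cvg_cst|exact: cw].
- by rewrite /D; lra.
- move=> x /andP[x1 x2] xS /andP[Dx _].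
  exists (0 - (k x + phi x * G N (w N x))).
    have x01 : 0 < x < T by lra.
    exact: deriv_sub (deriv_const _ _) (dw N x01 xS).
  have := slope x; move: Dx; rewrite /D; lra.
Qed.

(* the regularised solutions increase with n *)
Let W0 t := sup [set w n t | n in [set: nat]].

Let W0_has t : 0 <= t <= T -> has_sup [set w n t | n in [set: nat]].
Proof.
move=> tT; split; first by exists (w 0%N t), 0%N.
exists (1 + C * t + (1 `^ r)^-1 * (Phi t - Phi 0)) => _ [n _ <-].
exact: w_upper.
Qed.

Let w_le_W0 n t : 0 <= t <= T -> w n t <= W0 t.
Proof. by move=> tT; apply: sup_upper_bound; [exact: W0_has|exists n]. Qed.

Let W0_le t c : 0 <= t <= T -> (forall n, w n t <= c) -> W0 t <= c.
Proof. by move=> tT H; apply: ge_sup; [have [] := W0_has tT|move=> _ [n _ <-]]. Qed.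

Let W0_approx t e : 0 <= t <= T -> 0 < e -> exists N, forall n, (N <= n)%N -> W0 t - e < w n t.
Proof.
move=> tT e0; have [_ [N _ <-] HN] := sup_adherent e0 (W0_has tT).
by exists N => n Nn; apply: (lt_le_trans HN); exact: w_mono.
Qed.

(** Away from the singular end the limit coincides with a regularised solution
    started on it, because the distance between solutions does not increase. *)
Let W0_local a b : 0 < a -> a <= b -> b < T -> exists v,
  [/\ continuous v, forall t, a <= t <= b -> W0 t = v t, forall t, a <= t <= b -> 0 < W0 t &
   forall t, a < t < b -> t \notin S -> is_derive t 1 v (k t + phi t / v t `^ r)].
Proof.
move=> a0 ab bT; have [N HN] := w_positive a0 ab bT.
have aT : 0 <= a < T by lra.
have [v [cv va dv]] := regular N (W0 a) aT.
have W0v t : a <= t <= b -> W0 t = v t.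
  move=> tab; apply/eqP; rewrite -subr_eq0 -normr_le0; apply/ler_addgt0Pr => e e0.
  have e20 : 0 < e / 2 by lra.
  have [||n1 H1] := @W0_approx a (e / 2); [lra..|].
  have [||n2 H2] := @W0_approx t (e / 2); [lra..|].
  pose n := maxn N (maxn n1 n2).
  have Nn : (N <= n)%N by rewrite leq_maxl.
  have {}H1 : W0 a - e / 2 < w n a by apply: H1; rewrite !leq_max leqnn !orbT.
  have {}H2 : W0 t - e / 2 < w n t by apply: H2; rewrite !leq_max leqnn !orbT.
  have dwn x : a < x < b -> x \notin S -> is_derive x 1 (w n) (k x + phi x * G N (w n x)).
    move=> xab xS; have := @dw n x ltac:(lra) xS.
    have wN : lev N <= w n x by apply: HN => //; lra.
    by rewrite /G !truncated_ipow_ge//; exact: le_trans (lev_anti Nn) wN.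
  have dvb x : a < x < b -> x \notin S -> is_derive x 1 v (k x + phi x * G N (v x)).
    by move=> xab xS; apply: dv => //; lra.
  have a0' := ltW a0; have bT' := ltW bT.
  have wnT := @w_le_W0 n a ltac:(lra).
  have c1 : w n t <= v t + e / 2.
    by apply: (comparison (leqnn N) a0' bT' (@cw n) cv dwn dvb) => //; [exact: ltW|rewrite va; lra].
  have c2 : v t <= w n t + e / 2.
    by apply: (comparison (leqnn N) a0' bT' cv (@cw n) dvb dwn) => //; [exact: ltW|rewrite va; lra].
  have := @w_le_W0 n t ltac:(lra).
  by rewrite add0r ler_norml; lra.
have levW t : a <= t <= b -> lev N <= W0 t.
  by move=> tab; apply: le_trans (HN N t (leqnn _) tab) _; apply: w_le_W0; lra.
exists v; split=> // t tab; first exact: lt_le_trans (levW t tab).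
move=> tS; have := dv t ltac:(lra) tS.
by rewrite /G truncated_ipow_ge// -W0v ?levW//; lra.
Qed.

Let W0_at0 : W0 0 = 0.
Proof.
have z : 0 <= (0 : R) <= T by rewrite lexx ltW.
apply/eqP; rewrite eq_le; apply/andP; split; first by apply: W0_le => // n; rewrite w0.
by have := w_le_W0 0%N z; rewrite w0.
Qed.

(** At T the limit is continuous because it is a supremum of continuous functions
    which, up to the term C t, are nondecreasing. *)
Let W0_continuous : {within `[0, T], continuous W0}.
Proof.
apply/(continuous_within_itvP _ T0); split.
- move=> t; rewrite in_itv/= => t01.
  have [|||v [cv Wv _ _]] := @W0_local (t / 2) ((t + T) / 2); [lra..|].
  have ne : \forall x \near t, v x = W0 x.
    have : t \in `](t / 2), ((t + T) / 2)[ by rewrite in_itv/=; lra.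
    move=> /near_in_itvoo; apply: filterS => x; rewrite in_itv/= => xab.
    by rewrite Wv//; lra.
  have Wt : W0 t = v t by rewrite Wv//; lra.
  have : W0 x @[x --> t] --> v t by apply: cvg_trans (cv t); apply: near_eq_cvg.
  by rewrite -Wt.
- apply/cvg_right_epsP => e e0; rewrite W0_at0.
  have e40 : 0 < e / 4 by lra.
  have /continuous_epsP/(_ _ e0)[d1 d10 H1] := @cw 0%N 0.
  pose E t := C * t + ((e / 4) `^ r)^-1 * (Phi t - Phi 0).
  have cE : {for 0, continuous E}.
    apply: cvgD; first by apply: cvgM; [exact: cvg_cst|exact: cvg_id].
    by apply: cvgM; [exact: cvg_cst|apply: cvgB; [exact: cPhi|exact: cvg_cst]].
  have /continuous_epsP/(_ _ e40)[d2 d20 H2] := cE.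
  exists (Num.min T (Num.min d1 d2)); first by rewrite !lt_min T0 d10.
  move=> t; rewrite add0r !lt_min => /andP[t0 /and3P[tT td1 td2]].
  have t01 : 0 <= t <= T by lra.
  have := H1 t; have := H2 t; rewrite subr0 gtr0_norm// => /(_ td2) h2 /(_ td1).
  rewrite w0 subr0 !ltr_norml => /andP[h1 _].
  have := @w_le_W0 0%N t t01.
  have : W0 t <= e / 4 + E t.
    by apply: W0_le => // n; rewrite /E addrA; apply: w_upper.
  move: h2; rewrite /E subrr !mulr0 addr0 subr0 ltr_norml => /andP[_].
  by rewrite -/(W0 t) => *; apply/andP; split; lra.
- apply/cvg_left_epsP => e e0; have T0' := T0; have C0' := C0.
  have e20 : 0 < e / 2 by lra.
  have TT : 0 <= T <= T by lra.
  have [N /(_ N (leqnn N)) HN] := W0_approx TT e20.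
  have /continuous_epsP/(_ _ e20)[d1 d10 H1] := @cw N T.
  exists (Num.min T (Num.min d1 (e / (C + 1)))).
    by rewrite !lt_min T0 d10 divr_gt0//; lra.
  move=> t /andP[]; rewrite ltrBlDr -ltrBlDl !lt_min => /and3P[t0 td1].
  rewrite ltr_pdivlMr; last lra.
  move=> tC tT; have t01 : 0 <= t <= T by lra.
  have := @w_le_W0 N t t01.
  have := H1 t; rewrite ltr0_norm ?subr_lt0// opprB => /(_ td1); rewrite ltr_norml => /andP[h1 _].
  suff : W0 t <= W0 T + C * (T - t) by rewrite -/(W0 t) -/(W0 T) ltr_norml; move: HN; lra.
  apply: W0_le => // n; apply: (@le_trans _ _ (w n T + C * (T - t))); last first.
    by rewrite lerD2r w_le_W0.
  suff : (fun x => - (w n x + C * x)) T <= (fun x => - (w n x + C * x)) t by rewrite /=; lra.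
  apply: (@le0_derive_le _ (fun x => - (w n x + C * x)) _ _ S); first exact: ltW.
    move=> x; apply: cvgN; apply: cvgD; first exact: cw.
    by apply: cvgM; [exact: cvg_cst|exact: cvg_id].
  move=> x /andP[x1 x2] xS; have x01 : 0 < x < T by lra.
  exists (- (k x + phi x * G n (w n x) + C * 1)).
    exact: deriv_opp (deriv_add (dw n x01 xS) (deriv_scale _ (deriv_var _))).
  have := kC x01; rewrite ler_norml => /andP[? _].
  have : 0 <= phi x * G n (w n x).
    by rewrite mulr_ge0 ?(ltW (phi0 _))//; have /andP[] := G_bound n (w n x).
  lra.
Qed.

Let limit_solution : singular_solution r T S k phi (W0 \o clamp 0 T).
Proof.
have cl t : 0 <= t <= T -> (W0 \o clamp 0 T) t = W0 t by move=> tT; rewrite /= clamp_id.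
split.
- by apply: clamp_continuous W0_continuous; exact: ltW.
- by rewrite /= clamp_id ?W0_at0// lexx ltW.
- move=> t t01; rewrite /= clamp_id; last lra.
  have [|||v [_ _ Wp _]] := @W0_local (t / 2) ((t + T) / 2); [lra..|].
  by apply: Wp; lra.
- move=> t t01 tS; rewrite /= clamp_id; last lra.
  have [|||v [cv Wv _ dv]] := @W0_local (t / 2) ((t + T) / 2); [lra..|].
  have ne : \forall x \near t, v x = (W0 \o clamp 0 T) x.
    have : t \in `](t / 2), ((t + T) / 2)[ by rewrite in_itv/=; lra.
    move=> /near_in_itvoo; apply: filterS => x; rewrite in_itv/= => xab.
    by rewrite /= clamp_id ?Wv//; lra.
  have -> : W0 t = v t by rewrite Wv//; lra.
  by apply: near_eq_is_derive ne _; apply: dv => //; lra.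
Qed.

Lemma singular_solution_of_sequence : exists w, singular_solution r T S k phi w.
Proof. by exists (W0 \o clamp 0 T); exact: limit_solution. Qed.

End Limit.

(** The solution is the limit of solutions with the nonlinearity frozen at lower
    and lower levels. They increase, are bounded, and on each compact part of
    ]0, T[ they end up above the freezing level, so that the limit solves the
    singular equation there. *)
Theorem singular_solution_exists : exists w, singular_solution r T S k phi w.
Proof.
have [w Hw] := ex_w.
by apply: (@singular_solution_of_sequence w) => n; have [] := Hw n.
Qed.

End LeftProblem.

(** * Dependence on the drift and behaviour at the far end *)

Section Comparison.
Context {R : realType}.
Implicit Types (del e eta : R).
Variables (r T : R) (S : seq R) (phi : R -> R).
Hypotheses (r0 : 0 < r) (T0 : 0 < T).
Hypothesis phi0 : forall t, 0 < t < T -> 0 < phi t.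

Lemma singular_solution_ge0 k w t : singular_solution r T S k phi w -> 0 <= t <= T -> 0 <= w t.
Proof.
move=> [cw w0 wp _] /andP[]; rewrite le_eqVlt => /predU1P[<- _|t0].
  by rewrite w0.
rewrite le_eqVlt => /predU1P[->|tT]; last by rewrite ltW// wp// t0.
rewrite leNgt; apply/negP => wT.
have wT' : 0 < - w T by rewrite oppr_gt0.
have /continuous_epsP/(_ _ wT')[d d0 Hd] := cw T.
pose s := Num.max (T - d / 2) (T / 2).
have T0' := T0.
have sT : 0 < s < T by rewrite /s; case: (leP (T - d / 2) (T / 2)) => ?; lra.
have sd : T - d < s by rewrite /s; case: (leP (T - d / 2) (T / 2)) => ?; lra.
have : `|w s - w T| < - w T by apply: Hd; rewrite ltr_norml; lra.
by have := wp s sT; rewrite ltr_norml; lra.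
Qed.

(** The term phi / w^r decreases with w, so it can only reduce a gap between two
    solutions. *)
Lemma singular_solution_lip k1 k2 w1 w2 e : 0 <= e ->
  singular_solution r T S k1 phi w1 -> singular_solution r T S k2 phi w2 ->
  (forall t, 0 < t < T -> k2 t <= k1 t + e) ->
  forall t, 0 <= t <= T -> w2 t <= w1 t + e * t.
Proof.
move=> e0 [cw1 w10 w1p dw1] [cw2 w20 w2p dw2] k12 t t01.
suff : (fun t => w2 t - w1 t - e * t) t <= 0 by rewrite /=; lra.
apply: (@le0_comparison _ (fun t => w2 t - w1 t - e * t) 0 T 1 S) => //.
- move=> x; apply: cvgB; first by apply: cvgB; [exact: cw2|exact: cw1].
  by apply: cvgM; [exact: cvg_cst|exact: cvg_id].
- by rewrite w10 w20; lra.
move=> x x01 xS /andP[Dx _].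
exists (k2 x + phi x / w2 x `^ r - (k1 x + phi x / w1 x `^ r) - e * 1).
  exact: deriv_sub (deriv_sub (dw2 _ x01 xS) (dw1 _ x01 xS)) (deriv_scale _ (deriv_var _)).
have w12 : w1 x <= w2 x.
  have : 0 <= e * x by rewrite mulr_ge0//; lra.
  by lra.
have := ler_wpM2l (ltW (phi0 x01)) (ipow_anti r0 (w1p _ x01) w12).
by have := k12 _ x01; lra.
Qed.

Lemma singular_solution_le k1 k2 w1 w2 :
  singular_solution r T S k1 phi w1 -> singular_solution r T S k2 phi w2 ->
  (forall t, 0 < t < T -> k1 t <= k2 t) -> forall t, 0 <= t <= T -> w1 t <= w2 t.
Proof.
move=> s1 s2 k12 t t01; have := singular_solution_lip (lexx 0) s2 s1 _ t01.
by rewrite mul0r addr0; apply => s s01; rewrite addr0 k12.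
Qed.

(** Near T the solutions are bounded away from 0, where x^(-r) is Lipschitz. With
    the Gronwall factor exp(L Phi) the gap then has a positive lower slope. *)
Lemma singular_solution_lt k1 k2 w1 w2 Phi e : 0 < e ->
  continuous Phi -> (forall t, 0 < t < T -> t \notin S -> is_derive t 1 Phi (phi t)) ->
  singular_solution r T S k1 phi w1 -> singular_solution r T S k2 phi w2 ->
  (forall t, 0 < t < T -> k1 t + e <= k2 t) -> 0 < w1 T -> w1 T < w2 T.
Proof.
move=> e0 cPhi dPhi s1 s2 k12 w1T.
have w12 : forall t, 0 <= t <= T -> w1 t <= w2 t.
  by apply: singular_solution_le s1 s2 _ => t /k12; lra.
have [cw1 w10 w1p dw1] := s1; have [cw2 w20 w2p dw2] := s2.
have T0' := T0.
have /continuous_epsP/(_ (w1 T / 2))[|d d0 Hd] := cw1 T; first by lra.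
pose b := Num.max (T - d / 2) (T / 2).
have bT : 0 < b < T by rewrite /b; case: (leP (T - d / 2) (T / 2)) => ?; lra.
have bd : T - d < b by rewrite /b; case: (leP (T - d / 2) (T / 2)) => ?; lra.
pose th := w1 T / 2; have th0 : 0 < th by rewrite /th; lra.
have wth t : b < t < T -> th <= w1 t.
  move=> tb; have : `|w1 t - w1 T| < w1 T / 2 by apply: Hd; rewrite ltr_norml; lra.
  by rewrite ltr_norml /th; lra.
pose L := r * th `^ (- r - 1); have L0 : 0 <= L by rewrite mulr_ge0 ?powR_ge0// ltW.
pose F t := (w2 t - w1 t) * expR (L * Phi t); pose m := expR (L * Phi b).
have m0 : 0 < m := expR_gt0 _.
have cF : continuous F.
  move=> x; apply: cvgM; first by apply: cvgB; [exact: cw2|exact: cw1].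
  apply: (@continuous_comp _ _ _ (fun x => L * Phi x) expR); last exact: continuous_expR.
  by apply: cvgM; [exact: cvg_cst|exact: cPhi].
have Phi_mono x : b <= x < T -> Phi b <= Phi x.
  move=> xbT; rewrite -lerN2.
  apply: (@le0_derive_le _ (fun x => - Phi x) _ _ S); first by lra.
    by move=> y; apply: cvgN; exact: cPhi.
  move=> y ybx yS; have y01 : 0 < y < T by lra.
  exists (- phi y); first exact: deriv_opp (dPhi _ y01 yS).
  by rewrite oppr_le0 ltW// phi0.
have HF : (fun t => e * m * t - F t) T <= (fun t => e * m * t - F t) b.
  apply: (@le0_derive_le _ (fun t => e * m * t - F t) _ _ S); first by lra.
    by move=> x; apply: cvgB; [apply: cvgM; [exact: cvg_cst|exact: cvg_id]|exact: cF].
  move=> x xbT xS; have x01 : 0 < x < T by lra.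
  have dF := deriv_mul (deriv_sub (dw2 _ x01 xS) (dw1 _ x01 xS))
     (deriv_comp (g := fun t => L * Phi t) (is_derive_expR (L * Phi x)) (deriv_scale L (dPhi _ x01 xS))).
  exists (e * m * 1 - ((k2 x + phi x / w2 x `^ r - (k1 x + phi x / w1 x `^ r)) * expR (L * Phi x) +
       (w2 x - w1 x) * (expR (L * Phi x) * (L * phi x)))).
    exact: deriv_sub (deriv_scale _ (deriv_var _)) dF.
  set E := expR (L * Phi x).
  have mE : m <= E by rewrite ler_expR ler_wpM2l// Phi_mono//; lra.
  have w12x : w1 x <= w2 x by apply: w12; lra.
  have lip := truncated_ipow_lip r0 th0 w12x.
  have thx : th <= w1 x by apply: wth.
  rewrite !truncated_ipow_ge// in lip; last exact: le_trans w12x.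
  have := ler_wpM2l (ltW (phi0 x01)) lip; rewrite -/L => lip'.
  suff : e * m <= ((k2 x + phi x / w2 x `^ r - (k1 x + phi x / w1 x `^ r)) + (w2 x - w1 x) * (L * phi x)) * E.
    by rewrite mulrDl; lra.
  apply: (@le_trans _ _ (e * E)); first by rewrite ler_wpM2l// ltW.
  by rewrite ler_wpM2r ?expR_ge0//; have := k12 _ x01; lra.
have Fb : 0 <= F b by rewrite mulr_ge0 ?expR_ge0// subr_ge0 w12//; lra.
have : 0 < e * m * (T - b) by rewrite !mulr_gt0//; lra.
move=> h; have : 0 < F T by move: HF; rewrite /=; lra.
by rewrite /F pmulr_lgt0 ?expR_gt0// subr_gt0.
Qed.

(** If the drift is at most -kappa, a solution positive at T would stay above the
    line of slope -lam through (T, 0) when followed backwards, and could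
    not vanish at 0. *)
Lemma singular_solution_vanishes k w mu kappa lam : 0 < lam -> 0 <= mu ->
  singular_solution r T S k phi w ->
  (forall t, 0 < t < T -> k t <= - kappa) ->
  (forall t, 0 < t < T -> phi t <= mu * (T - t) `^ r) ->
  lam + mu / lam `^ r <= kappa -> w T <= 0.
Proof.
move=> lam0 mu0 [cw w0 wp dw] kk phimu lamk; rewrite leNgt; apply/negP => wT.
(* the time is reversed, s = T - t, so that the comparison starts at T *)
pose D s := lam * s + w T - w (T - s).
have : D T <= 0.
  apply: (@le0_comparison _ D 0 T (w T) [seq T - s | s <- S]) => //.
  - move=> x; apply: cvgB.
      by apply: cvgD; [apply: cvgM; [exact: cvg_cst|exact: cvg_id]|exact: cvg_cst].
    apply: (@continuous_comp _ _ _ (fun s => T - s) w); last exact: cw.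
    by apply: cvgB; [exact: cvg_cst|exact: cvg_id].
  - by rewrite /D mulr0 add0r !subr0 subrr.
  - move=> s s01 sS /andP[D0 DT].
    have x01 : 0 < T - s < T by lra.
    have xS : T - s \notin S.
      by apply: contra sS => h; apply/mapP; exists (T - s) => //; rewrite subKr.
    have d := deriv_sub (deriv_add (deriv_scale lam (deriv_var s)) (deriv_const (w T) s))
      (deriv_comp (g := fun s => T - s) (dw _ x01 xS) (deriv_sub (deriv_const T s) (deriv_var s))).
    eexists; first exact: d.
    have ws : lam * s <= w (T - s) by move: DT; rewrite /D; lra.
    have [s0 _] := andP s01.
    have ls0 : 0 < lam * s by rewrite mulr_gt0.
    suff : phi (T - s) / w (T - s) `^ r <= mu / lam `^ r.
      by have := kk _ x01; lra.
    apply: (@le_trans _ _ (mu * s `^ r / (lam * s) `^ r)).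
      rewrite ler_pM ?invr_ge0 ?powR_ge0 ?ipow_anti// ?(ltW (phi0 _))//.
      by have := phimu _ x01; rewrite subKr.
    by rewrite powRM ?(ltW lam0) ?(ltW s0)// -mulf_div divff ?mulr1// gt_eqF// powR_gt0.
  - by rewrite lexx ltW.
rewrite /D subrr w0; have : 0 <= lam * T by rewrite mulr_ge0// ltW.
by lra.
Qed.

Lemma singular_solution_pos_of_drift_ge0 k w t0 : t0 < T ->
  singular_solution r T S k phi w ->
  (forall t, t0 < t < T -> 0 <= k t) -> 0 < w T.
Proof.
move=> t0T [cw w0 wp dw] k0; pose b := Num.max (T / 2) ((t0 + T) / 2).
have T0' := T0.
have bT : 0 < b < T /\ t0 < b by rewrite /b; case: (leP (T / 2) ((t0 + T) / 2)) => ?; lra.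
have wb : 0 < w b by apply: wp; lra.
apply: (lt_le_trans wb); rewrite -lerN2.
apply: (@le0_derive_le _ (fun x => - w x) _ _ S); first by lra.
  by move=> y; apply: cvgN; exact: cw.
move=> y ybT yS; have y01 : 0 < y < T by lra.
exists (- (k y + phi y / w y `^ r)); first exact: deriv_opp (dw _ y01 yS).
rewrite oppr_le0 addr_ge0//; first by apply: k0; lra.
by rewrite divr_ge0 ?powR_ge0// ltW// phi0.
Qed.

(** The solution increases whenever it is below the line of slope -eps through
    (T, 0), so it stays above that line; near T its slope exceeds -eps/2, so it
    cannot reach 0 at T. *)
Lemma singular_solution_pos_of_drift_small k w B t0 : t0 < T -> 0 < B ->
  singular_solution r T S k phi w ->
  (forall t, t0 < t < T -> - (B * phi t) <= (T - t) `^ r * k t) ->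
  (forall e, 0 < e -> exists2 t1, t1 < T & forall t, t1 < t < T -> - e <= k t) ->
  0 < w T.
Proof.
move=> t0T B0 [cw w0 wp dw] kphi ksmall; pose b := Num.max (T / 2) ((t0 + T) / 2).
have T0' := T0.
have bT : 0 < b < T /\ t0 < b by rewrite /b; case: (leP (T / 2) ((t0 + T) / 2)) => ?; lra.
have wb : 0 < w b by apply: wp; lra.
(* eps^r <= 1/B makes w nondecreasing below the line, and w b is above the line *)
pose eps := Num.min (B `^ (- r^-1)) (w b / (T - b)).
have Tb : 0 < T - b by lra.
have eps0 : 0 < eps by rewrite lt_min powR_gt0// divr_gt0.
have epsB : B * eps `^ r <= 1.
  apply: (@le_trans _ _ (B * (B `^ (- r^-1)) `^ r)).
    by rewrite ler_wpM2l ?(ltW B0)// powR_le// ?(ltW eps0)// ge_min lexx.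
  by rewrite -powRrM mulNr mulVf ?gt_eqF// powR_inv1 ?(ltW B0)// divff// gt_eqF.
have line t : b <= t <= T -> eps * (T - t) <= w t.
  move=> tbT; suff : (fun t => eps * (T - t) - w t) t <= 0 by rewrite /=; lra.
  apply: (@le0_comparison _ (fun t => eps * (T - t) - w t) b T 1 S) => //.
  - move=> x; apply: cvgB; last exact: cw.
    by apply: cvgM; [exact: cvg_cst|apply: cvgB; [exact: cvg_cst|exact: cvg_id]].
  - by rewrite subr_le0 -ler_pdivlMr// ge_min lexx orbT.
  - move=> x xbT xS /andP[D0 _]; have x01 : 0 < x < T by lra.
    exists (eps * (0 - 1) - (k x + phi x / w x `^ r)).
      exact: deriv_sub (deriv_scale _ (deriv_sub (deriv_const _ _) (deriv_var _))) (dw _ x01 xS).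
    suff : 0 <= k x + phi x / w x `^ r by lra.
    have wx := wp _ x01; have Tx : 0 < T - x by lra.
    have wl : w x <= eps * (T - x) by lra.
    have pT : 0 < (T - x) `^ r by rewrite powR_gt0.
    rewrite -(pmulr_rge0 _ pT) mulrDr.
    have h1 : phi x * B <= (T - x) `^ r * (phi x / w x `^ r).
      rewrite mulrCA ler_wpM2l ?(ltW (phi0 _))// ler_pdivlMr ?powR_gt0//.
      apply: (@le_trans _ _ (B * (eps * (T - x)) `^ r)).
        by rewrite ler_wpM2l ?(ltW B0)// powR_le// ltW.
      rewrite powRM ?(ltW eps0) ?(ltW Tx)// mulrA ler_piMl// ltW//.
    have : - (B * phi x) <= (T - x) `^ r * k x by apply: kphi; lra.
    by lra.
have [|t1 t1T Hk] := ksmall (eps / 2); first by rewrite divr_gt0.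
pose c := Num.max b ((t1 + T) / 2).
have cT : b <= c < T /\ t1 < c by rewrite /c; case: (leP b ((t1 + T) / 2)) => ?; lra.
have : (fun x => - w x - eps / 2 * x) T <= (fun x => - w x - eps / 2 * x) c.
  apply: (@le0_derive_le _ (fun x => - w x - eps / 2 * x) _ _ S); first by lra.
    move=> y; apply: cvgB; first by apply: cvgN; exact: cw.
    by apply: cvgM; [exact: cvg_cst|exact: cvg_id].
  move=> y ybT yS; have y01 : 0 < y < T by lra.
  exists (- (k y + phi y / w y `^ r) - eps / 2 * 1).
    exact: deriv_sub (deriv_opp (dw _ y01 yS)) (deriv_scale _ (deriv_var _)).
  have : 0 <= phi y / w y `^ r by rewrite divr_ge0 ?powR_ge0// ltW// phi0.
  by have := Hk y; lra.
have := line c; have : 0 < eps * (T - c) by rewrite mulr_gt0//; lra.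
by rewrite /=; lra.
Qed.

End Comparison.

(** * Shooting: the speed at which the two half-waves match *)

Section Shooting.
Context {R : realType}.
Implicit Types (del mu e : R).

Variables (r s M : R) (S : seq R) (f h F H : R -> R).
Hypotheses (r0 : 0 < r) (s01 : 0 < s < 1).
Hypotheses (cF : continuous F) (cH : continuous H).
Hypothesis dF : forall t, 0 < t < 1 -> t \notin S -> is_derive t 1 F (f t).
Hypothesis dH : forall t, 0 < t < 1 -> t \notin S -> is_derive t 1 H (h t).
Hypothesis hM : forall t, 0 <= t <= 1 -> `|h t| <= M.
Hypothesis f_neg : forall t, 0 < t < s -> f t < 0.
Hypothesis f_pos : forall t, s < t < 1 -> 0 < f t.
Hypothesis f_low : forall x, 0 < x < 1 -> x != s -> exists2 del, 0 < del &
  exists2 mu, 0 < mu & forall y, `|y - x| < del -> mu <= `|f y|.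

(** On [0, s] the profile in the phase plane is a singular solution; on [s, 1] it
    is one after the reflection t |-> 1 - t, which exchanges c - h and h - c. *)
Definition left_wave c w :=
  singular_solution r s S (fun t => c - h t) (fun t => - f t) w.
Definition right_wave c w :=
  singular_solution r (1 - s) [seq 1 - t | t <- S]
    (fun t => h (1 - t) - c) (fun t => f (1 - t)) w.

Let M0 : 0 <= M.
Proof. by apply: le_trans (hM (t := 0) _) => //; rewrite lexx ler01. Qed.

Let reflect_notin t : t \notin [seq 1 - t | t <- S] -> 1 - t \notin S.
Proof. by apply: contra => tS; apply/mapP; exists (1 - t) => //; rewrite subKr. Qed.

Let left_phi0 t : 0 < t < s -> 0 < - f t.
Proof. by move=> /f_neg; rewrite oppr_gt0. Qed.

Let right_phi0 t : 0 < t < 1 - s -> 0 < f (1 - t).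
Proof. by move=> ts; apply: f_pos; lra. Qed.

Let dleftPhi t : 0 < t < s -> t \notin S -> is_derive t 1 (fun t => - F t) (- f t).
Proof.
by have s1 := s01; move=> ts tS; apply: deriv_opp; apply: dF => //; lra.
Qed.

Let drightPhi t : 0 < t < 1 - s -> t \notin [seq 1 - t | t <- S] ->
  is_derive t 1 (fun t => - F (1 - t)) (f (1 - t)).
Proof.
have s1 := s01; move=> ts tS; have t01 : 0 < 1 - t < 1 by lra.
have := deriv_opp (deriv_comp (g := fun t => 1 - t) (dF t01 (reflect_notin tS))
  (deriv_sub (deriv_const 1 t) (deriv_var t))).
by congr (is_derive _ _ _ _); ring.
Qed.

Let cleftPhi : continuous (fun t => - F t).
Proof. by move=> x; apply: cvgN; exact: cF. Qed.

Let comp_reflect (g : R -> R) : continuous g -> continuous (fun t : R => g (1 - t)).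
Proof.
move=> cg x; apply: (@continuous_comp _ _ _ (fun t : R => 1 - t) g); last exact: cg.
by apply: cvgB; [exact: cvg_cst|exact: cvg_id].
Qed.

Let crightPhi : continuous (fun t : R => - F (1 - t)).
Proof. by move=> x; apply: cvgN; exact: (comp_reflect cF). Qed.

Lemma left_wave_exists c : exists w, left_wave c w.
Proof.
have s1 := s01; have ss : 0 < s by lra.
apply: (@singular_solution_exists _ r s (`|c| + M) S _ _ (fun t => c * t - H t) _
  r0 ss _ cleftPhi _ dleftPhi _ left_phi0).
- by move=> x; apply: cvgB; [apply: cvgM; [exact: cvg_cst|exact: cvg_id]|exact: cH].
- move=> t ts tS; have t01 : 0 < t < 1 by lra.
  have := deriv_sub (deriv_scale c (deriv_var t)) (dH t01 tS).
  by rewrite mulr1.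
- move=> t ts; apply: (le_trans (ler_normB _ _)); rewrite lerD2l; apply: hM; lra.
- move=> x xs; have [||d d0 [mu mu0 Hd]] := @f_low x; [lra|by apply/eqP; lra|].
  exists (Num.min d (Num.min x (s - x))); first by rewrite !lt_min d0; lra.
  exists mu => // y; rewrite !lt_min !ltr_norml => /and3P[yd yx ys].
  have /Hd : `|y - x| < d by rewrite ltr_norml.
  by rewrite ltr0_norm// f_neg//; lra.
Qed.

Lemma right_wave_exists c : exists w, right_wave c w.
Proof.
have s1 := s01; have ss : 0 < 1 - s by lra.
apply: (@singular_solution_exists _ r (1 - s) (`|c| + M) _ _ _
  (fun t => - H (1 - t) - c * t) _ r0 ss _ crightPhi _ drightPhi _ right_phi0).
- move=> x; apply: cvgB; first by apply: cvgN; exact: (comp_reflect cH).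
  by apply: cvgM; [exact: cvg_cst|exact: cvg_id].
- move=> t ts tS; have t01 : 0 < 1 - t < 1 by lra.
  have := deriv_sub (deriv_opp (deriv_comp (g := fun t => 1 - t) (dH t01 (reflect_notin tS))
    (deriv_sub (deriv_const 1 t) (deriv_var t)))) (deriv_scale c (deriv_var t)).
  by congr (is_derive _ _ _ _); ring.
- move=> t ts; rewrite distrC; apply: (le_trans (ler_normB _ _)); rewrite lerD2l; apply: hM; lra.
- move=> x xs; have [||d d0 [mu mu0 Hd]] := @f_low (1 - x); [lra|by apply/eqP; lra|].
  exists (Num.min d (Num.min x (1 - s - x))); first by rewrite !lt_min d0; lra.
  exists mu => // y; rewrite !lt_min !ltr_norml => /and3P[yd yx ys].
  have /Hd : `|1 - y - (1 - x)| < d by rewrite ltr_norml; lra.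
  by rewrite gtr0_norm// f_pos//; lra.
Qed.

Lemma left_wave_lip c1 c2 w1 w2 : c1 <= c2 -> left_wave c1 w1 -> left_wave c2 w2 ->
  w1 s <= w2 s <= w1 s + (c2 - c1) * s.
Proof.
have s1 := s01; move=> c12 h1 h2; apply/andP; split.
  by apply: (singular_solution_le r0 left_phi0 h1 h2) => [t ts|]; lra.
by apply: (singular_solution_lip (e := c2 - c1) r0 left_phi0 _ h1 h2) => [|t ts|]; lra.
Qed.

Lemma right_wave_lip c1 c2 w1 w2 : c1 <= c2 -> right_wave c1 w1 -> right_wave c2 w2 ->
  w2 (1 - s) <= w1 (1 - s) <= w2 (1 - s) + (c2 - c1) * (1 - s).
Proof.
have s1 := s01; move=> c12 h1 h2; apply/andP; split.
  by apply: (singular_solution_le r0 right_phi0 h2 h1) => [t ts|]; lra.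
by apply: (singular_solution_lip (e := c2 - c1) r0 right_phi0 _ h2 h1) => [|t ts|]; lra.
Qed.

Lemma left_wave_lt c1 c2 w1 w2 : c1 < c2 -> left_wave c1 w1 -> left_wave c2 w2 ->
  0 < w1 s -> w1 s < w2 s.
Proof.
have s1 := s01; move=> c12 h1 h2; have c0 : 0 < c2 - c1 by lra.
have ss : 0 < s by lra.
by apply: (singular_solution_lt r0 ss left_phi0 c0 cleftPhi dleftPhi h1 h2) => t ts; lra.
Qed.

Lemma right_wave_lt c1 c2 w1 w2 : c1 < c2 -> right_wave c1 w1 -> right_wave c2 w2 ->
  0 < w2 (1 - s) -> w2 (1 - s) < w1 (1 - s).
Proof.
have s1 := s01; move=> c12 h1 h2; have c0 : 0 < c2 - c1 by lra.
have ss : 0 < 1 - s by lra.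
by apply: (singular_solution_lt r0 ss right_phi0 c0 crightPhi drightPhi h2 h1) => t ts; lra.
Qed.

Let wave_growth T S' k phi w kap : 0 < T -> (forall t, 0 < t < T -> 0 < phi t) ->
  singular_solution r T S' k phi w -> (forall t, 0 < t < T -> kap <= k t) -> kap * T <= w T.
Proof.
move=> T0 phi0 [cw w0 wp dw] kk.
suff : (fun x => kap * x - w x) T <= (fun x => kap * x - w x) 0.
  by rewrite /= w0; lra.
apply: (@le0_derive_le _ (fun x => kap * x - w x) _ _ S'); first exact: ltW.
  by move=> y; apply: cvgB; [apply: cvgM; [exact: cvg_cst|exact: cvg_id]|exact: cw].
move=> y y01 yS.
exists (kap * 1 - (k y + phi y / w y `^ r)); first exact: deriv_sub (deriv_scale _ (deriv_var _)) (dw _ y01 yS).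
have : 0 <= phi y / w y `^ r by rewrite divr_ge0 ?powR_ge0// ltW// phi0.
by have := kk _ y01; lra.
Qed.

(** The end values of the two half-waves, as functions of the speed, are
    Lipschitz and monotone in opposite directions, so they cross. *)
Lemma matching_speed_exists : exists c wl wr,
  [/\ left_wave c wl, right_wave c wr & wl s = wr (1 - s)].
Proof.
have s1 := s01.
have [wl Hl] := choice left_wave_exists; have [wr Hr] := choice right_wave_exists.
pose g c := wl c s - wr c (1 - s).
have g_lip c1 c2 : c1 <= c2 -> 0 <= g c2 - g c1 <= c2 - c1.
  move=> c12; have /andP[a1 a2] := left_wave_lip c12 (Hl c1) (Hl c2).
  have /andP[b1 b2] := right_wave_lip c12 (Hr c1) (Hr c2).
  by rewrite /g; apply/andP; split; lra.
have cg : continuous g.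
  move=> x; apply/continuous_epsP => e e0; exists e => // y; apply: le_lt_trans.
  have [xy|/ltW xy] := leP x y; have /andP[g1 g2] := g_lip _ _ xy.
    by rewrite !ger0_norm; lra.
  by rewrite distrC (distrC y) !ger0_norm; lra.
have wl0 c : 0 <= wl c s by apply: (singular_solution_ge0 _ (Hl c)); lra.
have wr0 c : 0 <= wr c (1 - s) by apply: (singular_solution_ge0 _ (Hr c)); lra.
have hb t : 0 <= t <= 1 -> - M <= h t <= M by move=> /hM; rewrite ler_norml.
pose c2 := M + wr M (1 - s) / s; pose c1 := - M - wl (- M) s / (1 - s).
have c2M : M <= c2 by rewrite lerDl divr_ge0//; lra.
have c1M : c1 <= - M by rewrite gerBl divr_ge0//; lra.
have g2 : 0 <= g c2.
  have : (c2 - M) * s <= wl c2 s.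
    apply: (wave_growth _ left_phi0 (Hl c2)); first lra.
    by move=> t ts; have := hb t; lra.
  have /andP[b1 _] := right_wave_lip c2M (Hr M) (Hr c2).
  by rewrite /c2 addrC addKr divfK /g; lra.
have g1 : g c1 <= 0.
  have : (- M - c1) * (1 - s) <= wr c1 (1 - s).
    apply: (wave_growth _ right_phi0 (Hr c1)); first lra.
    by move=> t ts; have := hb (1 - t); lra.
  have /andP[b1 _] := left_wave_lip c1M (Hl c1) (Hl (- M)).
  by rewrite /c1 opprB addrC subrK divfK /g; lra.
have c12 : c1 <= c2 by have := M0; lra.
have [|c _ gc] := IVT c12 (continuous_subspaceT cg) (v := 0).
  by rewrite ge_min g1/= le_max g2 orbT.
by exists c, (wl c), (wr c); split => //; apply/eqP; rewrite -subr_eq0 -/(g c) gc.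
Qed.

(** A positive common end value moves strictly upwards on the left and strictly
    downwards on the right when the speed increases. *)
Lemma matching_speed_unique c c' wl wr wl' wr' :
  left_wave c wl -> right_wave c wr -> wl s = wr (1 - s) -> 0 < wl s ->
  left_wave c' wl' -> right_wave c' wr' -> wl' s = wr' (1 - s) -> c' = c.
Proof.
move=> hl hr e wp hl' hr' e'; have [cc|cc|//] := ltgtP c' c.
  have /andP[h1 _] := left_wave_lip (ltW cc) hl' hl.
  by have := right_wave_lt cc hr' hr; rewrite -e -e' => /(_ wp); lra.
have h1 := left_wave_lt cc hl hl' wp.
by have /andP[] := right_wave_lip (ltW cc) hr hr'; rewrite -e -e'; lra.
Qed.

Lemma left_wave_upper c w kap mu lam : 0 < lam -> 0 <= mu -> left_wave c w ->
  (forall t, 0 < t < s -> c - h t <= - kap) ->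
  (forall t, 0 < t < s -> - f t <= mu * (s - t) `^ r) ->
  lam + mu / lam `^ r <= kap -> w s <= 0.
Proof.
have s1 := s01; have ss : 0 < s by lra.
by move=> l0 m0 hw; exact: (singular_solution_vanishes r0 ss left_phi0 l0 m0 hw).
Qed.

Lemma right_wave_upper c w kap mu lam : 0 < lam -> 0 <= mu -> right_wave c w ->
  (forall t, s < t < 1 -> h t - c <= - kap) ->
  (forall t, s < t < 1 -> f t <= mu * (t - s) `^ r) ->
  lam + mu / lam `^ r <= kap -> w (1 - s) <= 0.
Proof.
have s1 := s01; have ss : 0 < 1 - s by lra.
move=> l0 m0 hw H1 H2 H3; apply: (singular_solution_vanishes r0 ss right_phi0 l0 m0 hw _ _ H3).
  by move=> t ts; apply: H1; lra.
by move=> t ts; have -> : 1 - s - t = (1 - t) - s by [ring]; apply: H2; lra.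
Qed.

Hypothesis ch : {for s, continuous h}.

(** If both half-waves ended at 0, then c - h(s) could be neither positive nor
    negative; and when c = h(s) either one-sided condition keeps one of them positive. *)
Lemma matching_value_pos c wl wr B del : 0 < B -> 0 < del ->
  (forall t, s - del < t < s -> - (B * - f t) <= (s - t) `^ r * (h s - h t)) \/
  (forall t, s < t < s + del -> (t - s) `^ r * (h s - h t) <= B * f t) ->
  left_wave c wl -> right_wave c wr -> wl s = wr (1 - s) -> 0 < wl s.
Proof.
have s1 := s01; have ss : 0 < s by lra.
have ss' : 0 < 1 - s by lra.
move=> B0 del0 Hlim hl hr e.
have [hc|hc|hc] := ltgtP c (h s).
- have hc0 : 0 < h s - c by lra.
  have /continuous_epsP/(_ _ hc0)[d d0 Hd] := ch.
  rewrite e; apply: (singular_solution_pos_of_drift_ge0 (t0 := 1 - s - d) ss' right_phi0 _ hr); first lra.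
  move=> t ts; have : `|h (1 - t) - h s| < h s - c by apply: Hd; rewrite ltr_norml; lra.
  by rewrite ltr_norml; lra.
- have hc0 : 0 < c - h s by lra.
  have /continuous_epsP/(_ _ hc0)[d d0 Hd] := ch.
  apply: (singular_solution_pos_of_drift_ge0 (t0 := s - d) ss left_phi0 _ hl); first lra.
  move=> t ts; have : `|h t - h s| < c - h s by apply: Hd; rewrite ltr_norml; lra.
  by rewrite ltr_norml; lra.
- case: Hlim => Hlim.
    apply: (singular_solution_pos_of_drift_small (t0 := s - del) r0 ss left_phi0 _ B0 hl).
    + lra.
    + by move=> t ts; rewrite hc; exact: Hlim.
    + move=> eps eps0; have /continuous_epsP/(_ _ eps0)[d d0 Hd] := ch.
      exists (s - d); first lra.
      move=> t ts; have : `|h t - h s| < eps by apply: Hd; rewrite ltr_norml; lra.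
      by rewrite ltr_norml; lra.
  rewrite e; apply: (singular_solution_pos_of_drift_small (t0 := 1 - s - del) r0 ss' right_phi0 _ B0 hr).
  + lra.
  + move=> t ts; rewrite hc -lerN2 opprK -mulrN opprB.
    by have -> : 1 - s - t = (1 - t) - s by [ring]; apply: Hlim; lra.
  + move=> eps eps0; have /continuous_epsP/(_ _ eps0)[d d0 Hd] := ch.
    exists (1 - s - d); first lra.
    move=> t ts; have : `|h (1 - t) - h s| < eps by apply: Hd; rewrite ltr_norml; lra.
    by rewrite ltr_norml; lra.
Qed.

Hypothesis cf : {for s, continuous f}.

(** At s itself the equation holds because its right-hand side, read off on either
    side, is continuous there. *)
Lemma glue_waves c wl wr : left_wave c wl -> right_wave c wr ->
  wl s = wr (1 - s) -> 0 < wl s ->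
  exists W : R -> R, [/\ continuous W, W 0 = 0 /\ W 1 = 0,
    (forall t, 0 < t < 1 -> 0 < W t),
    (forall t, 0 < t < 1 -> t \notin S -> is_derive t 1 W (c - h t - f t / W t `^ r)) &
    (forall t, t <= s -> W t = wl t) /\ (forall t, s <= t -> W t = wr (1 - t))].
Proof.
have s1 := s01; have ss : 0 < s by lra.
have ss' : 0 < 1 - s by lra.
move=> hl hr e wp; have [cwl wl0 wlp dwl] := hl; have [cwr wr0 wrp dwr] := hr.
pose W t := if t <= s then wl t else wr (1 - t).
have Wl t : t <= s -> W t = wl t by rewrite /W => ->.
have Wr t : s <= t -> W t = wr (1 - t).
  rewrite le_eqVlt => /predU1P[<-|st]; first by rewrite Wl.
  by rewrite /W leNgt st.
have nl t : t < s -> \forall x \near t, wl x = W x.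
  by move=> ts; near=> x; rewrite Wl// ltW//; near: x; exact: lt_nbhsl.
have nr t : s < t -> \forall x \near t, wr (1 - x) = W x.
  by move=> ts; near=> x; rewrite Wr// ltW//; near: x; exact: lt_nbhsr.
have cW : continuous W.
  move=> t; suff : W x @[x --> t] --> W t by [].
  have [ts|ts|ts] := ltgtP t s.
  - by rewrite (Wl _ (ltW ts)); apply: cvg_trans (cwl t); apply: near_eq_cvg; exact: nl.
  - have cr : wr (1 - x) @[x --> t] --> wr (1 - t) := comp_reflect cwr (x := t).
    by rewrite (Wr _ (ltW ts)); apply: cvg_trans cr; apply: near_eq_cvg; exact: nr.
  - apply/continuous_epsP => eps eps0.
    have /continuous_epsP/(_ _ eps0)[d1 d10 H1] := cwl s.
    have /continuous_epsP/(_ _ eps0)[d2 d20 H2] := comp_reflect cwr (x := s).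
    rewrite ts; exists (Num.min d1 d2); first by rewrite lt_min d10.
    move=> y; rewrite lt_min => /andP[y1 y2].
    have [ys|/ltW ys] := leP y s; first by rewrite !Wl//; exact: H1.
    by rewrite !Wr//; exact: H2.
have Wp t : 0 < t < 1 -> 0 < W t.
  move=> t01; have [ts|ts|->] := ltgtP t s.
  - by rewrite Wl ?ltW// wlp//; lra.
  - by rewrite Wr ?ltW// wrp//; lra.
  - by rewrite Wl.
have dW t : 0 < t < 1 -> t \notin S -> t != s -> is_derive t 1 W (c - h t - f t / W t `^ r).
  move=> t01 tS; rewrite neq_lt => /orP[ts|ts].
    apply: near_eq_is_derive (nl _ ts) _; rewrite (Wl _ (ltW ts)) -mulNr.
    by apply: dwl => //; lra.
  have tr : 0 < 1 - t < 1 - s by lra.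
  have tS' : 1 - t \notin [seq 1 - t | t <- S].
    by apply: contra tS => /mapP[x xS /(congr1 (fun y => 1 - y))]; rewrite !subKr => ->.
  apply: near_eq_is_derive (nr _ ts) _; rewrite (Wr _ (ltW ts)).
  have := deriv_comp (g := fun t => 1 - t) (dwr _ tr tS') (deriv_sub (deriv_const 1 t) (deriv_var t)).
  by rewrite subKr; congr (is_derive _ _ _ _); ring.
exists W; split => //; first by rewrite Wl ?Wr ?subrr ?wl0 ?wr0//; lra.
move=> t t01 tS; have [->|ts] := eqVneq t s; last exact: dW.
have [d d0 Hd] := notin_seq_near S s.
apply: (@is_derive_of_limit _ W (fun t => c - h t - f t / W t `^ r)) => //.
  exists (Num.min d (Num.min s (1 - s))); first by rewrite !lt_min d0; lra.
  move=> x; rewrite !lt_min => /and3P[xd x1 x2] xs.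
  by apply: dW => //; [move: x1 x2; rewrite !ltr_norml; lra|exact: Hd].
have Ws : 0 < W s by rewrite Wl.
apply: cvgB; first by apply: cvgB; [exact: cvg_cst|exact: ch].
apply: cvgM; first exact: cf.
apply: (@continuous_comp _ _ _ W (fun y => (y `^ r)^-1)); first exact: cW.
exact: ipow_continuous.
Unshelve. all: by end_near.
Qed.

End Shooting.

(** * The coefficients *)

Section Coefficient.
Context {R : realType}.
Implicit Types (f g d h : R -> R) (m : nat -> R) (del mu e B : R) (n : nat).

Definition jump_points n m : seq R := [seq m i | i <- iota 1 n].

Lemma jump_pointsP n m (t : R) :
  reflect (exists2 i, (0 < i <= n)%N & t = m i) (t \in jump_points n m).
Proof.
apply: (iffP mapP) => -[i]; first by rewrite mem_iota add1n ltnS; exists i.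
by move=> ni ->; exists i => //; rewrite mem_iota add1n ltnS.
Qed.

Lemma subdivision_lt n m i j : subdivision n m -> (i < j <= n.+1)%N -> m i < m j.
Proof.
move=> [_ _ mS] /andP[]; elim: j => // j IH; rewrite ltnS leq_eqVlt ltnS => /predU1P[->|ij] jn.
  exact: mS.
by apply: lt_trans (mS _ jn); apply: IH => //; exact: leqW.
Qed.

Lemma subdivision_in n m i : subdivision n m -> (0 < i <= n)%N -> 0 < m i < 1.
Proof.
move=> sm /andP[i0 iN]; have [m0 m1 _] := sm; rewrite -m0 -m1.
apply/andP; split; apply: (subdivision_lt sm); first by rewrite i0 leqW.
by rewrite ltnS iN leqnn.
Qed.

Lemma subdivision_locate n m (t : R) : subdivision n m -> 0 < t < 1 ->
  t \notin jump_points n m -> exists2 i, (i <= n)%N & m i < t < m i.+1.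
Proof.
move=> sm t01 tS; have [m0 m1 _] := sm.
have H j : (j <= n.+1)%N -> t < m j -> exists2 i, (i <= n)%N & m i < t < m i.+1.
  elim: j => [_|j IH jn tj]; first by rewrite m0; lra.
  have [tj'|jt|jt] := ltgtP t (m j); first by apply: IH tj'; exact: ltnW.
    by exists j; rewrite ?jt.
  case: j {IH} jn tj jt => [|j] jn tj jt; first by move: t01; rewrite jt m0 ltxx.
  by move: tS => /jump_pointsP[]; exists j.+1.
by apply: (H n.+1) => //; rewrite m1; lra.
Qed.

Lemma jumps_at_continuous n m f (t : R) : jumps_at n m f -> 0 < t < 1 ->
  t \notin jump_points n m -> {for t, continuous f}.
Proof.
move=> [sm _ cf] t01 /(subdivision_locate sm t01)[i ni mt].
by apply: (cf i ni); rewrite in_itv.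
Qed.

(** All that the passage between profiles and the phase plane uses of the
    diffusivity; the one-sided limits replace lower semicontinuity. *)
Definition piecewise_positive (J : seq R) d : Prop :=
  [/\ forall t, 0 < t < 1 -> 0 < d t,
      forall t, 0 < t < 1 -> t \notin J -> {for t, continuous d},
      forall t, t \in J -> 0 < t < 1 &
      forall t, t \in J -> exists l1 l2 : R, [/\ 0 < l1, 0 < l2,
        d x @[x --> t^'-] --> l1 & d x @[x --> t^'+] --> l2]].

Lemma lsc_interior d (t a : R) :
  lower_semicontinuous ((fun t => (d t)%:E) : subspace `[0, 1] -> \bar R) ->
  0 < t < 1 -> a < d t -> exists2 del, 0 < del & forall y, `|y - t| < del -> a < d y.
Proof.
move=> lsc t01 at_; have [|V nV HV] := lsc t a; first by rewrite lte_fin.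
have : nbhs t V.
  move: nV; rewrite -nbhs_subspace_interior// interior_itv_bnd/=.
  by rewrite in_itv.
move=> /nbhs_ballP[del /= del0 Hd]; exists del => // y yt.
by rewrite -lte_fin; apply: HV; apply: Hd; rewrite /ball/= distrC.
Qed.

(** Lower semicontinuity and positivity at a jump point bound d from below near it,
    so the one-sided limits are positive. *)
Lemma standing_d_piecewise p g n m d : standing_d p g n m d ->
  piecewise_positive (jump_points n m) d.
Proof.
move=> [[d_ge0 lsc d_gt0] jd _ _]; have [sm jumps _] := jd; split=> //.
- by move=> t t01; exact: jumps_at_continuous jd t01.
- by move=> t /jump_pointsP[i ni ->]; exact: subdivision_in ni.
move=> t /jump_pointsP[i ni ->]; have m01 := subdivision_in sm ni.
have [l1 [l2 [d1 d2 _]]] := jumps i ni; exists l1, l2.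
have dm := d_gt0 _ m01.
have [|del del0 Hd] := @lsc_interior d (m i) (d (m i) / 2) lsc m01; first lra.
have d20 : 0 < d (m i) / 4 by lra.
split=> //.
  have /cvg_left_epsP/(_ _ d20)[e e0 He] := d1.
  pose y := m i - Num.min del e / 2.
  have me : 0 < Num.min del e by rewrite lt_min del0.
  have mdel : Num.min del e <= del by rewrite ge_min lexx.
  have me' : Num.min del e <= e by rewrite ge_min lexx orbT.
  have := Hd y; have := He y; rewrite /y !ltr_norml; lra.
have /cvg_right_epsP/(_ _ d20)[e e0 He] := d2.
pose y := m i + Num.min del e / 2.
have me : 0 < Num.min del e by rewrite lt_min del0.
have mdel : Num.min del e <= del by rewrite ge_min lexx.
have me' : Num.min del e <= e by rewrite ge_min lexx orbT.
have := Hd y; have := He y; rewrite /y !ltr_norml; lra.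
Qed.

(** The two one-sided limits and the value lie in a compact part of ]0, +oo[. *)
Lemma piecewise_positive_local J d (t : R) : piecewise_positive J d -> 0 < t < 1 ->
  exists2 del, 0 < del & exists mu B, [/\ 0 < mu, 0 < B &
    forall y, `|y - t| < del -> mu <= d y <= B].
Proof.
move=> [d0 cd _ jd] t01; have dt := d0 _ t01.
have [tJ|tJ] := boolP (t \in J); last first.
  have d20 : 0 < d t / 2 by lra.
  have /continuous_epsP/(_ _ d20)[del del0 Hd] := cd _ t01 tJ.
  exists del => //; exists (d t / 2), (2 * d t); split; [lra|lra|].
  by move=> y /Hd; rewrite ltr_norml; lra.
have [l1 [l2 [l10 l20 d1 d2]]] := jd _ tJ.
have l120 : 0 < l1 / 2 by lra.
have l220 : 0 < l2 / 2 by lra.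
have /cvg_left_epsP/(_ _ l120)[e1 e10 H1] := d1.
have /cvg_right_epsP/(_ _ l220)[e2 e20 H2] := d2.
exists (Num.min e1 e2); first by rewrite lt_min e10.
exists (Num.min (d t) (Num.min (l1 / 2) (l2 / 2))), (d t + 2 * l1 + 2 * l2); split.
- by rewrite !lt_min dt; lra.
- lra.
move=> y; rewrite lt_min !ltr_norml !ge_min => /andP[y1 y2].
have [yt|ty|->] := ltgtP y t.
- have : `|d y - l1| < l1 / 2 by apply: H1; lra.
  rewrite ltr_norml => h1; apply/andP; split; last lra.
  by apply/orP; right; apply/orP; left; lra.
- have : `|d y - l2| < l2 / 2 by apply: H2; lra.
  rewrite ltr_norml => h1; apply/andP; split; last lra.
  by apply/orP; right; apply/orP; right; lra.
- by rewrite lexx/=; lra.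
Qed.

Lemma powR_continuous (r x : R) : 0 < x -> {for x, continuous (fun y : R => y `^ r)}.
Proof. by move=> x0; exact: (is_derive_continuous (is_derive1_powR r x0)). Qed.

Lemma standing_g_continuous s g (t : R) : standing_g s g -> 0 < t < 1 -> {for t, continuous g}.
Proof.
move=> [cg _ _ _] t01; have [+ _ _] := (continuous_within_itvP g ltr01).1 cg.
by apply; rewrite in_itv.
Qed.

Section Product.
Variables (r s : R) (J : seq R) (d g : R -> R).
Hypotheses (r0 : 0 < r) (s01 : 0 < s < 1) (hg : standing_g s g).
Hypothesis hd : piecewise_positive J d.

Definition weighted_reaction t := d t `^ r * g t.
Notation f := weighted_reaction.

Lemma weighted_reaction_neg t : 0 < t < s -> f t < 0.
Proof.
have s1 := s01; move=> ts; have [d0 _ _ _] := hd; have [_ _ gn _] := hg.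
by rewrite pmulr_rlt0 ?gn ?powR_gt0 ?d0//; lra.
Qed.

Lemma weighted_reaction_pos t : s < t < 1 -> 0 < f t.
Proof.
have s1 := s01; move=> ts; have [d0 _ _ _] := hd; have [_ _ _ gp] := hg.
by rewrite mulr_gt0 ?gp ?powR_gt0 ?d0//; lra.
Qed.

Lemma weighted_reaction_continuous t : 0 < t < 1 -> t \notin J -> {for t, continuous f}.
Proof.
move=> t01 tJ; have [d0 cd _ _] := hd.
apply: cvgM; last exact: (standing_g_continuous hg t01).
apply: (@continuous_comp _ _ _ d (fun y => y `^ r)); first exact: cd.
by apply: powR_continuous; exact: d0.
Qed.

(** At s the factor g vanishes and d is bounded, so a jump of d there is harmless. *)
Lemma weighted_reaction_continuous_zero : {for s, continuous f}.
Proof.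
have [_ [_ gs _] _ _] := hg.
have [del del0 [mu [B [mu0 B0 Hd]]]] := piecewise_positive_local hd s01.
apply/continuous_epsP => e e0.
have eB : 0 < e / B `^ r by rewrite divr_gt0// powR_gt0.
have /continuous_epsP/(_ _ eB)[d1 d10 H1] := standing_g_continuous hg s01.
exists (Num.min del d1); first by rewrite lt_min del0.
move=> y; rewrite lt_min => /andP[/Hd/andP[dy1 dy2] /H1].
rewrite /f gs mulr0 !subr0 normrM ltr_pdivlMr ?powR_gt0// => h.
apply: le_lt_trans h; rewrite mulrC ler_wpM2l// ger0_norm ?powR_ge0//.
by rewrite powR_le// (le_trans (ltW mu0)).
Qed.

Lemma weighted_reaction_low t : 0 < t < 1 -> t != s -> exists2 del, 0 < del &
  exists2 mu, 0 < mu & forall y, `|y - t| < del -> mu <= `|f y|.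
Proof.
move=> t01 ts; have s1 := s01.
have [del del0 [mu [B [mu0 B0 Hd]]]] := piecewise_positive_local hd t01.
have g0 : 0 < `|g t|.
  rewrite normr_gt0; have [_ _ gn gp] := hg.
  move: ts; rewrite neq_lt => /orP[ts|ts].
    by rewrite lt_eqF// gn//; lra.
  by rewrite gt_eqF// gp//; lra.
have g20 : 0 < `|g t| / 2 by lra.
have /continuous_epsP/(_ _ g20)[d1 d10 H1] := standing_g_continuous hg t01.
exists (Num.min del d1); first by rewrite lt_min del0.
exists (mu `^ r * (`|g t| / 2)); first by rewrite mulr_gt0// powR_gt0.
move=> y; rewrite lt_min => /andP[/Hd/andP[dy1 dy2] /H1 gy].
have gy2 : `|g t| / 2 <= `|g y| by have := lerB_dist (g t) (g y); rewrite (distrC (g t)); lra.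
rewrite normrM (ger0_norm (powR_ge0 _ _)); apply: ler_pM => //; first exact: powR_ge0.
by rewrite powR_le// ltW.
Qed.

End Product.
End Coefficient.

(** * From a phase-plane solution to a function of the wave variable *)

Section OneSided.
Context {R : realType}.
Implicit Types (f : R -> R) (z l : R).

Lemma is_derive_quotient f z l : is_derive z 1 f l ->
  t^-1 *: (f (t + z) - f z) @[t --> 0^'] --> l.
Proof.
move=> [df <-]; have H : h^-1 *: ((f \o shift z) (h *: 1) - f z) @[h --> 0^'] --> 'D_1 f z := df.
apply: cvg_trans H; apply: near_eq_cvg; apply: nearW => t.
by rewrite /= /GRing.scale/= mulr1.
Qed.

Lemma is_derive_left f z l : is_derive z 1 f l ->
  left_derivable f z /\ left_derive f z = l.
Proof.
move=> /is_derive_quotient H.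
have Hl : t^-1 *: (f (t + z) - f z) @[t --> 0^'-] --> l.
  apply: cvg_trans H; apply: cvg_app; apply: within_subset => t /=.
  by move/lt_eqF/negbT.
by split; [apply/cvg_ex; exists l|exact/cvg_lim].
Qed.

Lemma is_derive_right f z l : is_derive z 1 f l ->
  right_derivable f z /\ right_derive f z = l.
Proof.
move=> /is_derive_quotient H.
have Hl : t^-1 *: (f (t + z) - f z) @[t --> 0^'+] --> l.
  apply: cvg_trans H; apply: cvg_app; apply: within_subset => t /=.
  by move/gt_eqF/negbT.
by split; [apply/cvg_ex; exists l|exact/cvg_lim].
Qed.

End OneSided.

Section PowerFlux.
Context {R : realType}.
Variables (p : R).
Hypothesis p1 : 1 < p.
Notation r := (p - 1)^-1.

Lemma conjugate_exponent_gt0 : 0 < r.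
Proof. by rewrite invr_gt0 subr_gt0. Qed.

Lemma plapN (x : R) : 0 < x -> plap p (- x) = - x `^ (p - 1).
Proof.
move=> x0; rewrite /plap normrN gtr0_norm// mulrN; congr (- _).
have x00 : (p - 2 + 1 == 0) ==> (x != 0) by rewrite (gt_eqF x0) implybT.
by rewrite -[X in _ * X](powRr1 (ltW x0)) -powRD// -addrA; congr (_ `^ (_ + _)); ring.
Qed.

Lemma plap0 : plap p (0 : R) = 0.
Proof. by rewrite /plap mulr0. Qed.

(** The slope of a profile is recovered from its flux: plap p inverts the power r. *)
Lemma flux_of_slope (a w : R) : 0 < a -> 0 < w -> a * plap p (- (w / a) `^ r) = - w.
Proof.
move=> a0 w0; have wa : 0 < w / a by rewrite divr_gt0.
rewrite plapN ?powR_gt0// -powRrM mulVf ?powRr1 ?(ltW wa)//; last by rewrite gt_eqF// subr_gt0.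
by rewrite mulrN mulrCA divff ?mulr1// gt_eqF.
Qed.

Lemma slope_of_flux (a x w : R) : 0 < a -> x < 0 -> a * plap p x = - w ->
  0 < w /\ x = - (w / a) `^ r.
Proof.
move=> a0 x0; have y0 : 0 < - x by rewrite oppr_gt0.
rewrite -[x]opprK plapN// mulrN => /oppr_inj <-; split.
  by rewrite mulr_gt0// powR_gt0.
rewrite mulrAC divff ?gt_eqF// mul1r -powRrM divff ?powRr1 ?(ltW y0)//.
by rewrite gt_eqF// subr_gt0.
Qed.

End PowerFlux.

Section InverseProfile.
Context {R : realType}.
Implicit Types (t u x y z : R) (del e : R).
Variables (r : R) (J : seq R) (d W : R -> R).
Hypotheses (r0 : 0 < r) (hd : piecewise_positive J d).
Hypotheses (cW : continuous W) (W0 : forall u, 0 < u < 1 -> 0 < W u).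

Notation speed u := ((W u / d u) `^ r).
Let rho u : R := (speed u)^-1.

Let d0 u : 0 < u < 1 -> 0 < d u. Proof. by have [H _ _ _] := hd; exact: H. Qed.

Let speed_gt0 u : 0 < u < 1 -> 0 < speed u.
Proof. by move=> u01; rewrite powR_gt0// divr_gt0 ?W0 ?d0. Qed.

Lemma quotient_powR_continuous (w a : R -> R) u : {for u, continuous w} ->
  {for u, continuous a} -> 0 < w u -> 0 < a u ->
  {for u, continuous (fun x => (w x / a x) `^ r)}.
Proof.
move=> cw ca w0 a0.
apply: (@continuous_comp _ _ _ (fun x => w x / a x) (fun y => y `^ r)); last first.
  by apply: powR_continuous; rewrite divr_gt0.
by apply: cvgM; [exact: cw|apply: cvgV; [rewrite gt_eqF|exact: ca]].
Qed.

Let rho_continuous u : 0 < u < 1 -> u \notin J -> {for u, continuous rho}.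
Proof.
move=> u01 uJ; have [_ cd _ _] := hd.
apply: cvgV; first by rewrite gt_eqF// speed_gt0.
by apply: quotient_powR_continuous; [exact: cW|exact: cd|exact: W0|exact: d0].
Qed.

Let rho_integrable a b : 0 < a -> a <= b -> b < 1 ->
  (@lebesgue_measure R).-integrable `[a, b] (EFin \o rho).
Proof.
move=> a0 ab b1.
have [mu mu0 Hmu] : exists2 mu, 0 < mu & forall y, a <= y <= b -> mu <= speed y.
  apply: locally_bounded_below => // x xab; have x01 : 0 < x < 1 by lra.
  have [e e0 [nu [B [nu0 B0 Hd]]]] := piecewise_positive_local hd x01.
  have W20 : 0 < W x / 2 by rewrite divr_gt0 ?W0.
  have /continuous_epsP/(_ _ W20)[e1 e10 H1] := @cW x.
  exists (Num.min e e1); first by rewrite lt_min e0.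
  exists ((W x / 2 / B) `^ r); first by rewrite powR_gt0// divr_gt0.
  move=> y; rewrite lt_min => /andP[/Hd/andP[h1 h2] /H1]; rewrite ltr_norml => h3.
  have dy : 0 < d y by exact: lt_le_trans h1.
  rewrite powR_le//; first by rewrite divr_ge0// ltW.
  rewrite ler_pM ?invr_ge0 ?(ltW W20) ?(ltW B0)//; first lra.
  by rewrite lef_pV2 ?posrE.
apply: (@integrable_piecewise _ _ _ _ J mu^-1) => t tab.
  by apply: rho_continuous; lra.
have t01 : 0 < t < 1 by lra.
rewrite /rho ger0_norm ?invr_ge0 ?powR_ge0// lef_pV2 ?posrE ?speed_gt0//.
by apply: Hmu; lra.
Qed.

(** The profile takes the value u at the point - arrival u: along it the wave
    variable satisfies dz/du = - rho u. *)
Definition arrival u : R := oriented_integral rho 2^-1 u.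

Lemma arrival_half : arrival 2^-1 = 0.
Proof. by rewrite /arrival /oriented_integral lexx set_itv1 Rintegral_set1. Qed.

Let arrival_local u : 0 < u < 1 -> exists a b, [/\ 0 < a, a < u < b, b < 1 &
  exists C, forall x, a <= x <= b -> arrival x = primitive rho a b x - C].
Proof.
move=> u01; pose a := Num.min u 2^-1 / 2; pose b := (1 + Num.max u 2^-1) / 2.
have h : [/\ 0 < a, a < u < b, a < 2^-1 < b & b < 1].
  by rewrite /a /b; split; case: (leP u 2^-1) => ?; lra.
have [h1 h2 h3 h4] := h; exists a, b; split=> //; exists (primitive rho a b 2^-1) => x xab.
by rewrite /arrival (oriented_integralE (a := a) (b := b))//; [apply: rho_integrable; lra|lra].
Qed.

Lemma arrival_continuous u : 0 < u < 1 -> {for u, continuous arrival}.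
Proof.
move=> u01; have [a [b [a0 uab b1 [C HC]]]] := arrival_local u01.
have cP : continuous (fun x => primitive rho a b x - C).
  move=> x; apply: cvgB; last exact: cvg_cst.
  by apply: primitive_continuous; [lra|apply: rho_integrable; lra].
have ne : \forall x \near u, primitive rho a b x - C = arrival x.
  have : u \in `]a, b[ by rewrite in_itv.
  by move=> /near_in_itvoo; apply: filterS => x; rewrite in_itv/= => xab; rewrite HC//; lra.
suff : arrival x @[x --> u] --> arrival u by [].
by rewrite HC; [apply: cvg_trans (cP u); apply: near_eq_cvg|lra].
Qed.

Lemma arrival_derive u : 0 < u < 1 -> u \notin J -> is_derive u 1 arrival (rho u).
Proof.
move=> u01 uJ; have [a [b [a0 uab b1 [C HC]]]] := arrival_local u01.
have ne : \forall x \near u, primitive rho a b x - C = arrival x.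
  have : u \in `]a, b[ by rewrite in_itv.
  by move=> /near_in_itvoo; apply: filterS => x; rewrite in_itv/= => xab; rewrite HC//; lra.
apply: near_eq_is_derive ne _; rewrite -[rho u]subr0.
have ab : a <= b by lra.
exact: deriv_sub (primitive_derive (rho_integrable a0 ab b1) uab (rho_continuous u01 uJ))
  (deriv_const C u).
Qed.

Let cclamp a b : 0 < a -> a <= b -> b < 1 -> continuous (arrival \o clamp a b).
Proof.
move=> a0 ab b1; apply: clamp_continuous => //.
apply: continuous_in_subspaceT => x; rewrite inE/= in_itv/= => xab.
by apply: arrival_continuous; lra.
Qed.

Lemma arrival_lt x y : 0 < x -> x < y -> y < 1 -> arrival x < arrival y.
Proof.
move=> x0 xy y1.
(* a subinterval without exceptional points, on which the mean value theorem applies *)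
have HS : forall (S : seq R) a b, x <= a -> a < b -> b <= y -> exists u v,
    [/\ a <= u, u < v, v <= b & forall t, u < t < v -> t \notin S].
  elim=> [|s S IH] a b xa ab by'; first by exists a, b.
  have [u [v [au uv vb Huv]]] := IH a b xa ab by'.
  have [sv|vs] := ltP s v; last first.
    exists u, v; split=> // t tuv; rewrite inE negb_or Huv// andbT.
    by apply: contraTneq tuv => ->; rewrite andbC ltNge vs.
  exists (Num.max u s), v; split; [by rewrite le_max au|by rewrite gt_max uv|by []|].
  move=> t; rewrite gt_max => /andP[/andP[ut st] tv]; rewrite inE negb_or gt_eqF//=.
  by apply: Huv; rewrite ut.
have mono a b : x <= a -> a <= b -> b <= y -> arrival a <= arrival b.
  move=> xa ab by'; pose f := fun t => - (arrival \o clamp x y) t.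
  have : f b <= f a.
    apply: (@le0_derive_le _ f _ _ J) => // [t|t tab tJ].
      by apply: cvgN; apply: cclamp => //; lra.
    have t01 : 0 < t < 1 by lra.
    exists (- rho t); last by rewrite oppr_le0 invr_ge0 powR_ge0.
    apply: deriv_opp; apply: near_eq_is_derive (arrival_derive t01 tJ).
    have : t \in `]a, b[ by rewrite in_itv.
    move=> /near_in_itvoo; apply: filterS => z; rewrite in_itv/= => zab.
    by rewrite clamp_id//; lra.
  by rewrite /f /= !clamp_id; lra.
have [u [v [xu uv vy Huv]]] := HS J x y (lexx _) xy (lexx _).
have [|c cuv E] := MVT uv _ (continuous_subspaceT (cclamp x0 (ltW xy) y1)) (df := rho).
  move=> t; rewrite in_itv/= => tuv; have t01 : 0 < t < 1 by lra.
  apply: near_eq_is_derive (arrival_derive t01 (Huv _ tuv)).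
  have : t \in `]u, v[ by rewrite in_itv.
  move=> /near_in_itvoo; apply: filterS => z; rewrite in_itv/= => zab.
  by rewrite clamp_id//; lra.
move: cuv; rewrite in_itv/= => cuv; have c01 : 0 < c < 1 by lra.
have : 0 < rho c * (v - u) by rewrite mulr_gt0 ?invr_gt0 ?speed_gt0//; lra.
rewrite -E /= !clamp_id; [|lra|lra].
have := mono x u; have := mono v y.
by lra.
Qed.

Lemma arrival_inj x y : 0 < x < 1 -> 0 < y < 1 -> arrival x = arrival y -> x = y.
Proof.
move=> /andP[x0 x1] /andP[y0 y1] E; have [xy|yx|//] := ltgtP x y.
  by have := arrival_lt x0 xy y1; rewrite E ltxx.
by have := arrival_lt y0 yx x1; rewrite E ltxx.
Qed.

Lemma arrival_between x y z : 0 < x -> x <= y -> y < 1 -> arrival x <= z <= arrival y ->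
  exists2 u, x <= u <= y & arrival u = z.
Proof.
move=> x0 xy y1 zxy.
have [|c] := IVT xy (continuous_subspaceT (cclamp x0 xy y1)) (v := z).
  rewrite /= !clamp_id ?lexx ?xy//.
  by have [/andP[h1 h2]] := zxy; rewrite ge_min h1/= le_max h2 orbT.
by rewrite in_itv/= => cxy; rewrite clamp_id// => <-; exists c.
Qed.

(** Where - arrival does not take the value z, the profile has already reached 0 (on
    the right) or has not yet left 1 (on the left). *)
Definition profile_of z : R :=
  xget (if z < 0 then 1 else 0) [set u | 0 < u < 1 /\ arrival u = - z].
Notation U := profile_of.

Lemma profile_ofK u : 0 < u < 1 -> U (- arrival u) = u.
Proof.
move=> u01; rewrite /U; case: xgetP => [v _ [v01]|/(_ u)[]]; last by rewrite opprK.
by rewrite opprK; exact: arrival_inj.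
Qed.

Lemma profile_ofP z : 0 < U z < 1 -> arrival (U z) = - z.
Proof.
rewrite {1 2}/U; case: xgetP => [v E [v01 Hv] _|_]; first by rewrite /U -E.
by case: ifP; rewrite ltxx ?andbF.
Qed.

Lemma profile_of_eq z u : 0 < u < 1 -> arrival u = - z -> U z = u.
Proof. by move=> u01 E; rewrite -[z]opprK -E profile_ofK. Qed.

Lemma profile_of_half : U 0 = 2^-1.
Proof. by apply: profile_of_eq; [lra|rewrite arrival_half oppr0]. Qed.

Let profile_of_case z : 0 < U z < 1 \/
  (forall u, 0 < u < 1 -> arrival u <> - z) /\ U z = if z < 0 then 1 else 0.
Proof.
have [[u [u01 Hu]]|H] := pselect (exists u, 0 < u < 1 /\ arrival u = - z).
  by left; rewrite (profile_of_eq u01 Hu).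
right; split; first by move=> u u01 E; apply: H; exists u.
by rewrite /U; case: xgetP => // v _ [v01 Hv]; case: H; exists v.
Qed.

Lemma profile_of_range z : 0 <= U z <= 1.
Proof.
have [H|[_ ->]] := profile_of_case z; first lra.
by case: ifP; rewrite lexx ler01.
Qed.

Lemma profile_of_anti x y : x <= y -> U y <= U x.
Proof.
rewrite le_eqVlt => /predU1P[->//|xy].
have [/andP[a0 a1] /andP[b0 b1]] := (profile_of_range x, profile_of_range y).
have [Hx|[Nx Ex]] := profile_of_case x; have [Hy|[Ny Ey]] := profile_of_case y.
- have := profile_ofP Hx; have := profile_ofP Hy => E1 E2.
  rewrite leNgt; apply/negP => H; have := arrival_lt _ H; lra.
- rewrite Ey; case: ltP => y0; last lra.
  exfalso; have E := profile_ofP Hx.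
  have hx : 2^-1 <= U x.
    rewrite leNgt; apply/negP => H; have := arrival_lt _ H; rewrite arrival_half; lra.
  have [| | | |u u1 u2] := @arrival_between 2^-1 (U x) (- y); [lra|lra|lra| |].
    by rewrite arrival_half; lra.
  by apply: (Ny u) => //; lra.
- rewrite Ex; case: ltP => x0; first lra.
  exfalso; have E := profile_ofP Hy.
  have hy : U y <= 2^-1.
    rewrite leNgt; apply/negP => H; have := arrival_lt _ H; rewrite arrival_half; lra.
  have [| | | |u u1 u2] := @arrival_between (U y) 2^-1 (- x); [lra|lra|lra| |].
    by rewrite arrival_half; lra.
  by apply: (Nx u) => //; lra.
- by rewrite Ex Ey; case: ltP => hy; case: ltP => hx; lra.
Qed.

Lemma profile_of_lt x y : x < y -> 0 < U x < 1 -> U y < U x.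
Proof.
move=> xy Ux; rewrite lt_neqAle profile_of_anti ?ltW// andbT; apply/eqP => E.
have Uy : 0 < U y < 1 by rewrite E.
by have := profile_ofP Ux; rewrite -E (profile_ofP Uy); lra.
Qed.

Lemma profile_of_lt_r x y : x < y -> 0 < U y < 1 -> U y < U x.
Proof.
move=> xy Uy; rewrite lt_neqAle profile_of_anti ?ltW// andbT; apply/eqP => E.
have Ux : 0 < U x < 1 by rewrite -E.
by have := profile_ofP Ux; rewrite -E (profile_ofP Uy); lra.
Qed.

Let reversed_continuous : continuous (fun z => U (- z)).
Proof.
apply: (@monotone_onto_continuous _ _ 0 1) => [x y xy|x|u u01].
- by apply: profile_of_anti; rewrite lerN2.
- exact: profile_of_range.
- by exists (arrival u); exact: profile_ofK.
Qed.

Lemma profile_of_continuous : continuous U.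
Proof.
move=> z; have -> : U = (fun x => (fun y => U (- y)) (- x)).
  by apply/funext => x; rewrite opprK.
apply: (@continuous_comp _ _ _ (fun x => - x) (fun y => U (- y))).
  by apply: cvgN; exact: cvg_id.
exact: reversed_continuous.
Qed.

Lemma profile_of_derive z : 0 < U z < 1 -> U z \notin J ->
  is_derive z 1 U (- speed (U z)).
Proof.
move=> U01 UJ; have E := profile_ofP U01.
have U01' : U z \in `]0, 1[ by rewrite in_itv.
have d1 : is_derive (arrival (U z)) 1 (fun y => U (- y)) (rho (U z))^-1.
  apply: is_derive_inverse (arrival_derive U01 UJ) _.
  - by move: (near_in_itvoo U01'); apply: filterS => x; rewrite in_itv/=; exact: profile_ofK.
  - by move: (near_in_itvoo U01'); apply: filterS => x; rewrite in_itv/=; exact: arrival_continuous.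
  - by rewrite gt_eqF// invr_gt0 speed_gt0.
rewrite invrK E in d1.
have := deriv_comp (g := fun x => - x) d1 (deriv_opp (deriv_var z)).
by rewrite mulrN mulr1; congr (is_derive _ _ _ _); apply/funext => x; rewrite opprK.
Qed.

Lemma profile_of_ninfty : U z @[z --> -oo] --> (1 : R).
Proof.
apply/cvgrPdist_lt => e e0.
pose u := 1 - Num.min e 1 / 2.
have u01 : 0 < u < 1 /\ 1 - e < u by rewrite /u; case: (leP e 1) => ?; lra.
exists (- arrival u); split; first exact: num_real.
move=> z zu; have := profile_of_anti (ltW zu); rewrite profile_ofK; last lra.
by have := profile_of_range z => h1 h2; rewrite ger0_norm; lra.
Qed.

Lemma profile_of_pinfty : U z @[z --> +oo] --> (0 : R).
Proof.
apply/cvgrPdist_lt => e e0.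
pose u := Num.min e 1 / 2.
have u01 : 0 < u < 1 /\ u < e by rewrite /u; case: (leP e 1) => ?; lra.
exists (- arrival u); split; first exact: num_real.
move=> z zu; have := profile_of_anti (ltW zu); rewrite profile_ofK; last lra.
by have := profile_of_range z => h1 h2; rewrite sub0r normrN ger0_norm; lra.
Qed.

End InverseProfile.

(** * Level sets of a continuous profile *)

Section LevelSets.
Context {R : realType}.
Implicit Types (t u x y z : R) (del e : R).
Variables (n q : nat) (m k : nat -> R) (U : R -> R).
Notation J := (jump_points n m).
Notation K := (jump_points q k).
Hypotheses (cU : continuous U) (U01 : forall z, 0 <= U z <= 1).

Lemma near_level z (A : set R) : nbhs (U z) A -> \forall x \near z, A (U x).
Proof. exact: cU. Qed.

Lemma near_notin_seq (S : seq R) u : u \notin S -> \forall v \near u, v \notin S.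
Proof.
move=> uS; have [del del0 H] := notin_seq_near S u.
apply/nbhs_ballP; exists del => //= v; rewrite /ball/= distrC => vu.
by have [->//|] := eqVneq v u; exact: H.
Qed.

Lemma near_inside z : 0 < U z < 1 -> \forall x \near z, 0 < U x < 1.
Proof.
move=> Uz; apply: (@near_level z [set v | 0 < v < 1]).
have : U z \in `]0, 1[ by rewrite in_itv.
by move=> /near_in_itvoo; apply: filterS => v; rewrite in_itv.
Qed.

Lemma near_level_notin z (S : seq R) : U z \notin S -> \forall x \near z, U x \notin S.
Proof. by move=> /near_notin_seq; exact: (@near_level z [set v | v \notin S]). Qed.

Lemma level_ends z : ~ (0 < U z < 1) -> U z = 0 \/ U z = 1.
Proof.
move=> H; have /andP[a b] := U01 z.
have [<-|a'] := eqVneq 0 (U z); first by left.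
have [->|b'] := eqVneq (U z) 1; first by right.
by case: H; rewrite !lt_neqAle a b a' b'.
Qed.

Lemma M_level z : M_ n m U z <-> U z \in J.
Proof.
split; first by move=> [i ni E]; apply/jump_pointsP; exists i.
by move=> /jump_pointsP[i ni E]; exists i.
Qed.

Lemma K_level z : K_ q k U z <-> U z \in K.
Proof.
split; first by move=> [i ni E]; apply/jump_pointsP; exists i.
by move=> /jump_pointsP[i ni E]; exists i.
Qed.

Lemma boundary_M_level z : boundary (M_ n m U) z -> U z \in J.
Proof.
move=> [clM _]; apply/negPn/negP => /(near_level_notin) nz.
by have [x [/M_level xJ /negP]] := clM _ nz.
Qed.

Lemma boundary_N_level z : boundary (N_ U) z -> U z = 0 \/ U z = 1.
Proof.
move=> [clN _]; apply: level_ends => /near_inside nz.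
by have [x [[->|->]]] := clN _ nz; rewrite ltxx ?andbF.
Qed.

(** Near such a point the profile takes only the values 0 and 1, and being continuous
    it cannot switch between them. *)
Lemma locally_constant_outside z : ~ boundary (N_ U) z -> U z = 0 \/ U z = 1 ->
  \forall x \near z, U x = U z.
Proof.
move=> Nb Uz; have : (N_ U)^° z.
  by apply: contrapT => nI; apply: Nb; split=> //; apply: subset_closure.
move=> nN; have n1 : \forall x \near z, `|U x - U z| < 1.
  have /continuous_epsP/(_ _ ltr01)[e e0 He] := @cU z.
  by apply/nbhs_ballP; exists e => //= x; rewrite /ball/= distrC; exact: He.
near=> x.
have : N_ U x by near: x.
have : `|U x - U z| < 1 by near: x.
rewrite ltr_norml => hx.
by case: Uz hx => ->; move=> hx [] Ux; move: hx; rewrite Ux; lra.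
Unshelve. all: by end_near.
Qed.

Lemma derive_outside z : ~ boundary (N_ U) z -> U z = 0 \/ U z = 1 -> is_derive z 1 U 0.
Proof.
move=> nb Uz; apply: near_eq_is_derive (deriv_const (U z) z).
by move: (locally_constant_outside nb Uz); apply: filterS => x ->.
Qed.

Lemma near_not_boundary_N z : ~ boundary (N_ U) z -> \forall x \near z, ~ boundary (N_ U) x.
Proof.
move=> nb; have [/near_inside|/level_ends Uz] := pselect (0 < U z < 1).
  by apply: filterS => x Ux /boundary_N_level[] E; move: Ux; rewrite E ltxx ?andbF.
have := locally_constant_outside nb Uz => /nbhs_interior; apply: filterS => x xI [_]; apply.
move: xI; apply: filterS => y E; rewrite /N_/= E; exact: Uz.
Qed.

End LevelSets.

(** * The constructed function is a regular profile *)

Section ConstructedProfile.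
Context {R : realType}.
Implicit Types (t u x y z : R) (del e : R).
Variables (p c : R) (g d h : R -> R) (n q : nat) (m k : nat -> R).
Variables (W Hc : R -> R).
Notation r := ((p - 1)^-1).
Notation J := (jump_points n m).
Notation K := (jump_points q k).
Hypotheses (p1 : 1 < p) (hd : piecewise_positive J d).
Hypothesis sm : subdivision n m.
Hypotheses (cg : {within `[0, 1], continuous g}) (g0 : g 0 = 0) (g1 : g 1 = 0).
Hypotheses (cW : continuous W) (W00 : W 0 = 0) (W10 : W 1 = 0).
Hypothesis W0 : forall u, 0 < u < 1 -> 0 < W u.
Hypothesis dW : forall u, 0 < u < 1 -> u \notin J ++ K ->
  is_derive u 1 W (c - h u - weighted_reaction r d g u / W u `^ r).
Hypotheses (cHc : continuous Hc) (HcE : forall u, 0 <= u <= 1 -> H_ h u = Hc u).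
Hypothesis dHc : forall u, 0 < u < 1 -> u \notin K -> is_derive u 1 Hc (h u).

Notation U := (profile_of r d W).
Notation arr := (arrival r d W).
Notation speed u := ((W u / d u) `^ r).

Let d0 u : 0 < u < 1 -> 0 < d u. Proof. by have [H _ _ _] := hd; exact: H. Qed.
Let r0 : 0 < r := conjugate_exponent_gt0 p1.
Let U01 := profile_of_range r0 hd cW W0.
Let UK := profile_ofK r0 hd cW W0.
Let UP := @profile_ofP _ r d W.
Let U_anti := profile_of_anti r0 hd cW W0.
Let U_lt := profile_of_lt r0 hd cW W0.
Let U_lt_r := profile_of_lt_r r0 hd cW W0.
Let cU := profile_of_continuous r0 hd cW W0.
Let J01 u : u \in J -> 0 < u < 1. Proof. by have [_ _ H _] := hd; exact: H. Qed.
Let speed0 u : 0 < u < 1 -> 0 < speed u.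
Proof. by move=> u01; rewrite powR_gt0// divr_gt0 ?W0 ?d0. Qed.

Let near_01 z : 0 < U z < 1 -> \forall x \near z, 0 < U x < 1.
Proof. exact: near_inside. Qed.
Let near_nJ z (S : seq R) : U z \notin S -> \forall x \near z, U x \notin S.
Proof. exact: near_level_notin. Qed.
Let ends z : ~ (0 < U z < 1) -> U z = 0 \/ U z = 1.
Proof. exact: level_ends. Qed.
Let M_E := M_level n m U.
Let K_E := K_level q k U.

Let boundary_M z : boundary (M_ n m U) z <-> U z \in J.
Proof.
split=> [|UJ]; first exact: boundary_M_level.
split; first by apply: subset_closure; exact/M_E.
move=> /nbhs_ballP[e /= e0 He].
have [del del0 H] := notin_seq_near J (U z).
have /continuous_epsP/(_ _ del0)[e1 e10 H1] := @cU z.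
pose x := z + Num.min e e1 / 2.
have [xz ze ze1] : [/\ z < x, x - z < e & x - z < e1].
  by rewrite /x; split; case: (leP e e1) => ?; lra.
have : M_ n m U x by apply: He; rewrite /ball/= ltr_norml; lra.
move=> /M_E; apply/negP; apply: H.
  by apply: H1; rewrite ltr_norml; lra.
by rewrite lt_eqF// U_lt// J01.
Qed.

Let boundary_N z : boundary (N_ U) z -> U z = 0 \/ U z = 1.
Proof. exact: boundary_N_level. Qed.
Let locally_constant z : ~ boundary (N_ U) z -> U z = 0 \/ U z = 1 ->
  \forall x \near z, U x = U z.
Proof. exact: locally_constant_outside. Qed.
Let derive_constant z : ~ boundary (N_ U) z -> U z = 0 \/ U z = 1 -> is_derive z 1 U 0.
Proof. exact: derive_outside. Qed.
Let near_not_bN z : ~ boundary (N_ U) z -> \forall x \near z, ~ boundary (N_ U) x.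
Proof. exact: near_not_boundary_N. Qed.

Let dU z : 0 < U z < 1 -> U z \notin J -> is_derive z 1 U (- speed (U z)).
Proof. by move=> a b; exact: (profile_of_derive r0 hd cW W0 a b). Qed.

Let derive1_off z : 0 < U z < 1 -> U z \notin J -> derive1 U z = - speed (U z).
Proof. by move=> a b; rewrite derive1E (@derive_val _ _ _ _ _ _ _ (dU a b)). Qed.

Let derive1_const z : ~ boundary (N_ U) z -> U z = 0 \/ U z = 1 -> derive1 U z = 0.
Proof. by move=> a b; rewrite derive1E (@derive_val _ _ _ _ _ _ _ (derive_constant a b)). Qed.

(** At a jump of d the profile decreases through U z, so its left side sees the
    right limit of d and conversely. *)
Let sides z : U z \in J -> exists l1 l2 : R, [/\ 0 < l1, 0 < l2,
  [/\ d (U x) @[x --> z^'-] --> l2, d (U x) @[x --> z^'+] --> l1,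
   derive1 U x @[x --> z^'-] --> - (W (U z) / l2) `^ r &
   derive1 U x @[x --> z^'+] --> - (W (U z) / l1) `^ r],
  t^-1 *: (U (t + z) - U z) @[t --> 0^'-] --> - (W (U z) / l2) `^ r &
  t^-1 *: (U (t + z) - U z) @[t --> 0^'+] --> - (W (U z) / l1) `^ r].
Proof.
move=> UJ; have [_ _ _ jd] := hd; have Uz := J01 UJ.
have [l1 [l2 [l10 l20 d1 d2]]] := jd _ UJ; exists l1, l2.
have dl : d (U x) @[x --> z^'-] --> l2.
  apply/cvg_left_epsP => e e0; have /cvg_right_epsP/(_ _ e0)[e1 e10 H1] := d2.
  have /continuous_epsP/(_ _ e10)[e2 e20 H2] := @cU z.
  exists e2 => // x /andP[x1 x2]; apply: H1; rewrite U_lt_r//=.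
  have : `|U x - U z| < e1 by apply: H2; rewrite ltr_norml; lra.
  by rewrite ltr_norml; lra.
have dr : d (U x) @[x --> z^'+] --> l1.
  apply/cvg_right_epsP => e e0; have /cvg_left_epsP/(_ _ e0)[e1 e10 H1] := d1.
  have /continuous_epsP/(_ _ e10)[e2 e20 H2] := @cU z.
  exists e2 => // x /andP[x1 x2]; apply: H1; rewrite U_lt// andbT.
  have : `|U x - U z| < e1 by apply: H2; rewrite ltr_norml; lra.
  by rewrite ltr_norml; lra.
have cWU : continuous (fun x => W (U x)).
  by move=> x; apply: (@continuous_comp _ _ _ U W); [exact: cU|exact: cW].
have lim_speed (F : set_system R) (l : R) : Filter F -> 0 < l ->
    d (U x) @[x --> F] --> l -> W (U x) @[x --> F] --> W (U z) ->
    - speed (U x) @[x --> F] --> - (W (U z) / l) `^ r.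
  move=> FF l0 dF WF; apply: cvgN.
  apply: (@cvg_comp _ _ _ (fun x => W (U x) / d (U x)) (fun y => y `^ r)); last first.
    by apply: powR_continuous; rewrite divr_gt0 ?W0.
  by apply: cvgM => //; apply: cvgV; rewrite ?gt_eqF.
have sl : - speed (U x) @[x --> z^'-] --> - (W (U z) / l2) `^ r.
  by apply: lim_speed => //; apply: cvg_at_left_filter; exact: cWU.
have sr : - speed (U x) @[x --> z^'+] --> - (W (U z) / l1) `^ r.
  by apply: lim_speed => //; apply: cvg_at_right_filter; exact: cWU.
have [del del0 HJ] := notin_seq_near J (U z).
have /continuous_epsP/(_ _ del0)[e2 e20 H2] := @cU z.
have [e3 /= e30 H3] := (nbhs_ballP _ _).1 (near_01 Uz).
have e0 : 0 < Num.min e2 e3 by rewrite lt_min e20.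
have off x : `|x - z| < Num.min e2 e3 -> x != z -> 0 < U x < 1 /\ U x \notin J.
  rewrite lt_min => /andP[/H2 h2 h3] xz.
  have Ux : 0 < U x < 1 by apply: H3; rewrite /ball/= distrC.
  split=> //; apply: HJ => //; move: xz; rewrite neq_lt => /orP[xz|xz].
    by rewrite gt_eqF// U_lt.
  by rewrite lt_eqF// U_lt.
have offl t : z - Num.min e2 e3 < t < z -> 0 < U t < 1 /\ U t \notin J.
  by move=> tz; apply: off; [rewrite ltr_norml; lra|rewrite lt_eqF//; lra].
have offr t : z < t < z + Num.min e2 e3 -> 0 < U t < 1 /\ U t \notin J.
  by move=> tz; apply: off; [rewrite ltr_norml; lra|rewrite gt_eqF//; lra].
split; [exact: l10|exact: l20|split; [exact: dl|exact: dr| |]| |].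
- apply: cvg_trans sl; apply: near_eq_cvg; rewrite near_withinE.
  apply/nbhs_ballP; exists (Num.min e2 e3) => //= x; rewrite /ball/= ltr_norml => h1 h2.
  by have [|a b] := offl x; [lra|rewrite derive1_off].
- apply: cvg_trans sr; apply: near_eq_cvg; rewrite near_withinE.
  apply/nbhs_ballP; exists (Num.min e2 e3) => //= x; rewrite /ball/= ltr_norml => h1 h2.
  by have [|a b] := offr x; [lra|rewrite derive1_off].
- apply: (left_quotient_cvg (df := fun x => - speed (U x))) => //.
  by exists (Num.min e2 e3) => // t /offl[]; exact: dU.
- apply: (right_quotient_cvg (df := fun x => - speed (U x))) => //.
  by exists (Num.min e2 e3) => // t /offr[]; exact: dU.
Qed.

Let sides_flux z : U z \in J -> [/\ left_derivable U z, right_derivable U z,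
   left_derive U z < 0, right_derive U z < 0 &
   flux_matching p d U z /\ left_flux p d U z = - W (U z)].
Proof.
move=> UJ; have Uz := J01 UJ.
have [l1 [l2 [l10 l20 [d1 d2 _ _] s1 s2]]] := sides UJ.
have El : left_derive U z = - (W (U z) / l2) `^ r by apply/cvg_lim.
have Er : right_derive U z = - (W (U z) / l1) `^ r by apply/cvg_lim.
have Fl : left_flux p d U z = - W (U z).
  by rewrite /left_flux El (cvg_lim _ d1)// mulrC flux_of_slope// ?W0.
have Fr : right_flux p d U z = - W (U z).
  by rewrite /right_flux Er (cvg_lim _ d2)// mulrC flux_of_slope// ?W0.
split.
- by apply/cvg_ex; eexists; exact: s1.
- by apply/cvg_ex; eexists; exact: s2.
- by rewrite El oppr_lt0 powR_gt0// divr_gt0// W0.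
- by rewrite Er oppr_lt0 powR_gt0// divr_gt0// W0.
split=> //; split; first by apply/cvg_ex; eexists; exact: d1.
  by apply/cvg_ex; eexists; exact: d2.
by rewrite Fl Fr.
Qed.

Let flux_off z : 0 < U z < 1 -> U z \notin J -> d (U z) * plap p (derive1 U z) = - W (U z).
Proof. by move=> a b; rewrite derive1_off// flux_of_slope ?d0 ?W0. Qed.

(** The matching of the one-sided fluxes at the jumps of d is the continuity of W. *)
Let fluxE : flux p d n m U = (fun z => - W (U z)).
Proof.
apply/funext => z; rewrite /flux.
case: asboolP => [/boundary_N[] ->|nb]; rewrite ?W00 ?W10 ?oppr0//.
case: asboolP => [/boundary_M UJ|nM]; first by have [_ _ _ _ []] := sides_flux UJ.
have UJ : U z \notin J by apply/negP => /boundary_M.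
have [Uz|/ends Uz] := pselect (0 < U z < 1); first exact: flux_off.
by rewrite derive1_const// plap0 mulr0; case: Uz => ->; rewrite ?W00 ?W10 oppr0.
Qed.

Let C1_point z : ~ boundary (M_ n m U) z -> ~ boundary (N_ U) z ->
  derivable U z 1 /\ {for z, continuous (derive1 U)}.
Proof.
move=> nM nN; have UJ : U z \notin J by apply/negP => /boundary_M.
have [Uz|/ends Uz] := pselect (0 < U z < 1).
  split; first by have [] := dU Uz UJ.
  have cs : - speed (U x) @[x --> z] --> - speed (U z).
    have [_ cd _ _] := hd; apply: cvgN.
    apply: (@continuous_comp _ _ _ U (fun u => speed u)); first exact: cU.
    by apply: quotient_powR_continuous; [exact: cW|exact: cd|exact: W0|exact: d0].
  suff : derive1 U x @[x --> z] --> derive1 U z by [].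
  rewrite derive1_off//; apply: cvg_trans cs; apply: near_eq_cvg.
  by near=> x; rewrite derive1_off//; near: x; [exact: near_01|exact: near_nJ].
split; first by have [] := derive_constant nN Uz.
suff : derive1 U x @[x --> z] --> derive1 U z by [].
have c0 : (fun _ : R => 0 : R) x @[x --> z] --> (0 : R) by exact: cvg_cst.
rewrite derive1_const//; apply: cvg_trans c0.
apply: near_eq_cvg; near=> x; rewrite derive1_const//; first by near: x; exact: near_not_bN.
have -> : U x = U z by near: x; exact: locally_constant.
exact: Uz.
Unshelve. all: by end_near.
Qed.


Let z0 : \bar R := ereal_inf [set z%:E | z in [set z | U z < 1]].
Let z1 : \bar R := ereal_sup [set z%:E | z in [set z | 0 < U z]].

Let z0P z : (z0 < z%:E)%E <-> U z < 1.
Proof.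
split=> [/ereal_inf_lt[_ [x /= Ux <-]]|Uz].
  by rewrite lte_fin => xz; apply: le_lt_trans Ux; apply: U_anti; exact: ltW.
have Uz1 : 0 < 1 - U z by rewrite subr_gt0.
have /continuous_epsP/(_ _ Uz1)[e e0 He] := @cU z.
apply: (@le_lt_trans _ _ (z - e / 2)%:E); last by rewrite lte_fin; lra.
apply: ereal_inf_lbound; exists (z - e / 2) => //=.
have : `|U (z - e / 2) - U z| < 1 - U z by apply: He; rewrite ltr_norml; lra.
by rewrite ltr_norml; lra.
Qed.

Let z1P z : (z%:E < z1)%E <-> 0 < U z.
Proof.
split=> [/ereal_sup_gt[_ [x /= Ux <-]]|Uz].
  by rewrite lte_fin => xz; apply: (lt_le_trans Ux); apply: U_anti; exact: ltW.
have /continuous_epsP/(_ _ Uz)[e e0 He] := @cU z.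
apply: (@lt_le_trans _ _ (z + e / 2)%:E); first by rewrite lte_fin; lra.
apply: ereal_sup_ubound; exists (z + e / 2) => //=.
have : `|U (z + e / 2) - U z| < U z by apply: He; rewrite ltr_norml; lra.
by rewrite ltr_norml; lra.
Qed.

Let z01P z : (z0 < z%:E < z1)%E <-> 0 < U z < 1.
Proof.
split; first by move=> /andP[/z0P a /z1P b]; rewrite b.
by move=> /andP[/z1P a /z0P b]; rewrite a b.
Qed.

Let U_half : U 0 = 2^-1. Proof. exact: (profile_of_half r0 hd cW W0). Qed.

Let z0_lt0 : (z0 < 0)%E. Proof. by apply/z0P; rewrite U_half; lra. Qed.
Let z1_gt0 : (0 < z1)%E. Proof. by apply/z1P; rewrite U_half; lra. Qed.

Let inner_not_boundary_N z : 0 < U z < 1 -> ~ boundary (N_ U) z.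
Proof. by move=> Uz /boundary_N[] E; move: Uz; rewrite E ltxx ?andbF. Qed.

(** The phase-plane equation for W becomes the differential equation of the profile
    after multiplication by the slope - (W/d)^r of U. *)
Let dWU z : 0 < U z < 1 -> U z \notin J ++ K ->
  is_derive z 1 (fun x => - W (U x)) (- (c - h (U z)) * - speed (U z) - g (U z)).
Proof.
move=> Uz UJK; have UJ : U z \notin J by move: UJK; rewrite mem_cat negb_or => /andP[].
have := deriv_opp (deriv_comp (dW Uz UJK) (dU Uz UJ)).
suff E : weighted_reaction r d g (U z) / W (U z) `^ r * speed (U z) = g (U z).
  by congr (is_derive _ _ _ _); rewrite -{}E; ring.
have dz := d0 Uz; have wz := W0 Uz.
rewrite /weighted_reaction powRM ?invr_ge0 ?(ltW dz) ?(ltW wz)//.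
rewrite -[(d (U z))^-1]powR_inv1 ?(ltW dz)// -powRrM mulN1r powRN.
have a0 : d (U z) `^ r != 0 by rewrite gt_eqF// powR_gt0.
have b0 : W (U z) `^ r != 0 by rewrite gt_eqF// powR_gt0.
by field; rewrite a0 b0.
Qed.

Let gU_continuous : continuous (fun z => g (U z)).
Proof.
have cgc := clamp_continuous (@ler01 R) cg.
have -> : (fun z => g (U z)) = (fun z => (g \o clamp 0 1) (U z)).
  by apply/funext => z; rewrite /= clamp_id.
by move=> z; apply: (@continuous_comp _ _ _ U (g \o clamp 0 1)); [exact: cU|exact: cgc].
Qed.

Let exceptional : seq R := [seq - arr u | u <- J ++ K] ++ [:: fine z0; fine z1].

Let exceptional_inner z : 0 < U z < 1 -> z \notin exceptional -> U z \notin J ++ K.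
Proof.
move=> Uz; apply: contra => UJK; rewrite mem_cat; apply/orP; left.
by apply/mapP; exists (U z) => //; rewrite UP ?opprK.
Qed.

Let fine_end (a : \bar R) z : a = z%:E -> z = fine a. Proof. by move=> ->. Qed.

(** The boundary of the set where U is 0 or 1 consists of the finite endpoints. *)
Let outer z : U z = 0 \/ U z = 1 -> z \notin exceptional -> ~ boundary (N_ U) z.
Proof.
move=> Uz ze [_]; apply.
have [zz0 zz1] : z <> fine z0 /\ z <> fine z1.
  by split=> E; move: ze; rewrite mem_cat !inE E eqxx ?orbT.
case: Uz => Uz.
  have hz : (z1 <= z%:E)%E by rewrite leNgt; apply/negP => /z1P; rewrite Uz ltxx.
  have {}hz : (z1 < z%:E)%E.
    by rewrite lt_neqAle hz andbT; apply/eqP => /fine_end.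
  have [x /= x1 x2] : exists2 x : R, x < z & (z1 <= x%:E)%E.
    move: hz z1_gt0; case: z1 => // y yz y0; exists ((y + z) / 2); rewrite ?lee_fin; rewrite lte_fin in yz; lra.
  have : z \in `]x, +oo[ by rewrite in_itv/= x1.
  move=> /near_in_itvoy; apply: filterS => y; rewrite in_itv/= andbT => xy; left.
  apply/eqP; rewrite eq_le; have /andP[-> _] := U01 y; rewrite andbT leNgt.
  by apply/negP => /z1P yz1; have := lt_le_trans yz1 x2; rewrite lte_fin; lra.
have hz : (z%:E <= z0)%E by rewrite leNgt; apply/negP => /z0P; rewrite Uz ltxx.
have {}hz : (z%:E < z0)%E.
  by rewrite lt_neqAle hz andbT; apply/eqP => /esym/fine_end.
have [x /= x1 x2] : exists2 x : R, z < x & (x%:E <= z0)%E.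
  move: hz z0_lt0; case: z0 => // y yz y0; exists ((y + z) / 2); rewrite ?lee_fin; rewrite lte_fin in yz; lra.
have : z \in `]-oo, x[ by rewrite in_itv/= x1.
move=> /near_in_itvNyo; apply: filterS => y; rewrite in_itv/= => xy; right.
apply/eqP; rewrite eq_le; have /andP[_ ->] := U01 y; rewrite /= leNgt.
by apply/negP => /z0P yz1; have := le_lt_trans x2 yz1; rewrite lte_fin; lra.
Qed.

(** The balance law is conservation of the expression below, whose derivative
    vanishes at all but finitely many points. *)
Let balance_constant a b (P := primitive (fun z => g (U z)) a b)
  (E := fun z => - W (U z) + c * U z - Hc (U z) + P z) x y :
  a < x -> x <= y -> y < b -> E x = E y.
Proof.
move=> ax xy yb.
have gUi : (@lebesgue_measure R).-integrable `[a, b] (EFin \o (fun z => g (U z))).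
  apply: continuous_compact_integrable; first exact: segment_compact.
  exact: continuous_subspaceT gU_continuous.
have cP : continuous P by apply: primitive_continuous => //; lra.
have cE : continuous E.
  move=> z; apply: cvgD; last exact: cP.
  apply: cvgB.
    apply: cvgD; last by apply: cvgM; [exact: cvg_cst|exact: cU].
    by apply: cvgN; apply: (@continuous_comp _ _ _ U W); [exact: cU|exact: cW].
  by apply: (@continuous_comp _ _ _ U Hc); [exact: cU|exact: cHc].
have dE z : x < z < y -> z \notin exceptional -> is_derive z 1 E 0.
  move=> zxy ze; have zab : a < z < b by lra.
  have dP := primitive_derive gUi zab (@gU_continuous z).
  have [Uz|/ends Uz] := pselect (0 < U z < 1).
    have UJK := exceptional_inner Uz ze.
    have := UJK; rewrite mem_cat negb_or => /andP[UJ UK'].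
    have := deriv_add (deriv_sub (deriv_add (dWU Uz UJK) (deriv_scale c (dU Uz UJ)))
      (deriv_comp (dHc Uz UK') (dU Uz UJ))) dP.
    by congr (is_derive _ _ _ _); ring.
  have nb := outer Uz ze.
  have gz : g (U z) = 0 by case: Uz => ->.
  rewrite gz in dP.
  have := deriv_add (deriv_const (- W (U z) + c * U z - Hc (U z)) z) dP.
  rewrite addr0; apply: near_eq_is_derive.
  by move: (locally_constant nb Uz); apply: filterS => w Uw; rewrite /E Uw.
by apply: (@constant_of_derive0 _ E exceptional).
Qed.

Let balance x y : flux p d n m U y - flux p d n m U x + c * (U y - U x)
  - (H_ h (U y) - H_ h (U x)) + oriented_integral (g \o U) x y = 0.
Proof.
rewrite fluxE !HcE//.
pose a := Num.min x y - 1; pose b := Num.max x y + 1.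
have hab : a < x < b /\ a < y < b by rewrite /a /b; case: (leP x y) => ?; lra.
rewrite (@oriented_integralE _ (g \o U) a b); [|exact: continuous_compact_integrable (@segment_compact _ _ _) (continuous_subspaceT gU_continuous)|lra|lra].
have [xy|/ltW xy] := leP x y.
  have := @balance_constant a b x y; rewrite /= => /(_ ltac:(lra) xy ltac:(lra)).
  by rewrite /comp; lra.
have := @balance_constant a b y x; rewrite /= => /(_ ltac:(lra) xy ltac:(lra)).
by rewrite /comp; lra.
Qed.

Let WU_cvg (F : set_system R) (l : R) : Filter F -> W l = 0 ->
  U x @[x --> F] --> l -> - W (U x) @[x --> F] --> (0 : R).
Proof.
move=> FF Wl UF; rewrite -oppr0; apply: cvgN; rewrite -Wl.
exact: (@cvg_comp _ _ _ U W F (nbhs l) (nbhs (W l)) UF (@cW l)).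
Qed.

Lemma profile_of_solution : monotone_solution p c g d h n m U.
Proof.
split.
- exact: cU.
- exact: U01.
- by right => x y xy; exact: U_anti.
- by move=> z /not_orP[a b]; exact: C1_point.
- move=> z /not_orP[a b] Uz; rewrite derive1_off//; last by apply/negP => /boundary_M.
  by rewrite oppr_eq0 gt_eqF// speed0.
- move=> z /boundary_M /sides_flux[a b c1 c2 [e _]]; split => //.
    by rewrite lt_eqF.
  by rewrite lt_eqF.
- rewrite fluxE => z; apply: cvgN.
  by apply: (@continuous_comp _ _ _ U W); [exact: cU|exact: cW].
- exact: balance.
- by rewrite fluxE; apply: WU_cvg W00 _; exact: (profile_of_pinfty r0 hd cW W0).
- by rewrite fluxE; apply: WU_cvg W10 _; exact: (profile_of_ninfty r0 hd cW W0).
Qed.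

Let end_flux (F : set_system R) (l : R) : Filter F -> W l = 0 -> l = 0 \/ l = 1 ->
  U x @[x --> F] --> l -> (\forall x \near F, 0 < U x < 1) ->
  d (U x) * plap p (derive1 U x) @[x --> F] --> (0 : R).
Proof.
move=> FF Wl l01 UF U01F; apply: cvg_trans (WU_cvg FF Wl UF).
apply: near_eq_cvg.
have [del del0 HJ] := notin_seq_near J l.
have /cvgrPdist_lt/(_ _ del0) nl := UF.
near=> x; have Ux : 0 < U x < 1 by near: x.
rewrite flux_off//; apply: HJ; first by rewrite distrC; near: x.
by move: Ux => /andP[a b]; case: l01 => ->; [rewrite gt_eqF|rewrite lt_eqF].
Unshelve. all: by end_near.
Qed.

Let U_at_z0 x : z0 = x%:E -> U x = 1.
Proof.
move=> E; apply/eqP; rewrite eq_le; have /andP[_ ->] := U01 x; rewrite /= leNgt.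
by apply/negP => /z0P; rewrite E ltxx.
Qed.

Let U_at_z1 x : z1 = x%:E -> U x = 0.
Proof.
move=> E; apply/eqP; rewrite eq_le; have /andP[-> _] := U01 x; rewrite andbT leNgt.
by apply/negP => /z1P; rewrite E ltxx.
Qed.

Let flux_z0 : d (U z) * plap p (derive1 U z) @[z --> ereal_at_right z0] --> (0 : R).
Proof.
have := z0_lt0; have := U_at_z0; have := @z0P; case: z0 => // [x|] xP Ux x0.
- rewrite /ereal_at_right; apply: (end_flux (l := 1)) => //; first by right.
    have cx : U y @[y --> x] --> U x := @cU x.
    by rewrite (Ux x erefl) in cx; exact: cvg_at_right_filter cx.
  near=> z; apply/andP; split.
    have : z < 0 by near: z; apply: nbhs_right_lt; rewrite lte_fin in x0.
    by move=> z0'; have := U_anti (ltW z0'); rewrite U_half; lra.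
  by apply/xP; rewrite lte_fin; near: z; exact: nbhs_right_gt.
- rewrite /ereal_at_right; apply: (end_flux (l := 1)) => //; first by right.
    exact: (profile_of_ninfty r0 hd cW W0).
  exists 0; split; first exact: num_real.
  move=> z z0'; apply/andP; split; first by have := U_anti (ltW z0'); rewrite U_half; lra.
  by apply/xP; rewrite ltNyr.
Unshelve. all: by end_near.
Qed.

Let flux_z1 : d (U z) * plap p (derive1 U z) @[z --> ereal_at_left z1] --> (0 : R).
Proof.
have := z1_gt0; have := U_at_z1; have := @z1P; case: z1 => // [x|] xP Ux x0.
- rewrite /ereal_at_left; apply: (end_flux (l := 0)) => //; first by left.
    have cx : U y @[y --> x] --> U x := @cU x.
    by rewrite (Ux x erefl) in cx; exact: cvg_at_left_filter cx.
  near=> z; apply/andP; split.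
    by apply/xP; rewrite lte_fin; near: z; exact: nbhs_left_lt.
  have : 0 < z by near: z; apply: nbhs_left_gt; rewrite lte_fin in x0.
  by move=> z0'; have := U_anti (ltW z0'); rewrite U_half; lra.
- rewrite /ereal_at_left; apply: (end_flux (l := 0)) => //; first by left.
    exact: (profile_of_pinfty r0 hd cW W0).
  exists 0; split; first exact: num_real.
  move=> z z0'; apply/andP; split; last by have := U_anti (ltW z0'); rewrite U_half; lra.
  by apply/xP; rewrite ltry.
Unshelve. all: by end_near.
Qed.

(** U decreases, so it meets the jump points of d in reverse order. *)
Let zeta (i : nat) : \bar R :=
  if i == 0%N then z0 else if i == n.+1 then z1 else (- arr (m (n.+1 - i)%N))%:E.

Let zeta_inner i : (0 < i <= n)%N -> zeta i = (- arr (m (n.+1 - i)%N))%:E /\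
  (0 < n.+1 - i <= n)%N.
Proof.
move=> /andP[i0 iN]; rewrite /zeta gtn_eqF// ltn_eqF ?ltnS//; split=> //.
by rewrite subn_gt0 ltnS iN/= leq_subLR -add1n leq_add2r.
Qed.

Let zetaU i : (0 < i <= n)%N -> U (fine (zeta i)) \in J /\ zeta i = (fine (zeta i))%:E.
Proof.
move=> /zeta_inner[-> ni]; split=> //=.
by rewrite UK ?(subdivision_in sm)//; apply/jump_pointsP; exists (n.+1 - i)%N.
Qed.

Let zeta_lt i : (i <= n)%N -> (zeta i < zeta i.+1)%E.
Proof.
move=> iN; have [i0|i0] := posnP i.
  rewrite i0 {1}/zeta eqxx /zeta/=; case: ifP => n0; first exact: lt_trans z0_lt0 z1_gt0.
  have n1 : (0 < n <= n)%N by rewrite leqnn lt0n eq_sym -eqSS n0.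
  have := subdivision_in sm n1; rewrite subSS subn0 => m01.
  by apply/z0P; rewrite UK//; case/andP: m01.
have ni : (0 < i <= n)%N by rewrite i0.
have [E ji] := zeta_inner ni.
have [ein|neq] := eqVneq i n.
  rewrite {2}/zeta /= eqSS ein eqxx -ein E; apply/z1P.
  by have := subdivision_in sm ji => m01; rewrite UK//; case/andP: m01.
have ni1 : (0 < i.+1 <= n)%N by rewrite /= ltn_neqAle neq.
have [-> ji1] := zeta_inner ni1; rewrite E lte_fin ltrN2.
have /andP[a0 a1] := subdivision_in sm ji; have /andP[b0 b1] := subdivision_in sm ji1.
apply: (arrival_lt r0 hd cW W0) => //; apply: (subdivision_lt sm).
by rewrite leq_subr andbT subSS subSn// ltnS.
Qed.

Let zeta_mono i j : (i < j <= n.+1)%N -> (zeta i < zeta j)%E.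
Proof.
move=> /andP[]; elim: j => // j IH; rewrite ltnS leq_eqVlt ltnS => /predU1P[->|ij] jn.
  exact: zeta_lt.
by apply: lt_trans (zeta_lt jn); apply: IH => //; exact: leqW.
Qed.

Let zeta_between i z : (i <= n)%N -> (zeta i < z%:E < zeta i.+1)%E ->
  0 < U z < 1 /\ U z \notin J.
Proof.
move=> iN /andP[iz zi]; split.
  apply/z01P; apply/andP; split.
    have [i0|i0] := posnP i; first by move: iz; rewrite i0.
    have h0i : (0 < i <= n.+1)%N by rewrite i0 leqW.
    exact: lt_trans (zeta_mono h0i) iz.
  have [ein|neq] := eqVneq i n; first by move: zi; rewrite ein /zeta eqxx.
  apply: (lt_trans zi); have := @zeta_mono i.+1 n.+1.
  by rewrite {2}/zeta eqxx; apply; rewrite !ltnS ltn_neqAle neq iN leqnn.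
apply/negP => /jump_pointsP[l ln E].
have zE : zeta (n.+1 - l)%N = z%:E.
  have ln' : (0 < n.+1 - l <= n)%N.
    by case/andP: ln => l0 lN; rewrite subn_gt0 ltnS lN/= leq_subLR -add1n leq_add2r.
  have [-> _] := zeta_inner ln'; rewrite subKn; last by case/andP: ln => _ /leqW.
  by rewrite -E UP ?opprK// E; exact: subdivision_in sm ln.
have [li|il] := leqP (n.+1 - l)%N i.
  move: li; rewrite leq_eqVlt => /predU1P[E'|li]; first by move: iz; rewrite -E' zE ltxx.
  have := @zeta_mono (n.+1 - l)%N i; rewrite li leqW// zE => /(_ isT) hh.
  by have := lt_trans hh iz; rewrite ltxx.
move: il; rewrite leq_eqVlt => /predU1P[E'|il]; first by move: zi; rewrite E' zE ltxx.
have := @zeta_mono i.+1 (n.+1 - l)%N; rewrite il leq_subr zE => /(_ isT) hh.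
by have := lt_trans hh zi; rewrite ltxx.
Qed.

Let prop_i : property_i U z0 z1.
Proof.
split.
- by split; [exact: z0_lt0|exact: z1_gt0].
- by apply/seteqP; split => z /= /z01P.
- move=> x y x0 xy yz1; have [xz|zx] := ltP 0 (U y).
    apply: U_lt => //; apply/andP; split; last exact/z0P.
    by apply: (lt_le_trans xz); apply: U_anti; exact: ltW.
  by move/z1P: yz1; rewrite ltNge zx.
- split; first exact: U_half.
    move=> z zz; apply/eqP; rewrite eq_le; have /andP[_ ->] := U01 z; rewrite /= leNgt.
    by apply/negP => /z0P; rewrite ltNge zz.
  move=> z zz; apply/eqP; rewrite eq_le; have /andP[-> _] := U01 z; rewrite andbT leNgt.
  by apply/negP => /z1P; rewrite ltNge zz.
move=> z /z01P Uz; have [UJ|UJ] := boolP (U z \in J).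
  have [a b c1 c2 _] := sides_flux UJ; split=> //; first by rewrite lt_eqF.
  by rewrite lt_eqF.
have [a ->] := is_derive_left (dU Uz UJ); have [b ->] := is_derive_right (dU Uz UJ).
by split=> //; rewrite oppr_eq0 gt_eqF// speed0.
Qed.

Let prop_ii : property_ii n m U z0 z1 zeta.
Proof.
split.
- split; [by rewrite /zeta eqxx|by rewrite /zeta eqxx|exact: zeta_lt].
- apply/seteqP; split => z /=.
    move=> [l ln E].
    have ln' : (0 < n.+1 - l <= n)%N.
      by case/andP: ln => l0 lN; rewrite subn_gt0 ltnS lN/= leq_subLR -add1n leq_add2r.
    exists (n.+1 - l)%N => //.
    have [-> _] := zeta_inner ln'; rewrite subKn; last by case/andP: ln => _ /leqW.
    by rewrite -E UP ?opprK// E; exact: subdivision_in sm ln.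
  move=> [i ni E]; have [UJ _] := zetaU ni.
  by move: UJ; rewrite E /= => /M_E.
- move=> i iN z /= /(zeta_between iN)[Uz UJ]; apply: C1_point.
    by move/boundary_M; exact/negP.
  exact: inner_not_boundary_N.
- move=> i ni /=; have [UJ _] := zetaU ni.
  have [l1 [l2 [l10 l20 [d1 d2 e1 e2] s1 s2]]] := sides UJ.
  have El := cvg_lim (@Rhausdorff R) s1; have Er := cvg_lim (@Rhausdorff R) s2.
  split.
  + by apply/cvg_ex; eexists; exact: s1.
  + by apply/cvg_ex; eexists; exact: s2.
  + by rewrite /left_derive El.
  + by rewrite /right_derive Er.
Qed.

Let prop_iii : property_iii p d n U z0 z1 zeta.
Proof.
split; [exact: flux_z0|exact: flux_z1|].
by move=> i /zetaU[UJ _]; have [_ _ _ _ []] := sides_flux UJ.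
Qed.

Let prop_iv : property_iv p c g d h n q m k U.
Proof.
move=> z /not_orP[/not_orP[nM nK] nN] w.
have UJ : U z \notin J by apply/negP => /boundary_M.
have UK' : U z \notin K by apply/negP => /K_E.
have [Uz|/ends Uz] := pselect (0 < U z < 1).
  have UJK : U z \notin J ++ K by rewrite mem_cat negb_or UJ.
  have nw : \forall x \near z, - W (U x) = w x.
    by near=> x; rewrite /w flux_off//; near: x; [exact: near_01|exact: near_nJ].
  have dw := near_eq_is_derive nw (dWU Uz UJK).
  split; [by have [] := dU Uz UJ|by have [] := dw|].
  rewrite derive1_off// [derive1 w z]derive1E (@derive_val _ _ _ _ _ _ _ dw); ring.
have nw : \forall x \near z, 0 = w x.
  near=> x; rewrite /w derive1_const ?plap0 ?mulr0//; first by near: x; exact: near_not_bN.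
  have -> : U x = U z by near: x; exact: locally_constant.
  exact: Uz.
have dw := near_eq_is_derive nw (deriv_const 0 z).
split; [by have [] := derive_constant nN Uz|by have [] := dw|].
rewrite derive1_const// [derive1 w z]derive1E (@derive_val _ _ _ _ _ _ _ dw).
by case: Uz => ->; rewrite ?g0 ?g1; ring.
Unshelve. all: by end_near.
Qed.

Theorem profile_of_regular : regular_profile p c g d h n q m k U.
Proof.
split; last by exists z0, z1, zeta; split; [exact: prop_i|exact: prop_ii|exact: prop_iii|exact: prop_iv].
split; first exact: profile_of_solution.
  exact: (profile_of_ninfty r0 hd cW W0).
exact: (profile_of_pinfty r0 hd cW W0).
Qed.

End ConstructedProfile.

(** * Every regular profile comes from the phase plane *)

Section Tail.
Context {R : realType}.
Implicit Types (t u x y z : R) (del e : R) (S : seq R).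

(** If D were positive at t it would stay at least D t from there on, against the
    limit; likewise if it were negative. *)
Lemma vanish_of_repelled (D : R -> R) S z : continuous D ->
  D t @[t --> +oo] --> (0 : R) ->
  (forall t, z < t -> t \notin S -> D t != 0 ->
     exists2 l, is_derive t 1 D l & 0 <= D t * l) ->
  forall t, z <= t -> D t = 0.
Proof.
have pos : forall D : R -> R, continuous D -> D t @[t --> +oo] --> (0 : R) ->
    (forall t, z < t -> t \notin S -> D t != 0 ->
     exists2 l, is_derive t 1 D l & 0 <= D t * l) ->
    forall t, z <= t -> D t <= 0.
  move=> {}D cD limD HD t zt; rewrite leNgt; apply/negP => Dt.
  have /cvgrPdist_lt/(_ _ Dt)[A [_ HA]] := limD.
  pose y := Num.max t A + 1.
  have ty : t <= y by rewrite /y; case: (leP t A) => ?; lra.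
  have Ay : A < y by rewrite /y; case: (leP t A) => ?; lra.
  suff : (fun x => D t - D x) y <= 0.
    by have := HA _ Ay; rewrite sub0r normrN ltr_norml /=; lra.
  apply: (@le0_comparison _ (fun x => D t - D x) t y (D t) S) => //.
  - by move=> x; apply: cvgB; [exact: cvg_cst|exact: cD].
  - by rewrite subrr.
  - move=> x /andP[tx xy] xS /andP[h1 h2].
    have Dx : 0 < D x by lra.
    have zx : z < x by lra.
    have [l dl Dl] := HD x zx xS (negbT (gt_eqF Dx)).
    exists (0 - l); first exact: deriv_sub (deriv_const _ _) dl.
    by move: Dl; rewrite pmulr_rge0//; lra.
  - by rewrite ty lexx.
move=> cD limD HD t zt; apply/eqP; rewrite eq_le pos//= -oppr_le0.
apply: (pos (fun t => - D t)) => //.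
- by move=> x; apply: cvgN; exact: cD.
- by rewrite -oppr0; apply: cvgN.
- move=> x zx xS; rewrite oppr_eq0 => Dx; have [l dl Dl] := HD _ zx xS Dx.
  by exists (- l); [exact: deriv_opp|rewrite mulrNN].
Qed.

End Tail.

Section GivenProfile.
Context {R : realType}.
Implicit Types (t u x y z : R) (del e : R).
Variables (p c s : R) (g d h : R -> R) (n q : nat) (m k : nat -> R) (U : R -> R).
Notation r := ((p - 1)^-1).
Notation J := (jump_points n m).
Notation K := (jump_points q k).
Notation f := (weighted_reaction r d g).
Hypotheses (p1 : 1 < p) (hd : piecewise_positive J d) (s01 : 0 < s < 1).
Hypothesis (hg : standing_g s g).
Hypothesis HU : regular_profile p c g d h n q m k U.

Let solU : monotone_solution p c g d h n m U. Proof. by have [[]] := HU. Qed.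
Let cU : continuous U. Proof. exact: sol_continuous solU. Qed.
Let U01 z : 0 <= U z <= 1. Proof. exact: sol_range solU z. Qed.
Let r0 : 0 < r := conjugate_exponent_gt0 p1.
Let d0 u : 0 < u < 1 -> 0 < d u. Proof. by have [H _ _ _] := hd; exact: H. Qed.
Notation E := (fun z => - flux p d n m U z).

Let cflux : continuous (flux p d n m U). Proof. exact: sol_flux_continuous solU. Qed.

Let ends_info : exists z0 z1 : \bar R, property_i U z0 z1.
Proof. by have [_ [z0 [z1 [zeta []]]]] := HU; exists z0, z1. Qed.

Lemma regular_profile_half : U 0 = 2^-1.
Proof. by have [z0 [z1 [_ _ _ []]]] := ends_info. Qed.

Lemma regular_profile_lt x y : 0 < U x < 1 -> 0 < U y < 1 -> x < y -> U y < U x.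
Proof.
have [z0 [z1 [_ E01 dec _ _]]] := ends_info => Ux Uy xy.
have : [set z | 0 < U z < 1] x by [].
have : [set z | 0 < U z < 1] y by [].
by rewrite E01 /= => /andP[_ b] /andP[a _]; exact: dec.
Qed.

Lemma regular_profile_inj x y : 0 < U x < 1 -> U x = U y -> x = y.
Proof.
move=> Ux e; have Uy : 0 < U y < 1 by rewrite -e.
have [xy|yx|//] := ltgtP x y.
  by have := regular_profile_lt Ux Uy xy; rewrite e ltxx.
by have := regular_profile_lt Uy Ux yx; rewrite e ltxx.
Qed.

Lemma regular_profile_outer z : ~ (0 < U z < 1) ->
  (z < 0 /\ U z = 1) \/ (0 < z /\ U z = 0).
Proof.
have [z0 [z1 [[z00 z10] E01 _ [_ U1 U0] _]]] := ends_info => Uz.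
have : ~ [set z | 0 < U z < 1] z by [].
rewrite E01 /= => /negP; rewrite negb_and -!leNgt => /orP[h1|h1].
  by left; split; [rewrite -lte_fin; exact: le_lt_trans h1 z00|exact: U1].
by right; split; [rewrite -lte_fin; exact: lt_le_trans z10 h1|exact: U0].
Qed.

Lemma regular_profile_onto u : 0 < u < 1 -> exists z, U z = u.
Proof.
move=> u01; have [[_ Um Up] _] := HU.
have u0 : 0 < u by lra.
have u1 : 0 < 1 - u by lra.
have /cvgrPdist_lt/(_ _ u0)[A [_ HA]] := Up.
have /cvgrPdist_lt/(_ _ u1)[B [_ HB]] := Um.
have := HA (A + 1); have := HB (B - 1).
move=> /(_ ltac:(lra)) hb /(_ ltac:(lra)) ha.
have hu1 : u < U (B - 1) by move: hb; rewrite ltr_norml; lra.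
have hu2 : U (A + 1) < u by move: ha; rewrite ltr_norml; lra.
have [ab|ab] := leP (A + 1) (B - 1).
  have [|z _ <-] := IVT ab (continuous_subspaceT cU) (v := u); last by exists z.
  by rewrite ge_min (ltW hu2)/= le_max (ltW hu1) orbT.
have [|z _ <-] := IVT (ltW ab) (continuous_subspaceT cU) (v := u); last by exists z.
by rewrite ge_min (ltW hu2) orbT/= le_max (ltW hu1).
Qed.

(* by injectivity each exceptional value is taken at one point at most *)
Let preimage u : R := xget 0 [set z | U z = u].

Let exceptional : seq R := [seq preimage u | u <- J ++ K].

Let exceptionalP z : 0 < U z < 1 -> z \notin exceptional -> U z \notin J ++ K.
Proof.
move=> Uz; apply: contra => UJK; apply/mapP; exists (U z) => //.
rewrite /preimage; case: xgetP => [x _ /= e|/(_ z)/(_ erefl)]; last by [].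
by apply: regular_profile_inj => //; rewrite e.
Qed.

Let not_boundaries z : 0 < U z < 1 -> U z \notin J ->
  ~ boundary (M_ n m U) z /\ ~ boundary (N_ U) z.
Proof.
move=> Uz UJ; split; first by move/(boundary_M_level cU); exact/negP.
by move=> /(boundary_N_level cU U01)[] e; move: Uz; rewrite e ltxx ?andbF.
Qed.

Let flux_formula z : 0 < U z < 1 -> U z \notin J ->
  flux p d n m U z = d (U z) * plap p (derive1 U z).
Proof.
move=> Uz UJ; have [nM nN] := not_boundaries Uz UJ.
by rewrite /flux; case: asboolP => //; case: asboolP.
Qed.

Lemma flux_outer z : ~ (0 < U z < 1) -> flux p d n m U z = 0.
Proof.
move=> /(level_ends U01) Uz; rewrite /flux.
case: asboolP => // nN; case: asboolP => [/(boundary_M_level cU) UJ|_].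
  have [_ _ J01 _] := hd; have := J01 _ UJ.
  by case: Uz => ->; rewrite ltxx ?andbF.
have dUz := derive_outside cU nN Uz.
by rewrite derive1E (@derive_val _ _ _ _ _ _ _ dUz) plap0 mulr0.
Qed.

(** Here the differential equation is available; the slope is negative because U
    decreases, and so it can be solved for in terms of the flux. *)
Let regular_point z : 0 < U z < 1 -> z \notin exceptional ->
  [/\ 0 < E z, is_derive z 1 U (- (E z / d (U z)) `^ r) &
   is_derive z 1 (flux p d n m U) ((h (U z) - c) * - (E z / d (U z)) `^ r - g (U z))].
Proof.
move=> Uz ze; have := exceptionalP Uz ze; rewrite mem_cat negb_or => /andP[UJ UK].
have [nM nN] := not_boundaries Uz UJ.
have [_ [z0 [z1 [zeta [_ _ _ /(_ z) iv]]]]] := HU.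
have [] := iv.
  by move=> [[//|/K_level]|//]; exact/negP.
move=> dU dw Ew.
have dU' : is_derive z 1 U (derive1 U z) by split; [exact: dU|rewrite derive1E].
have neg : derive1 U z < 0.
  rewrite lt_neqAle (sol_derive_neq0 solU) ?Uz//; last by case.
  rewrite leNgt; apply/negP => pos.
  have /is_derive_quotient/cvgrPdist_lt/(_ _ pos) H := dU'.
  move: H; rewrite near_withinE => /nbhs_ballP[e /= e0 He].
  have [e1 /= e10 He1] := (nbhs_ballP _ _).1 (near_inside cU Uz).
  pose t := Num.min e e1 / 2.
  have [t0 te te1] : [/\ 0 < t, t < e & t < e1].
    by rewrite /t; split; case: (leP e e1) => ?; lra.
  have Ut : 0 < U (t + z) < 1 by apply: He1; rewrite /ball/= ltr_norml; lra.
  have := regular_profile_lt Uz Ut; rewrite ltrDr => /(_ t0) dec.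
  have : `|derive1 U z - t^-1 *: (U (t + z) - U z)| < derive1 U z.
    by apply: He; [rewrite /ball/= ltr_norml; lra|rewrite gt_eqF].
  rewrite ltr_norml => /andP[_]; rewrite /GRing.scale/=.
  have : t^-1 * (U (t + z) - U z) < 0 by rewrite pmulr_rlt0 ?invr_gt0// subr_lt0.
  lra.
have Fz := flux_formula Uz UJ.
have [Ez Us] : 0 < E z /\ derive1 U z = - (E z / d (U z)) `^ r.
  by apply: slope_of_flux => //; [exact: d0|rewrite opprK].
rewrite -Us; split; [exact: Ez|exact: dU'|].
have nw : \forall x \near z, d (U x) * plap p (derive1 U x) = flux p d n m U x.
  near=> x; rewrite flux_formula//; near: x; first exact: (near_inside cU).
  exact: (near_level_notin cU).
apply: near_eq_is_derive nw _; split=> //.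
rewrite -derive1E; move: Ew; rewrite /=; lra.
Unshelve. all: by end_near.
Qed.

(** The contributions of c - h to the two derivatives cancel, as both carry the
    same factor U'. *)
Let defect_derive (w : R -> R) z : 0 < U z < 1 -> z \notin exceptional -> 0 < w (U z) ->
  is_derive (U z) 1 w (c - h (U z) - f (U z) / w (U z) `^ r) ->
  is_derive z 1 (fun x => E x - w (U x)) (g (U z) * (1 - E z `^ r / w (U z) `^ r)).
Proof.
move=> Uz ze w0 dw; have [Ez dU dF] := regular_point Uz ze.
have := deriv_sub (deriv_opp dF) (deriv_comp dw dU).
suff H : f (U z) / w (U z) `^ r * (E z / d (U z)) `^ r = g (U z) * (E z `^ r / w (U z) `^ r).
  congr (is_derive _ _ _ _); rewrite [RHS]mulrBr -{}H; ring.
have dz := d0 Uz.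
rewrite /weighted_reaction powRM ?invr_ge0 ?(ltW dz) ?(ltW Ez)//.
rewrite -[(d (U z))^-1]powR_inv1 ?(ltW dz)// -powRrM mulN1r powRN.
have a0 : d (U z) `^ r != 0 by rewrite gt_eqF// powR_gt0.
have b0 : w (U z) `^ r != 0 by rewrite gt_eqF// powR_gt0.
by field; rewrite a0 b0.
Qed.

Let ratio_sign (a b : R) : 0 < a -> 0 < b -> 0 <= (a - b) * (a `^ r / b `^ r - 1).
Proof.
move=> a0 b0; have br : 0 < b `^ r by rewrite powR_gt0.
have [ab|/ltW ab] := leP b a.
  by rewrite mulr_ge0 ?subr_ge0// ler_pdivlMr// mul1r powR_le// ltW.
rewrite mulr_le0 ?subr_le0// ler_pdivrMr// mul1r powR_le// ltW//.
Qed.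

Lemma regular_profile_anti x y : x <= y -> U y <= U x.
Proof.
case: (sol_monotone solU) => mono xy; last exact: mono.
have [a Ua] := @regular_profile_onto 4^-1 ltac:(lra).
have [b Ub] := @regular_profile_onto (3 / 4) ltac:(lra).
have Ua1 : 0 < U a < 1 by lra.
have Ub1 : 0 < U b < 1 by lra.
have [ab|ba] := ltP a b; first by have := regular_profile_lt Ua1 Ub1 ab; lra.
by have := mono _ _ ba; lra.
Qed.

Let right_of z t : U z = s -> z < t -> 0 < U t -> 0 < U t < s.
Proof.
have s1 := s01; move=> Uz zt Ut; rewrite Ut lt_neqAle -{2}Uz regular_profile_anti ?ltW// andbT.
apply/eqP => e; have := @regular_profile_inj z t; rewrite Uz e => /(_ ltac:(lra) erefl).
by move: zt => /[swap] ->; rewrite ltxx.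
Qed.

Let left_of z t : U z = s -> t < z -> U t < 1 -> s < U t < 1.
Proof.
have s1 := s01; move=> Uz zt Ut; rewrite Ut andbT lt_neqAle -{2}Uz regular_profile_anti ?ltW// andbT.
apply/eqP => e; have := @regular_profile_inj z t; rewrite Uz -e => /(_ ltac:(lra) erefl).
by move: zt => /[swap] ->; rewrite ltxx.
Qed.

Let comp_U (w : R -> R) : continuous w -> continuous (fun x => w (U x)).
Proof. by move=> cw x; apply: (@continuous_comp _ _ _ U w); [exact: cU|exact: cw]. Qed.

Let cvg_comp_U (w : R -> R) (F : set_system R) (l : R) : continuous w ->
  U x @[x --> F] --> l -> w (U x) @[x --> F] --> w l.
Proof. by move=> cw UF; exact: (@cvg_comp _ _ _ U w F (nbhs l) (nbhs (w l)) UF (@cw l)). Qed.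

(** Where the two sides differ, their difference is driven away from 0 because g < 0
    on the levels below s, yet it tends to 0 at +oo; hence they agree. The next
    lemma is the mirror image, with g > 0 and -oo. *)
Lemma flux_right (w : R -> R) z : continuous w -> w 0 = 0 -> (forall u, 0 < u < s -> 0 < w u) ->
  (forall u, 0 < u < s -> u \notin J ++ K ->
     is_derive u 1 w (c - h u - f u / w u `^ r)) ->
  U z = s -> forall t, z <= t -> E t = w (U t).
Proof.
have s1 := s01; have [_ _ gneg _] := hg.
move=> cw w0 wp dw Uz t zt; apply/eqP; rewrite -subr_eq0; apply/eqP.
apply: (@vanish_of_repelled _ (fun x => E x - w (U x)) exceptional z) zt.
- by move=> x; apply: cvgB; [apply: cvgN; exact: cflux|exact: comp_U].
- rewrite -(subrr (0 : R)) -{1}oppr0 -{2}w0; apply: cvgB.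
    by apply: cvgN; exact: sol_flux_pinfty solU.
  by apply: cvg_comp_U => //; have [[]] := HU.
move=> {}t zt te Dt.
have Ut0 : 0 < U t.
  rewrite lt_neqAle eq_sym; have /andP[-> _] := U01 t; rewrite andbT.
  apply: contra Dt => /eqP e.
  have nU : ~ (0 < U t < 1) by rewrite e ltxx.
  by rewrite /= flux_outer// e w0 subr0 oppr0.
have Uts := right_of Uz zt Ut0; have Ut : 0 < U t < 1 by lra.
have UJK := exceptionalP Ut te.
have wt := wp _ Uts.
exists (g (U t) * (1 - E t `^ r / w (U t) `^ r)); first exact: defect_derive (dw _ Uts UJK).
have [Et _ _] := regular_point Ut te.
have := ratio_sign Et wt; have := gneg _ Uts.
set a := E t `^ r / w (U t) `^ r; set b := E t - w (U t); set G := g (U t) => G0 H.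
by rewrite mulrCA -[1 - a]opprB mulrN mulrN -mulNr mulr_ge0// oppr_ge0 ltW.
Qed.

Lemma flux_left (w : R -> R) z : continuous w -> w 1 = 0 -> (forall u, s < u < 1 -> 0 < w u) ->
  (forall u, s < u < 1 -> u \notin J ++ K ->
     is_derive u 1 w (c - h u - f u / w u `^ r)) ->
  U z = s -> forall t, t <= z -> E t = w (U t).
Proof.
have s1 := s01; have [_ _ _ gpos] := hg.
move=> cw w1 wp dw Uz t zt; apply/eqP; rewrite -subr_eq0; apply/eqP.
rewrite -[t]opprK.
apply: (@vanish_of_repelled _ (fun x => E (- x) - w (U (- x))) [seq - x | x <- exceptional] (- z)); last by rewrite lerN2.
- have cD : continuous (fun x => E x - w (U x)).
    by move=> x; apply: cvgB; [apply: cvgN; exact: cflux|exact: comp_U].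
  move=> x; apply: (@continuous_comp _ _ _ (fun x => - x) (fun x => E x - w (U x))); last exact: cD.
  by apply: cvgN; exact: cvg_id.
- have H : E x - w (U x) @[x --> -oo] --> (0 : R).
    rewrite -(subrr (0 : R)) -{1}oppr0 -{2}w1; apply: cvgB.
      by apply: cvgN; exact: sol_flux_ninfty solU.
    by apply: cvg_comp_U => //; have [[]] := HU.
  exact: (cvgNy_compNP _ _).1 H.
move=> {t zt} t zt te Dt.
have zt' : - t < z by rewrite ltrNl.
have te' : - t \notin exceptional.
  by apply: contra te => h'; apply/mapP; exists (- t); rewrite ?opprK.
have Ut1 : U (- t) < 1.
  rewrite lt_neqAle; have /andP[_ ->] := U01 (- t); rewrite andbT.
  apply: contra Dt => /eqP e.
  have nU : ~ (0 < U (- t) < 1) by rewrite e ltxx andbF.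
  by rewrite /= flux_outer// e w1 subr0 oppr0.
have Uts := left_of Uz zt' Ut1; have Ut : 0 < U (- t) < 1 by lra.
have UJK := exceptionalP Ut te'.
have wt := wp _ Uts.
exists (g (U (- t)) * (1 - E (- t) `^ r / w (U (- t)) `^ r) * (- 1)).
  exact: (deriv_comp (g := fun x => - x) (defect_derive Ut te' wt (dw _ Uts UJK))
    (deriv_opp (deriv_var t))).
have [Et _ _] := regular_point Ut te'.
have := ratio_sign Et wt; have := gpos _ Uts.
set a := E (- t) `^ r / w (U (- t)) `^ r; set b := E (- t) - w (U (- t)).
set G := g (U (- t)) => G0 H.
by rewrite mulrN1 -mulrN opprB mulrCA mulr_ge0// ltW.
Qed.

(** Once the flux is known as a function of U, the profile solves a separable
    equation, so it is the constructed one. *)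
Lemma regular_profile_eq (W : R -> R) : continuous W -> (forall u, 0 < u < 1 -> 0 < W u) ->
  (forall t, E t = W (U t)) -> U = profile_of r d W.
Proof.
move=> cW W0 EW.
have arr z : 0 < U z < 1 -> arrival r d W (U z) = - z.
  move=> Uz; pose a := Num.min (U z) 2^-1; pose b := Num.max (U z) 2^-1.
  have [ab a0 b1] : [/\ a <= b, 0 < a & b < 1].
    by rewrite /a /b; split; case: (leP (U z) 2^-1) => ?; lra.
  pose Q x := (arrival r d W \o clamp a b) (U x) + x.
  have cQ : continuous Q.
    move=> x; apply: cvgD; last exact: cvg_id.
    apply: comp_U; apply: clamp_continuous => //.
    apply: continuous_in_subspaceT => y; rewrite inE/= in_itv/= => yab.
    by apply: (arrival_continuous r0 hd cW W0); lra.
  have bnd x : Num.min 0 z <= x <= Num.max 0 z -> a <= U x <= b.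
    rewrite /a /b -regular_profile_half; case: (leP 0 z) => z0 /andP[x1 x2].
      have u1 := regular_profile_anti x1; have u2 := regular_profile_anti x2.
      by rewrite ge_min u2/= le_max u1 orbT.
    have u1 := regular_profile_anti x1; have u2 := regular_profile_anti x2.
    by rewrite ge_min u2 orbT/= le_max u1.
  have Qc : Q (Num.min 0 z) = Q (Num.max 0 z).
    apply: (@constant_of_derive0 _ Q exceptional) => //.
      by case: (leP 0 z) => ?; lra.
    move=> x x0z xe.
    have Ux : 0 < U x < 1 by have := bnd x; lra.
    have := exceptionalP Ux xe; rewrite mem_cat negb_or => /andP[UJ _].
    have [_ dU _] := regular_point Ux xe.
    rewrite EW in dU.
    have dA := deriv_add (deriv_comp (arrival_derive r0 hd cW W0 Ux UJ) dU) (deriv_var x).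
    have e0 : ((W (U x) / d (U x)) `^ r)^-1 * - (W (U x) / d (U x)) `^ r + 1 = 0.
      by rewrite mulrN mulVf ?addNr// gt_eqF// powR_gt0// divr_gt0 ?W0 ?d0.
    rewrite e0 in dA; apply: near_eq_is_derive dA.
    have : x \in `](Num.min 0 z), (Num.max 0 z)[ by rewrite in_itv.
    move=> /near_in_itvoo; apply: filterS => y; rewrite in_itv/= => y0z.
    by rewrite /Q /= clamp_id// bnd//; lra.
  have {}Qc : Q 0 = Q z by move: Qc; case: (leP 0 z).
  move: Qc; rewrite /Q /= !clamp_id.
  - by rewrite regular_profile_half (arrival_half r d W); lra.
  - by apply: bnd; case: (leP 0 z) => ?; lra.
  - by apply: bnd; case: (leP 0 z) => ?; lra.
pose V := profile_of r d W.
have V01 := profile_of_range r0 hd cW W0.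
apply/funext => z; have [Uz|nUz] := pselect (0 < U z < 1).
  by rewrite (profile_of_eq r0 hd cW W0 Uz (arr z Uz)).
have nVz : ~ (0 < V z < 1).
  move=> Vz; have [x Ux] := regular_profile_onto Vz.
  have := arr x; rewrite Ux => /(_ Vz); rewrite (profile_ofP Vz) => /oppr_inj xz.
  by apply: nUz; rewrite xz Ux.
have Vh := profile_of_half r0 hd cW W0; have Va := profile_of_anti r0 hd cW W0.
have := level_ends V01 nVz.
have [[z0 ->]|[z0 ->]] := regular_profile_outer nUz; case=> // e.
  by have := Va _ _ (ltW z0); move: e; rewrite Vh /V => ->; lra.
by have := Va _ _ (ltW z0); move: e; rewrite Vh /V => ->; lra.
Qed.

End GivenProfile.

(** * Speed estimates and conclusion *)

Section SpeedBounds.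
Context {R : realType}.
Implicit Types (t x : R).

Lemma limf_esup_bounded (phi : R -> \bar R) (F : set_system R) {FF : Filter F} :
  (limf_esup phi F < +oo)%E -> exists2 B : R, 0 < B & F [set t | (phi t <= B%:E)%E].
Proof.
move=> /ereal_inf_lt[_ [V FV <-] supV].
exists (Num.max 1 (fine (ereal_sup [set phi t | t in V]))); first by rewrite lt_max ltr01.
move: FV; apply: filterS => t Vt.
have phit : (phi t <= ereal_sup [set phi t | t in V])%E by apply: ereal_sup_ubound; exists t.
apply: (le_trans phit); move: supV phit; case: (ereal_sup _) => [x| |]//= _ _; last by rewrite leNye.
by rewrite lee_fin le_max lexx orbT.
Qed.

Variables (p p' : R).
Hypotheses (p1 : 1 < p) (pp' : p^-1 + p'^-1 = 1).
Notation r := ((p - 1)^-1).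

Lemma conjugate_exponentE : p' = 1 + r.
Proof.
have p0 : p != 0 by rewrite gt_eqF// ?subr_gt0//; exact: lt_trans p1.
have p10 : p - 1 != 0 by rewrite gt_eqF// subr_gt0.
have -> : p' = (p'^-1)^-1 by rewrite invrK.
have -> : p'^-1 = 1 - p^-1 by rewrite -pp' addrC addKr.
have -> : 1 - p^-1 = (p - 1) / p by rewrite mulrBl divff// mul1r.
by rewrite invf_div; field.
Qed.

(** The slope minimising lam + x / lam^r; the minimum is the constant of the
    speed estimates. *)
Lemma optimal_slope x : 0 < x -> exists2 lam, 0 < lam &
  lam + x / lam `^ r = p' `^ p'^-1 * p `^ p^-1 * x `^ p'^-1.
Proof.
move=> x0; have r0 : 0 < r := conjugate_exponent_gt0 p1.
have p'E := conjugate_exponentE; have p'0 : 0 < p' by rewrite p'E addr_gt0.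
have p0 : 0 < p by exact: lt_trans p1.
have pr : p' = p * r.
  by rewrite p'E; field; rewrite gt_eqF// subr_gt0.
have rx0 : 0 < r * x by rewrite mulr_gt0.
exists ((r * x) `^ p'^-1); first by rewrite powR_gt0.
set lam := (r * x) `^ p'^-1.
have lam0 : 0 < lam by rewrite powR_gt0.
have lamQ : lam * lam `^ r = r * x.
  rewrite -[X in X * _](powRr1 (ltW lam0)) -powRD; last by rewrite (gt_eqF lam0) implybT.
  by rewrite -p'E /lam -powRrM mulVf ?powRr1 ?(ltW rx0)// gt_eqF.
have lr0 : lam `^ r != 0 by rewrite gt_eqF// powR_gt0.
have -> : x / lam `^ r = lam / r.
  apply: (mulIf lr0); rewrite divfK//.
  by rewrite mulrAC lamQ mulrAC divff ?mul1r// gt_eqF.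
have -> : lam + lam / r = p * lam by rewrite invrK; ring.
rewrite /lam powRM ?(ltW r0) ?(ltW x0)// pr powRM ?(ltW p0) ?(ltW r0)//.
rewrite -[X in X * (_ * _) = _](powRr1 (ltW p0)) -[X in _ `^ X * (_ * _) = _]pp'.
rewrite powRD; last by rewrite (gt_eqF p0) implybT.
rewrite -pr; ring.
Qed.

End SpeedBounds.

Section Assembly.
Context {R : realType}.
Implicit Types (t u x z c : R).
Variables (p p' s : R) (g d h : R -> R) (n q : nat) (m k : nat -> R).
Hypotheses (p1 : 1 < p) (pp' : p^-1 + p'^-1 = 1) (s01 : 0 < s < 1).
Hypotheses (hg : standing_g s g) (hd : standing_d p g n m d).
Hypothesis hh : standing_h s q k h.
Notation r := ((p - 1)^-1).
Notation J := (jump_points n m).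
Notation K := (jump_points q k).
Notation f := (weighted_reaction r d g).

Let r0 : 0 < r := conjugate_exponent_gt0 p1.

Let p'E : p' - 1 = r.
Proof. by rewrite (conjugate_exponentE p1 pp') addrC addKr. Qed.

Let hdp : piecewise_positive J d. Proof. exact: standing_d_piecewise hd. Qed.

Let h_bounded : exists M, forall t, 0 <= t <= 1 -> `|h t| <= M.
Proof. by have [] := hh. Qed.

Let h_cont t : 0 < t < 1 -> t \notin K -> {for t, continuous h}.
Proof. by have [_ _ jh] := hh; exact: jumps_at_continuous jh. Qed.

Let h_int : (@lebesgue_measure R).-integrable `[0, 1] (EFin \o h).
Proof.
have [M HM] := h_bounded; apply: (@integrable_piecewise _ h 0 1 K M) => t t01.
  exact: h_cont.
by apply: HM; lra.
Qed.

Let f_int : (@lebesgue_measure R).-integrable `[0, 1] (EFin \o f).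
Proof. by have [_ _ fi _] := hd; exact: integrable_cc. Qed.

Let F := primitive f 0 1.
Let Hc := primitive h 0 1.

Let cF : continuous F. Proof. exact: primitive_continuous ler01 f_int. Qed.
Let cHc : continuous Hc. Proof. exact: primitive_continuous ler01 h_int. Qed.

Let dF t : 0 < t < 1 -> t \notin J ++ K -> is_derive t 1 F (f t).
Proof.
move=> t01; rewrite mem_cat negb_or => /andP[tJ _].
exact: (primitive_derive f_int t01 (weighted_reaction_continuous hg hdp t01 tJ)).
Qed.

Let dHc t : 0 < t < 1 -> t \notin K -> is_derive t 1 Hc (h t).
Proof. by move=> t01 tK; exact: (primitive_derive h_int t01 (h_cont t01 tK)). Qed.

Let dHc' t : 0 < t < 1 -> t \notin J ++ K -> is_derive t 1 Hc (h t).
Proof. by move=> t01; rewrite mem_cat negb_or => /andP[_]; exact: dHc. Qed.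

Let HcE u : 0 <= u <= 1 -> H_ h u = Hc u.
Proof.
move=> u01; rewrite /H_ (oriented_integralE h_int)//; last by rewrite lexx ler01.
by rewrite [X in _ - X]primitive0 ?ler01// subr0.
Qed.

Let f_neg := weighted_reaction_neg r s01 hg hdp.
Let f_pos := weighted_reaction_pos r s01 hg hdp.
Let f_low := weighted_reaction_low r0 s01 hg hdp.
Let f_s := weighted_reaction_continuous_zero r0 s01 hg hdp.
Let h_s : {for s, continuous h}. Proof. by have [] := hh. Qed.

Notation lwave := (left_wave r s (J ++ K) f h).
Notation rwave := (right_wave r s (J ++ K) f h).

Lemma mu_1_gt0 : (0 < mu_1 p p' s g d)%E.
Proof.
have s1 := s01; have s2 : 0 < s / 2 < s by lra.
apply: (@lt_le_trans _ _ (- f (s / 2) / (s - s / 2) `^ (p' - 1))%:E).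
  by rewrite lte_fin divr_gt0 ?oppr_gt0 ?f_neg// powR_gt0; lra.
by apply: ereal_sup_ubound; exists (s / 2) => //=; rewrite in_itv.
Qed.

Lemma mu_2_gt0 : (0 < mu_2 p p' s g d)%E.
Proof.
have s1 := s01; pose t := (s + 1) / 2; have t1 : s < t < 1 by rewrite /t; lra.
apply: (@lt_le_trans _ _ (f t / (t - s) `^ (p' - 1))%:E).
  by rewrite lte_fin divr_gt0 ?f_pos// powR_gt0; lra.
by apply: ereal_sup_ubound; exists t => //=; rewrite in_itv.
Qed.

Let h_m_le t : 0 < t < s -> h_m s h <= h t.
Proof.
have s1 := s01; have [M HM] := h_bounded => ts.
apply: ge_inf; last by exists t => //=; rewrite in_itv/=; lra.
exists (- M) => _ [x /= + <-]; rewrite in_itv/= => xs.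
by have := HM x; rewrite ler_norml; lra.
Qed.

Let h_M_ge t : s < t < 1 -> h t <= h_M s h.
Proof.
have s1 := s01; have [M HM] := h_bounded => ts.
apply: sup_upper_bound; last by exists t => //=; rewrite in_itv/=; lra.
split; first by exists (h 1), 1 => //=; rewrite in_itv/=; lra.
exists M => _ [x /= + <-]; rewrite in_itv/= => xs.
by have := HM x; rewrite ler_norml; lra.
Qed.

Notation C := (p' `^ p'^-1 * p `^ p^-1).

Let C0 : 0 < C.
Proof.
rewrite mulr_gt0// powR_gt0//; last exact: lt_trans p1.
by rewrite (conjugate_exponentE p1 pp') addr_gt0.
Qed.

Let p'V0 : p'^-1 != 0.
Proof. by rewrite invr_eq0 (conjugate_exponentE p1 pp') gt_eqF// addr_gt0. Qed.

Lemma speed_lower c w : lwave c w -> 0 < w s ->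
  ((h_m s h)%:E - C%:E * poweR (mu_1 p p' s g d) p'^-1 < c%:E)%E.
Proof.
have s1 := s01; move=> hw ws; have := mu_1_gt0.
have ub t : 0 < t < s -> ((- f t / (s - t) `^ (p' - 1))%:E <= mu_1 p p' s g d)%E.
  by move=> ts; apply: ereal_sup_ubound; exists t => //=; rewrite in_itv.
case: (mu_1 _ _ _ _ _) ub => [x| |] ub //; last first.
  by move=> _; rewrite /= (negbTE p'V0) gt0_muley ?lte_fin// addeNy ltNyr.
rewrite lte_fin => x0 /=; rewrite -?EFinM -?EFinB lte_fin ltNge; apply/negP => cle.
have [lam lam0 E] := optimal_slope p1 pp' x0.
suff : w s <= 0 by lra.
apply: (left_wave_upper r0 s01 _ lam0 (ltW x0) hw (kap := C * x `^ p'^-1)).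
- exact: f_neg.
- by move=> t ts; have := h_m_le ts; lra.
- move=> t ts; have := ub t ts; rewrite lee_fin p'E ler_pdivrMr//.
  by rewrite powR_gt0; lra.
- by rewrite E.
Qed.

Lemma speed_upper c w : rwave c w -> 0 < w (1 - s) ->
  (c%:E < (h_M s h)%:E + C%:E * poweR (mu_2 p p' s g d) p'^-1)%E.
Proof.
have s1 := s01; move=> hw ws; have := mu_2_gt0.
have ub t : s < t < 1 -> ((f t / (t - s) `^ (p' - 1))%:E <= mu_2 p p' s g d)%E.
  by move=> ts; apply: ereal_sup_ubound; exists t => //=; rewrite in_itv.
case: (mu_2 _ _ _ _ _) ub => [x| |] ub //; last first.
  by move=> _; rewrite /= (negbTE p'V0) gt0_muley ?lte_fin// addey// ltry.
rewrite lte_fin => x0 /=; rewrite -?EFinM -?EFinD lte_fin ltNge; apply/negP => cle.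
have [lam lam0 E] := optimal_slope p1 pp' x0.
suff : w (1 - s) <= 0 by lra.
apply: (right_wave_upper r0 s01 _ lam0 (ltW x0) hw (kap := C * x `^ p'^-1)).
- exact: f_pos.
- by move=> t ts; have := h_M_ge ts; lra.
- move=> t ts; have := ub t ts; rewrite lee_fin p'E ler_pdivrMr//.
  by rewrite powR_gt0; lra.
- by rewrite E.
Qed.

Let one_sided_condition :
  (-oo < liminf_left p p' s g d h)%E \/ (limsup_right p p' s g d h < +oo)%E ->
  exists B del : R, [/\ 0 < B, 0 < del &
  (forall t, s - del < t < s -> - (B * - f t) <= (s - t) `^ r * (h s - h t)) \/
  (forall t, s < t < s + del -> (t - s) `^ r * (h s - h t) <= B * f t)].
Proof.
have s1 := s01; case.
  rewrite /liminf_left /limf_einf lteNr /= => /limf_esup_bounded[B B0 HB].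
  have [e /= e0 He] := (nbhs_ballP _ _).1 HB.
  exists B, (Num.min e s); split; [by []|by rewrite lt_min e0; lra|left => t].
  rewrite ltrBlDr -ltrBlDl lt_min => /andP[/andP[te t0] ts].
  have := He t; rewrite /ball/= gtr0_norm ?subr_gt0// => /(_ ltac:(lra) ts).
  have ft : 0 < - f t by rewrite oppr_gt0 f_neg//; lra.
  by rewrite -?EFinN lee_fin p'E lerNl ler_pdivlMr//; rewrite mulNr.
move=> /limf_esup_bounded[B B0 HB].
have [e /= e0 He] := (nbhs_ballP _ _).1 HB.
exists B, (Num.min e (1 - s)); split; [by []|by rewrite lt_min e0; lra|right => t].
rewrite -ltrBlDl lt_min => /andP[ts /andP[te t0]].
have := He t; rewrite /ball/= ltr0_norm ?subr_lt0// => /(_ ltac:(lra) ts).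
have ft : 0 < f t by rewrite f_pos//; lra.
by rewrite lee_fin p'E ler_pdivrMr.
Qed.

(** Both half-waves evaluated at U give minus the flux at the point where U = s. *)
Let profile_matches c U wl wr : regular_profile p c g d h n q m k U ->
  lwave c wl -> rwave c wr -> wl s = wr (1 - s).
Proof.
have s1 := s01; move=> HU hl hr.
have [z Uz] := regular_profile_onto HU s01.
have [cwl wl0 wlp dwl] := hl; have [cwr wr0 wrp dwr] := hr.
have dwl' u : 0 < u < s -> u \notin J ++ K ->
    is_derive u 1 wl (c - h u - f u / wl u `^ r).
  by move=> us uJK; have := dwl u us uJK; rewrite mulNr.
have cwr' : continuous (fun u : R => wr (1 - u)).
  move=> x; apply: (@continuous_comp _ _ _ (fun t : R => 1 - t) wr); last exact: cwr.
  by apply: cvgB; [exact: cvg_cst|exact: cvg_id].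
have wr1 : wr (1 - 1) = 0 by rewrite subrr.
have wrp' u : s < u < 1 -> 0 < wr (1 - u) by move=> us; apply: wrp; lra.
have dwr' u : s < u < 1 -> u \notin J ++ K ->
    is_derive u 1 (fun u => wr (1 - u)) (c - h u - f u / wr (1 - u) `^ r).
  move=> us uJK; have us' : 0 < 1 - u < 1 - s by lra.
  have uS : 1 - u \notin [seq 1 - t | t <- J ++ K].
    by apply: contra uJK => /mapP[x xS /(congr1 (fun y => 1 - y))]; rewrite !subKr => ->.
  have := deriv_comp (g := fun t : R => 1 - t) (dwr _ us' uS)
    (deriv_sub (deriv_const 1 u) (deriv_var u)).
  by rewrite subKr; congr (is_derive _ _ _ _); ring.
have := flux_right p1 hdp s01 hg HU cwl wl0 wlp dwl' Uz (lexx z).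
have := flux_left p1 hdp s01 hg HU cwr' wr1 wrp' dwr' Uz (lexx z).
by rewrite Uz => -> ->.
Qed.

Theorem wave_speed :
  (-oo < liminf_left p p' s g d h)%E \/ (limsup_right p p' s g d h < +oo)%E ->
  exists cstar : R,
    ((h_m s h)%:E - C%:E * poweR (mu_1 p p' s g d) p'^-1 < cstar%:E
     < (h_M s h)%:E + C%:E * poweR (mu_2 p p' s g d) p'^-1)%E
    /\ forall c : R,
         (exists! U : R -> R, regular_profile p c g d h n q m k U) <-> c = cstar.
Proof.
move=> /one_sided_condition[B [del [B0 del0 Hlim]]].
have s1 := s01; have [M hM] := h_bounded.
have [c [wl [wr [hl hr e]]]] :=
  matching_speed_exists r0 s01 cF cHc dF dHc' hM f_neg f_pos f_low.
have wp : 0 < wl s by exact: (matching_value_pos r0 s01 f_neg f_pos h_s B0 del0 Hlim hl hr e).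
exists c; split; first by rewrite (speed_lower hl wp) (speed_upper hr)// -e.
move=> c'; split=> [[U [HU _]]|->{c'}].
  have [wl' hl'] := left_wave_exists r0 s01 cF cHc dF dHc' hM f_neg f_low c'.
  have [wr' hr'] := right_wave_exists r0 s01 cF cHc dF dHc' hM f_pos f_low c'.
  exact: (matching_speed_unique r0 s01 cF dF f_neg f_pos hl hr e wp hl' hr' (profile_matches HU hl' hr')).
have [W [cW [W0 W1] Wp dW _]] := glue_waves s01 h_s f_s hl hr e wp.
have [cg [g0 _ g1] _ _] := hg; have [_ [sm _ _] _ _] := hd;
exists (profile_of r d W); split.
  exact: (profile_of_regular p1 hdp sm cg g0 g1 cW W0 W1 Wp dW cHc HcE dHc).
move=> U HU; apply/esym; apply: (regular_profile_eq p1 hdp HU cW Wp) => t.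
have [z Uz] := regular_profile_onto HU s01.
have [zt|/ltW tz] := leP z t.
  by apply: (flux_right p1 hdp s01 hg HU cW W0 _ _ Uz zt) => u us; [apply: Wp|apply: dW]; lra.
by apply: (flux_left p1 hdp s01 hg HU cW W1 _ _ Uz tz) => u us; [apply: Wp|apply: dW]; lra.
Qed.

End Assembly.

Theorem theorem2p1 (R : realType) (p p' sstar : R) (g d h : R -> R)
  (r q : nat) (m k : nat -> R)
  (p_gt1 : 1 < p) (pp' : p^-1 + p'^-1 = 1) (sstar01 : 0 < sstar < 1)
  (hg : standing_g sstar g) (hd : standing_d p g r m d)
  (hh : standing_h sstar q k h)
  (hlim : (-oo < liminf_left p p' sstar g d h)%E
            \/ (limsup_right p p' sstar g d h < +oo)%E) :
  [/\ (0 < mu_1 p p' sstar g d)%E,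
      (0 < mu_2 p p' sstar g d)%E &
  exists cstar : R,
    ((h_m sstar h)%:E
       - (p' `^ p'^-1 * p `^ p^-1)%R%:E * poweR (mu_1 p p' sstar g d) p'^-1
     < cstar%:E
     < (h_M sstar h)%:E
       + (p' `^ p'^-1 * p `^ p^-1)%R%:E * poweR (mu_2 p p' sstar g d) p'^-1)%E
    /\ forall c : R,
         (exists! U : R -> R, regular_profile p c g d h r q m k U)
           <-> c = cstar].
Proof.
split.
- exact: (mu_1_gt0 p' sstar01 hg hd).
- exact: (mu_2_gt0 p' sstar01 hg hd).
- exact: (wave_speed p_gt1 pp' sstar01 hg hd hh hlim).
Qed.
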